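(* Let $\{\ell_n\}_{n\ge1}$ be a decreasing sequence of positive numbers tending to $0$ such that there are constants $0<M_0\le M_1<\infty$ with $M_0/n\le \ell_n\le M_1/n$ for every $n$. Consider the Brownian circle covering model with lengths $\{\ell_n\}$, with associated random sets $F_t\subseteq C$, and let $u_n=\prod_{k=1}^n(1-\ell_k)$ and $\beta_0=\inf\{\beta:\sum_{n=1}^\infty e^{\ell_1+\cdots+\ell_n}/n^{1+\beta}<\infty\}$. Fix $x\in C$. (i) If $\ell_1\le 1/2$ and $\liminf_{n} n^2u_n<\infty$, then $P(\exists t\in[0,1]: x\in F_t)=0$. In particular, if $\ell_n=c/n$ for all $n$ (without requiring $\ell_1\le1/2$), then $P(\exists t\in[0,1]: x\in F_t)=0$ whenever $c\ge2$. (ii) If $\sum_{n=1}^\infty e^{\ell_1+\ell_2+\cdots+\ell_n}/n^3<\infty$, then $P(\exists t\in[0,1]:x\in F_t)=1$. In particular, if $\ell_n=c/n$ for all $n$, then this holds if $0<c<2$. (iii) Almost surely, $$\mathrm{HD}(\{t\in[0,1]:x\in F_t\})=\max\left\{1-\frac{\beta_0}{2},\,0\right\}.$$ In particular, if $\ell_n=c/n$ for all $n$ with $0<c\le2$, then $\mathrm{HD}(\{t\in[0,1]:x\in F_t\})=1-\frac c2$ almost surely.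
   Context: $C$ is the circle of circumference $1$, viewed as the quotient of $\mathbb{R}$ by $\mathbb{Z}$ via $u\mapsto \frac1{2\pi}(\cos 2\pi u,\sin2\pi u)$, with arclength metric. Brownian model: $\{U_{n,t}\}_{t\ge0}$, $n\ge1$, are independent Brownian motions on $C$ (the projections to $C$ of Brownian motions on $\mathbb{R}$ with variance $1$ per unit time, with continuous paths), each started from the uniform distribution on $C$. For each $n$ and $t$, $I_{n,t}$ is the open arc of $C$ with center $U_{n,t}$ and length $\ell_n$ (an arc of length greater than $1$ is all of $C$). Put $E_t:=\limsup_n I_{n,t}$ (the set of points belonging to $I_{n,t}$ for infinitely many $n$) and $F_t:=C\setminus E_t$. $\mathrm{HD}$ denotes Hausdorff dimension, with $\mathrm{HD}(\varnothing)=0$. *)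

(* Defs.v *)
From HB Require Import structures.
From mathcomp Require Import all_boot all_order all_algebra.
From mathcomp Require Import generic_quotient finmap.
From mathcomp Require Import all_classical all_reals all_analysis.

Set Implicit Arguments.
Unset Strict Implicit.
Unset Printing Implicit Defensive.

Import Order.TTheory GRing.Theory Num.Theory.
Import numFieldNormedType.Exports.

Local Open Scope classical_set_scope.
Local Open Scope ring_scope.

Section Circle.
Local Open Scope quotient_scope.
Variable R : realType.

Definition eqmod1 (u v : R) : bool := (u - v) \is a Num.int.

Lemma eqmod1_refl : reflexive eqmod1.
Proof. by move=> u; rewrite /eqmod1 subrr rpred0. Qed.

Lemma eqmod1_sym : symmetric eqmod1.
Proof. by move=> u v; rewrite /eqmod1 -opprB rpredN. Qed.

Lemma eqmod1_trans : transitive eqmod1.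
Proof.
by move=> v u w uv vw; rewrite /eqmod1 -(subrKA v) rpredD.
Qed.

Canonical eqmod1_equiv := EquivRel eqmod1 eqmod1_refl eqmod1_sym eqmod1_trans.

Definition circle : Type := quotient_topology {eq_quot eqmod1}.
HB.instance Definition _ := Topological.on circle.
HB.instance Definition _ := Quotient.on circle.

Definition circle_proj (u : R) : circle := \pi_circle u.

(* The quotient metric: on the circle of circumference 1, the length of the
   shorter of the two arcs from x to y. *)
Definition circle_dist (x y : circle) : R :=
  inf [set r | exists u v : R,
    [/\ circle_proj u = x, circle_proj v = y & r = `|u - v|]].

(* The open arc of length l centered at c. Distances are at most 1/2, so this
   is the whole circle as soon as 1 < l. *)
Definition circle_arc (c : circle) (l : R) : set circle :=
  [set y | circle_dist c y < l / 2].

Definition circle_borel : set (set circle) := <<s (@open circle) >>.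

End Circle.

Section Processes.
Context d (Omega : measurableType d) (R : realType) (P : probability Omega R).
Local Open Scope ereal_scope.

Definition process_sigma (S : Type) (G : set (set S)) (J : set R)
    (X : R -> Omega -> S) : set (set Omega) :=
  <<s \bigcup_(t in J) preimage_set_system setT (X t) G >>.

Definition mutually_independent (D : set nat) (F : nat -> set (set Omega)) :=
  forall (J : {fset nat}) (E : nat -> set Omega), [set` J] `<=` D ->
    (forall n, n \in J -> F n (E n)) ->
    P (\bigcap_(n in [set` J]) E n) = \big[*%E/1]_(n <- J) P (E n).

(* Only times t >= 0 matter, and the law of B 0 is left free.
   The second parameter of normal_prob is the standard deviation. *)
Record brownian_motion (B : R -> Omega -> R) : Prop := BrownianMotion {
  bm_measurable : forall t : R, (0 <= t)%R -> measurable_fun setT (B t) ;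
  bm_continuous : forall w, {within `[0%R, +oo[, continuous (B ^~ w)} ;
  bm_gaussian : forall (s t : R) (A : set R), (0 <= s < t)%R ->
    measurable A ->
    P ((B t \- B s)%R @^-1` A) = normal_prob 0%R (Num.sqrt (t - s)%R) A ;
  bm_indep : forall (s t : R) (E : set Omega) (A : set R), (0 <= s < t)%R ->
    process_sigma measurable `[0%R, s] B E -> measurable A ->
    P (E `&` (B t \- B s)%R @^-1` A) = P E * P ((B t \- B s)%R @^-1` A) }.

Definition circle_brownian_motion (U : R -> Omega -> circle R) : Prop :=
  exists2 B, brownian_motion B &
    forall (t : R) w, (0 <= t)%R -> U t w = circle_proj (B t w).

Definition uniform_circle (X : Omega -> circle R) : Prop :=
  forall A, circle_borel A ->
    P (X @^-1` A) = uniform_prob (@ltr01 R) (@circle_proj R @^-1` A).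

(* The process U 0 is unused: indices start at 1. *)
Record brownian_circle_model (U : nat -> R -> Omega -> circle R) : Prop :=
  BrownianCircleModel {
    bcm_brownian : forall n, (1 <= n)%N -> circle_brownian_motion (U n) ;
    bcm_uniform : forall n, (1 <= n)%N -> uniform_circle (U n 0%R) ;
    bcm_indep : mutually_independent [set n | (1 <= n)%N]
      (fun n => process_sigma (@circle_borel R) `[0%R, +oo[ (U n)) }.

Definition covered_set (ell : nat -> R) (U : nat -> R -> Omega -> circle R)
    (t : R) (w : Omega) : set (circle R) :=
  lim_sup_set (fun n => circle_arc (U n t w) (ell n)).

Definition uncovered_set (ell : nat -> R) (U : nat -> R -> Omega -> circle R)
    (t : R) (w : Omega) : set (circle R) := ~` covered_set ell U t w.

Definition exceptional_times (ell : nat -> R)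
    (U : nat -> R -> Omega -> circle R) (x : circle R) (w : Omega) : set R :=
  [set t | (0 <= t <= 1)%R /\ uncovered_set ell U t w x].

End Processes.

Section HausdorffDimension.
Variable R : realType.
Local Open Scope ereal_scope.
Implicit Types (A : set R) (s delta : R).

(* The 0 makes the diameter of the empty set 0 instead of -oo. *)
Definition ediam A : \bar R :=
  ereal_sup (0 |` [set (`|p.1 - p.2|%R)%:E | p in A `*` A]).

Definition hausdorff_content s delta A : \bar R :=
  ereal_inf [set \sum_(0 <= i <oo) (ediam (V i) `^ s) |
    V in [set V : nat -> set R |
      A `<=` \bigcup_i V i /\ forall i, ediam (V i) <= delta%:E]].

Definition hausdorff_measure s A : \bar R :=
  ereal_sup [set hausdorff_content s delta A | delta in `]0%R, +oo[].

(* The exponent 0 is left out of the infimum, which avoids 0 `^ 0 = 1;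
   the empty set has dimension 0. *)
Definition hausdorff_dim A : \bar R :=
  ereal_inf [set s%:E | s in [set s : R | (0 < s)%R /\
                                         hausdorff_measure s A = 0]].

End HausdorffDimension.

Section LengthSequence.
Variables (R : realType) (ell : nat -> R).

Definition uprod (n : nat) : R := \prod_(1 <= k < n.+1) (1 - ell k).

Definition expsum (n : nat) : R := expR (\sum_(1 <= k < n.+1) ell k).

Definition beta0 : R :=
  inf [set beta : R |
    (\sum_(1 <= n <oo) (expsum n / n%:R `^ (1 + beta))%:E < +oo)%E].

End LengthSequence.

(* Main.v *)
(* Fix x, let D_n(t) be the distance from x to the centre U_{n,t}, and put
   S_n = ell_1 + ... + ell_n. Then x is in F_t iff D_n(t) >= ell_n / 2 for all
   large n. The D_n are independent, P(D_n(t) < r) = 2r, and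
   P(D_n(s) < r, D_n(t) < r) = O(r^2 / sqrt |t - s|), while D_n moves from below
   r to above r within time h with probability O(sqrt h).

   Upper bounds. Cut [0, 1] into n^2 intervals. The expected number of those in
   which each of the arcs N, ..., n leaves x uncovered at some time is
   O(n^2 e^{-S_n}), which bounds the Hausdorff measures. If n^2 e^{-S_n} stays
   bounded along a subsequence, then boundedly many intervals survive, and the
   arcs n + 1, ..., 2n cover all of them with probability bounded below; so
   the probability that x stays uncovered at some time tends to 0.

   Lower bounds. Spread mass over the grid times i/q at which the arcs N, ..., n
   leave x uncovered. Two such times at distance about k^{-2} have correlation
   O(e^{S_k}), so the a-energy has bounded mean when
   sum_k e^{S_k} k^{2a - 3} is finite, and the total mass has variance close to
   0 for N large. On an event of probability close to 1 the mass is at least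
   1/2 and the energy is bounded for infinitely many n. By compactness a cover
   of the uncovered times by open intervals contains the grid times that
   survive up to n once n is large, and the energy bound makes it expensive. *)
Require Import Defs.
From HB Require Import structures.
From mathcomp Require Import all_boot all_order all_algebra.
From mathcomp Require Import finmap generic_quotient.
From mathcomp Require Import all_classical all_reals all_analysis.
From mathcomp Require Import measurable_realfun.
From mathcomp Require Import ring lra zify.
Set Implicit Arguments.
Unset Strict Implicit.
Unset Printing Implicit Defensive.
Import Order.TTheory GRing.Theory Num.Theory.
Import numFieldNormedType.Exports.
Local Open Scope classical_set_scope.
Local Open Scope ring_scope.

(** * Probability and independence *)

(** The mesh is forced by Brownian scaling: in time n^{-2} a centre moves by about 1/n, the order of
    the n-th arc. Leaving an arc within a mesh interval then costs a correction O(1/n) for each of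
    at most n arcs, hence only a bounded factor in the product. Independence is used between
    different arcs. For a single arc only three estimates enter: its law at one time, at two times,
    and its exit from a ball. Two obstacles shape the rest. Existence of an uncovered time is an
    uncountable union; since the conditions are closed and the paths continuous, compactness of
    [0, 1] makes it measurable and identifies survival past every finite stage with survival for
    ever. And no limit measure is constructed: a set of measure zero has covers of arbitrarily small
    cost, and such a cover is contradicted by the discrete energy at one finite stage. No zero-one
    law is invoked. Discarding finitely many arcs does not change F_t, so N may grow with the wanted
    precision while the exceptional set contains the uncovered times of every N; probability 1
    arises as a limit of 1 - eps. *)

Section ProbabilityValue.
Context d (Omega : measurableType d) (R : realType) (P : probability Omega R).
Implicit Types A B : set Omega.

Definition pr A : R := fine (P A).

Lemma prE A : measurable A -> P A = (pr A)%:E.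
Proof. by move=> mA; rewrite /pr fineK// fin_num_measure. Qed.

Lemma pr_ge0 A : 0 <= pr A.
Proof. by rewrite /pr fine_ge0. Qed.

Lemma pr_le1 A : measurable A -> pr A <= 1.
Proof. by move=> mA; rewrite -lee_fin -prE// probability_le1. Qed.

Lemma pr_mono A B : measurable A -> measurable B -> A `<=` B -> pr A <= pr B.
Proof.
by move=> mA mB AB; rewrite -lee_fin -!prE//; apply: le_measure => //; rewrite inE.
Qed.

Lemma pr_set0 : pr set0 = 0.
Proof. by rewrite /pr measure0. Qed.

Lemma pr_setT : pr setT = 1.
Proof. by rewrite /pr probability_setT. Qed.

Lemma pr_comb_integral (I : eqType) (s : seq I) (c : I -> R) (E : I -> set Omega) :
  (forall i, measurable (E i)) ->
  P.-integrable setT (EFin \o (fun w => \sum_(i <- s) c i * \1_(E i) w)) /\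
  (\int[P]_w (\sum_(i <- s) c i * \1_(E i) w)%:E = (\sum_(i <- s) c i * pr (E i))%:E)%E.
Proof.
move=> mE; elim: s => [|i s [IHi IHe]].
  split; last by under eq_integral do rewrite big_nil; rewrite integral0 big_nil.
  rewrite (_ : _ \o _ = cst 0%E); first exact: integrable0.
  by apply/funext => w /=; rewrite big_nil.
have intE : P.-integrable setT (EFin \o (\1_(E i) : Omega -> R)).
  by apply: integrable_indic => //; rewrite ltey_eq fin_num_measure.
have intZ : P.-integrable setT (fun w => ((c i)%:E * (\1_(E i) w : R)%:E)%E).
  exact: integrableZl.
have e w : (\sum_(j <- i :: s) c j * \1_(E j) w)%:E =
    ((c i)%:E * (\1_(E i) w : R)%:E + (\sum_(j <- s) c j * \1_(E j) w)%:E)%E.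
  by rewrite big_cons EFinD EFinM.
split.
  have -> : EFin \o (fun w => \sum_(j <- i :: s) c j * \1_(E j) w) =
      ((fun w => (c i)%:E * (\1_(E i) w : R)%:E)
       \+ (EFin \o (fun w => (\sum_(j <- s) c j * \1_(E j) w)%R)))%E.
    by apply/funext => w; rewrite /= e.
  exact: integrableD.
under eq_integral do rewrite e.
rewrite integralD//= IHe integralZl// integral_indic// setIT.
by rewrite big_cons EFinD EFinM -(prE (mE i)).
Qed.

(* The finite union, Markov and Chebyshev inequalities are instances. *)
Lemma pr_comb_le (I J : eqType) (s : seq I) (t : seq J) (c : I -> R) (c' : J -> R)
    (E : I -> set Omega) (E' : J -> set Omega) :
  (forall i, measurable (E i)) -> (forall i, measurable (E' i)) ->
  (forall w, \sum_(i <- s) c i * \1_(E i) w <= \sum_(i <- t) c' i * \1_(E' i) w) ->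
  \sum_(i <- s) c i * pr (E i) <= \sum_(i <- t) c' i * pr (E' i).
Proof.
move=> mE mE' h; rewrite -lee_fin -(pr_comb_integral s c mE).2 -(pr_comb_integral t c' mE').2.
apply: le_integral => //.
- exact: (pr_comb_integral s c mE).1.
- exact: (pr_comb_integral t c' mE').1.
- by move=> w _; rewrite lee_fin.
Qed.

Lemma pr_le_sum (J : eqType) A (t : seq J) (c : J -> R) (E : J -> set Omega) :
  measurable A -> (forall i, measurable (E i)) ->
  (forall w, \1_A w <= \sum_(i <- t) c i * \1_(E i) w) ->
  pr A <= \sum_(i <- t) c i * pr (E i).
Proof.
move=> mA mE h; have := @pr_comb_le _ _ [:: tt] t (fun=> 1) c (fun=> A) E.
rewrite big_seq1 mul1r; apply => // w; rewrite big_seq1 mul1r; exact: h.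
Qed.

Lemma pr_cover (J : eqType) A (t : seq J) (E : J -> set Omega) :
  measurable A -> (forall i, measurable (E i)) ->
  (forall w, A w -> exists2 i, i \in t & E i w) ->
  pr A <= \sum_(i <- t) pr (E i).
Proof.
move=> mA mE h; rewrite [leRHS](_ : _ = \sum_(i <- t) 1 * pr (E i)); last first.
  by apply: eq_bigr => i _; rewrite mul1r.
apply: pr_le_sum => // w; have [/set_mem Aw|] := boolP (w \in A); last first.
  by move=> /negbTE Aw; rewrite indicE Aw sumr_ge0.
have [i it Eiw] := h _ Aw.
rewrite indicE mem_set// big_seq (big_rem i)//= it indicE mem_set// mul1r lerDl.
by rewrite sumr_ge0.
Qed.

Lemma pr_sum_le (J : eqType) A (t : seq J) (E : J -> set Omega) :
  measurable A -> (forall i, measurable (E i)) ->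
  (forall w, \sum_(i <- t) (\1_(E i) w : R) <= \1_A w) ->
  \sum_(i <- t) pr (E i) <= pr A.
Proof.
move=> mA mE h; have := @pr_comb_le _ _ t [:: tt] (fun=> 1) (fun=> 1) E (fun=> A).
rewrite big_seq1 mul1r; under eq_bigr do rewrite mul1r; apply => // w.
by rewrite big_seq1 mul1r; under eq_bigr do rewrite mul1r; exact: h.
Qed.

Lemma prU_le A B : measurable A -> measurable B -> pr (A `|` B) <= pr A + pr B.
Proof.
move=> mA mB; have := @pr_cover _ (A `|` B) [:: true; false]
  (fun b => if b then A else B).
rewrite !big_cons big_nil addr0; apply; first exact: measurableU.
  by case.
by move=> w [Aw|Bw]; [exists true|exists false].
Qed.

Lemma pr_setC A : measurable A -> pr (~` A) = 1 - pr A.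
Proof.
by move=> mA; apply: EFin_inj; rewrite -prE; [rewrite probability_setC// EFinB -prE|exact: measurableC].
Qed.

Lemma prD A B : measurable A -> measurable B -> pr (A `&` ~` B) = pr A - pr (A `&` B).
Proof.
move=> mA mB; apply: EFin_inj; rewrite EFinB -!prE ?setIA//.
- by rewrite -setDE measureD// ltey_eq fin_num_measure.
- exact: measurableI.
- by apply: measurableI => //; exact: measurableC.
Qed.

Lemma pr_image_partition (I : finType) A (f : Omega -> I) :
  measurable A -> (forall i, measurable [set w | f w = i]) ->
  pr A = \sum_i pr (A `&` [set w | f w = i]).
Proof.
move=> mA mf.
have mE i : measurable (A `&` [set w | f w = i]) by exact: measurableI.
have key w : \sum_i (\1_(A `&` [set w | f w = i]) w : R) = \1_A w.
  rewrite (bigD1 (f w))//= big1; last first.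
    move=> i /negbTE fi; rewrite indicE (_ : _ \in _ = false)//.
    apply/negbTE; rewrite notin_setE => -[_] /= fw.
    by rewrite -fw eqxx in fi.
  rewrite addr0 !indicE; congr ((nat_of_bool _)%:R).
  by apply/idP/idP; rewrite !inE => //=; case.
apply/eqP; rewrite eq_le; apply/andP; split.
- rewrite [leRHS](_ : _ = \sum_i 1 * pr (A `&` [set w | f w = i])); last first.
    by apply: eq_bigr => i _; rewrite mul1r.
  by apply: pr_le_sum => // w; under eq_bigr do rewrite mul1r; rewrite key.
- by apply: pr_sum_le => // w; rewrite key.
Qed.

End ProbabilityValue.

Section SigmaAlgebraClosure.
Variables (T : Type) (F : set (set T)).
Hypothesis sF : sigma_algebra setT F.

Lemma sigmaC A : F A -> F (~` A).
Proof. by case: sF => _ + _ => h /h; rewrite setTD. Qed.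

Lemma sigma0 : F set0.
Proof. by case: sF. Qed.

Lemma sigmaT : F setT.
Proof. by rewrite -setC0; exact/sigmaC/sigma0. Qed.

(** Any countable index type is allowed, through [pickle]: the unions below run over rationals,
    integers, pairs of naturals and finite sets. *)
Lemma sigma_bigcup (I : countType) (D : set I) (A : I -> set T) :
  (forall i, D i -> F (A i)) -> F (\bigcup_(i in D) A i).
Proof.
move=> FA; case: sF => F0 _ FU.
pose B n := if (choice.unpickle n : option I) is Some i then if i \in D then A i else set0 else set0.
rewrite (_ : \bigcup_(i in D) A i = \bigcup_n B n).
  apply: FU => n; rewrite /B; case: (choice.unpickle n : option I) => // i.
  by case: ifPn => // /set_mem /FA.
apply/seteqP; split => x /=.
  by move=> [i Di Ax]; exists (choice.pickle i) => //; rewrite /B choice.pickleK mem_set.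
move=> [n _]; rewrite /B; case: (choice.unpickle n : option I) => // i.
by case: ifPn => // /set_mem Di Ax; exists i.
Qed.

Lemma sigma_bigcap (I : countType) (D : set I) (A : I -> set T) :
  (forall i, D i -> F (A i)) -> F (\bigcap_(i in D) A i).
Proof.
move=> FA; rewrite -(setCK (\bigcap_(i in D) A i)) setC_bigcap.
by apply/sigmaC/sigma_bigcup => i Di; exact/sigmaC/FA.
Qed.

Lemma sigmaI A B : F A -> F B -> F (A `&` B).
Proof.
move=> FA FB; rewrite (_ : _ `&` _ = \bigcap_(b in [set: bool]) if b then A else B).
  by apply: sigma_bigcap => -[].
apply/seteqP; split => x /=; first by move=> [Ax Bx] [].
by move=> h; split; [exact: (h true)|exact: (h false)].
Qed.

Lemma sigmaU A B : F A -> F B -> F (A `|` B).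
Proof.
move=> FA FB; rewrite -(setCK (_ `|` _)) setCU.
by apply/sigmaC/sigmaI; exact: sigmaC.
Qed.

End SigmaAlgebraClosure.

Section Independence.
Context d (Omega : measurableType d) (R : realType) (P : probability Omega R).
Local Notation pr := (pr P).

(** Dynkin's pi-lambda argument: the events independent of [C] form a lambda-system, so independence
    on the pi-system [G] spreads to the sigma-algebra it generates. *)
Lemma indep_generated (G : set (set Omega)) (C : set Omega) :
  setI_closed G -> G `<=` measurable -> measurable C ->
  (forall A, G A -> pr (A `&` C) = pr A * pr C) ->
  forall A, <<s G >> A -> measurable A /\ pr (A `&` C) = pr A * pr C.
Proof.
move=> GI Gm mC GC.
pose H := [set A | measurable A /\ pr (A `&` C) = pr A * pr C].
have HS : lambda_system setT H.
  split.
  - by move=> A _.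
  - by split; [exact: measurableT | rewrite setTI pr_setT mul1r].
  - move=> A B BA [mA hA] [mB hB]; split; first exact: measurableD.
    rewrite setDE prD// (setIidr BA) mulrBl -hA -hB.
    have -> : B `&` C = (A `&` C) `&` (B `&` C).
      by apply/seteqP; split => w /=; [move=> [/[dup] /BA]|]; tauto.
    rewrite -prD; [|exact: measurableI..].
    congr pr; apply/seteqP; split => w /=; first by tauto.
    by move=> [[Aw Cw]] h; split => //; split => // Bw; apply: h.
  - move=> A ndA HA; split; first by apply: bigcup_measurable => n _; case: (HA n).
    have cA : (P \o A) x @[x --> \oo] --> P (\bigcup_n A n).
      apply: nondecreasing_cvg_mu => //.
        by move=> i; case: (HA i).
      by apply: bigcup_measurable => n _; case: (HA n).
    have cAC : (P \o (fun n => A n `&` C)) x @[x --> \oo] --> P (\bigcup_n (A n `&` C)).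
      apply: nondecreasing_cvg_mu => //.
      - by move=> i; apply: measurableI => //; case: (HA i).
      - by apply: bigcup_measurable => n _; apply: measurableI => //; case: (HA n).
      - move=> m n mn; apply/subsetPset; apply: setSI; exact/subsetPset/ndA.
    rewrite setI_bigcupl.
    apply: EFin_inj; rewrite EFinM -!prE//; last 2 first.
    + by apply: bigcup_measurable => n _; case: (HA n).
    + by apply: bigcup_measurable => n _; apply: measurableI => //; case: (HA n).
    have cAM : (P (A x) * P C)%E @[x --> \oo] --> (P (\bigcup_n A n) * P C)%E.
      apply: cvgeZr => //; by rewrite fin_num_measure.
    apply: cvg_unique cAM; first exact: ereal_hausdorff.
    have -> : (fun x => (P (A x) * P C)%E) = P \o (fun n => A n `&` C).
      apply/funext => n /=; case: (HA n) => mA hA.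
      by rewrite !prE ?hA//; exact: measurableI.
    exact: cAC.
move=> A sA; apply: (@lambda_system_subset _ G GI setT H HS _ _ A sA) => //.
by move=> B GB; split; [exact: Gm|exact: GC].
Qed.

Lemma mutually_independent_pr (D : set nat) (F : nat -> set (set Omega))
    (s : seq nat) (E : nat -> set Omega) :
  mutually_independent P D F -> (forall n, D n -> F n `<=` measurable) ->
  uniq s -> (forall n, n \in s -> D n /\ F n (E n)) ->
  pr (\bigcap_(n in [set n | n \in s]) E n) = \prod_(n <- s) pr (E n).
Proof.
move=> indep Fm us FE; rewrite /pr.
have -> : [set n | n \in s] = [set` [fset n in s]%fset].
  by apply/seteqP; split => n /=; rewrite inE.
rewrite indep; last 2 first.
- by move=> n /=; rewrite inE => /FE[].
- by move=> n /=; rewrite inE => /FE[].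
rewrite (perm_big s)/=; last first.
  by apply: uniq_perm; rewrite ?fset_uniq// => n; rewrite inE.
elim: s us FE => [|n s IH]; first by rewrite !big_nil.
move=> /= /andP[_ us] FE; rewrite !big_cons.
have [Dn Fn] := FE n (mem_head _ _).
rewrite fineM ?IH//.
- by move=> m ms; apply: FE; rewrite inE ms orbT.
- by rewrite fin_num_measure//; exact: Fm Fn.
- rewrite big_seq; apply: (big_ind (fun x => x \is a fin_num)) => //.
    by move=> x y; exact: fin_numM.
  move=> m ms; have [Dm Fmm] := FE m (mem_behead (s := n :: s) ms).
  by rewrite fin_num_measure//; exact: Fm Fmm.
Qed.

(** The intersections of one event per index below [k] form a pi-system that generates the past; on
    it independence is the product formula with one more factor. *)
Lemma indep_past (F : nat -> set (set Omega)) (k : nat) (E C : set Omega) :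
  mutually_independent P [set n | (1 <= n)%N] F ->
  (forall n, (1 <= n)%N -> F n `<=` measurable /\ sigma_algebra setT (F n)) ->
  (1 <= k)%N ->
  <<s \bigcup_(j in [set j | (1 <= j < k)%N]) F j >> E -> F k C ->
  measurable E /\ pr (E `&` C) = pr E * pr C.
Proof.
move=> indep FP k1 sE FC.
pose G := [set A | exists2 B : nat -> set Omega,
  (forall j, (1 <= j < k)%N -> F j (B j)) &
  A = \bigcap_(j in [set j | j \in index_iota 1 k]) B j].
have Gm : G `<=` measurable.
  move=> _ [B FB ->]; apply: bigcap_measurableType => j /=.
  rewrite mem_index_iota => jk.
  by apply: (FP _ _).1 (FB _ jk); case/andP: jk.
have F1 : forall n, (1 <= n)%N -> F n `<=` measurable by move=> n /FP[].
have GI : setI_closed G.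
  move=> _ _ [B FB ->] [B' FB' ->]; exists (fun j => B j `&` B' j).
    move=> j jk; have [_ sF] := FP j (proj1 (andP jk)).
    by apply: sigmaI => //; [exact: FB|exact: FB'].
  by rewrite bigcapI.
have GC A : G A -> pr (A `&` C) = pr A * pr C.
  move=> [B FB ->{A}].
  rewrite (@mutually_independent_pr [set n | (1 <= n)%N] F) ?iota_uniq//; last first.
    by move=> n; rewrite mem_index_iota => nk; split; [by case/andP: nk|exact: FB].
  pose B' j := if j == k then C else B j.
  have -> : \bigcap_(j in [set j | j \in index_iota 1 k]) B j `&` C =
      \bigcap_(j in [set j | j \in rcons (index_iota 1 k) k]) B' j.
    apply/seteqP; split => w /=.
      move=> [hB Cw] j /=; rewrite mem_rcons inE /B'; case: eqP => //= _.
      exact: hB.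
    move=> h; split; last by have := h k; rewrite /B' eqxx; apply; rewrite /= mem_rcons mem_head.
    move=> j /= jk; have := h j; rewrite /B'; case: eqP => [ek|_].
      by move: jk; rewrite ek mem_index_iota ltnn andbF.
    by apply; rewrite /= mem_rcons inE jk orbT.
  rewrite (@mutually_independent_pr [set n | (1 <= n)%N] F)//; last 2 first.
  - by rewrite rcons_uniq iota_uniq mem_index_iota ltnn andbF.
  - move=> n; rewrite mem_rcons inE mem_index_iota /B'.
    by case: eqP => [-> _|_ /= nk]; split => //; [case/andP: nk|exact: FB].
  rewrite [LHS]big_rcons/= /B' eqxx; congr (_ * _).
  by apply: eq_big_nat => j /andP[_ jk]; rewrite ltn_eqF.
apply: (@indep_generated G C GI Gm (F1 _ k1 _ FC) GC).
move: E sE; apply: sub_smallest2r; first exact: smallest_sigma_algebra.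
move=> A [j /= jk FA].
exists (fun i => if i == j then A else setT).
  move=> i ik; case: eqP => [->//|_]; apply: sigmaT.
  by case: (FP i) => //; case/andP: ik.
apply/seteqP; split => w.
  by move=> Aw i /= _; case: eqP.
by move=> /(_ j); rewrite eqxx /= mem_index_iota; exact.
Qed.

End Independence.

(** * Gaussian laws and the distance to the integers *)

Section GaussianBounds.
Variable R : realType.
Implicit Types (s x r : R).
Local Notation mu := (@lebesgue_measure R).

Lemma expRN_le_inv x : 0 < x -> expR (- x) <= x^-1.
Proof.
move=> x0; rewrite expRN lef_pV2 ?posrE ?expR_gt0//.
by apply: le_trans (expR_ge1Dx x); rewrite lerDr.
Qed.

(** [pi >= 2] gives [sqrt (2 pi) >= 2]. *)
Lemma normal_peak_le s : 0 < s -> normal_peak s <= (2 * s)^-1.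
Proof.
move=> s0; rewrite /normal_peak lef_pV2 ?posrE ?mulr_gt0//; last first.
  by rewrite sqrtr_gt0 -mulrnAr mulr_gt0 ?exprn_gt0// pmulrn_lgt0// pi_gt0.
have -> : 2 * s = Num.sqrt ((2 * s) ^+ 2) by rewrite sqrtr_sqr ger0_norm// mulr_ge0// ltW.
apply: ler_wsqrtr.
rewrite -mulrnAr exprMn mulrC ler_wpM2l ?exprn_ge0 ?(ltW s0)//.
by have := @pi_ge2 R; lra.
Qed.

Lemma normal_prob_le s (A : set R) (f : R -> R) (c : R) :
  measurable A -> measurable_fun setT f -> (forall x, 0 <= f x) -> 0 <= c ->
  (forall x, A x -> normal_pdf 0 s x <= c * f x) ->
  (normal_prob 0 s A <= c%:E * \int[mu]_(x in A) (f x)%:E)%E.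
Proof.
move=> mA mf f0 c0 h; rewrite -ge0_integralZl//=; last 2 first.
- by apply/measurable_EFinP; exact: measurable_funTS.
- by move=> x _; rewrite lee_fin.
apply: ge0_le_integral => //=.
- by move=> x _; rewrite lee_fin normal_pdf_ge0.
- by apply/measurable_EFinP/measurable_funTS; exact: measurable_normal_pdf.
- by apply/measurable_EFinP/measurable_funTS; exact: measurable_funM.
Qed.

Lemma normal_prob_le_lebesgue s (A : set R) (c : R) :
  measurable A -> 0 <= c -> (forall x, A x -> normal_pdf 0 s x <= c) ->
  (normal_prob 0 s A <= c%:E * mu A)%E.
Proof.
move=> mA c0 h; rewrite -[mu A]mul1e -integral_cst//.
by apply: (@normal_prob_le s A (cst 1)) => //= x Ax; rewrite mulr1; exact: h.
Qed.

(* Off a ball the N(0, s^2) density is a small multiple of the N(0, 4 s^2) one,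
   whose total mass is 1. *)
Lemma normal_prob_tail s r : 0 < s -> 0 < r ->
  (normal_prob 0 s [set x | r <= `|x|]%R <= (6 * s ^+ 2 / r ^+ 2)%:E)%E.
Proof.
move=> s0 r0; set A := [set x | _].
have mA : measurable A.
  rewrite (_ : A = ~` `]- r, r[); first exact: measurableC.
  apply/seteqP; split => x; rewrite /A/= in_itv/= -ltr_norml.
    by rewrite leNgt => /negP.
  by move/negP; rewrite -leNgt.
have s20 : 0 < 2 * s by rewrite mulr_gt0.
have peak2 : normal_peak s = 2 * normal_peak (2 * s).
  rewrite /normal_peak exprMn -!mulrnAr -(mulrA (2 ^+ 2)) [in RHS]sqrtrM ?exprn_ge0//.
  by rewrite sqrtr_sqr ger0_norm// invfM mulrA divff ?mul1r.
have c0 : 0 <= 6 * s ^+ 2 / r ^+ 2 by apply: divr_ge0; [apply: mulr_ge0 => //|]; exact: sqr_ge0.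
have pdf_le x : A x ->
    normal_pdf 0 s x <= 6 * s ^+ 2 / r ^+ 2 * normal_pdf 0 (2 * s) x.
  move=> /= rx; rewrite !normal_pdfE ?gt_eqF// peak2 /normal_fun !subr0.
  have x2 : r ^+ 2 <= x ^+ 2 by rewrite -[x ^+ 2]real_normK ?num_real// lerXn2r ?nnegrE// ltW.
  have r2 : 0 < r ^+ 2 by rewrite exprn_gt0.
  (* The exponent [x^2 / (2 s^2)] is split into [3 x^2 / (8 s^2)] and the exponent of the wider
     density. The first part is spent through [expR (- z) <= z^-1], and [16 / 3 <= 6]. *)
  have -> : - x ^+ 2 / (s ^+ 2 *+ 2) =
      - (3 * x ^+ 2 / (8 * s ^+ 2)) + - x ^+ 2 / ((2 * s) ^+ 2 *+ 2).
    by field; rewrite gt_eqF.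
  rewrite expRD [leLHS](_ : _ = 2 * expR (- (3 * x ^+ 2 / (8 * s ^+ 2))) *
    (normal_peak (2 * s) * expR (- x ^+ 2 / ((2 * s) ^+ 2 *+ 2)))); last by ring.
  apply: ler_wpM2r; first by rewrite mulr_ge0 ?normal_peak_ge0 ?expR_ge0.
  have s2 : 0 < s ^+ 2 by rewrite exprn_gt0.
  have z0 : 0 < 3 * x ^+ 2 / (8 * s ^+ 2).
    by apply: divr_gt0; apply: mulr_gt0 => //; exact: lt_le_trans x2.
  have := expRN_le_inv z0; rewrite invf_div => e1.
  apply: le_trans (_ : 2 * (8 * s ^+ 2 / (3 * r ^+ 2)) <= _).
    apply: ler_wpM2l => //; apply: le_trans e1 _.
    apply: ler_wpM2l; first by rewrite mulr_ge0 ?ltW.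
    by rewrite lef_pV2 ?posrE; lra.
  rewrite [leLHS](_ : _ = (16 / 3) * (s ^+ 2 / r ^+ 2)); last first.
    by field; rewrite gt_eqF.
  by rewrite -[leRHS]mulrA ler_wpM2r ?divr_ge0 ?ltW//; lra.
apply: le_trans (normal_prob_le mA _ _ _ pdf_le) _ => //.
- exact: measurable_normal_pdf.
- by move=> x; exact: normal_pdf_ge0.
rewrite -[leRHS]mule1 lee_wpmul2l ?lee_fin//.
rewrite -[leRHS](@integral_normal_pdf R 0 (2 * s)).
apply: ge0_subset_integral => //=.
- by apply/measurable_EFinP; exact: measurable_normal_pdf.
- by move=> x _; rewrite lee_fin normal_pdf_ge0.
Qed.

(** The second bound is the peak times [expR (- z) <= z^-1] with [z = x^2 / (2 s^2)]. Its quadratic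
    decay makes the sum over integer translates converge. *)
Lemma normal_pdf_near s x : 0 < s ->
  (normal_pdf 0 s x <= (2 * s)^-1) /\ (x != 0 -> normal_pdf 0 s x <= s / x ^+ 2).
Proof.
move=> s0; have s1 : s != 0 by rewrite gt_eqF.
split; first exact: le_trans (normal_pdf_ub _ _ s1) (normal_peak_le s0).
move=> x0; rewrite normal_pdfE// /normal_fun subr0.
have x2 : 0 < x ^+ 2 by rewrite exprn_even_gt0.
have z0 : 0 < x ^+ 2 / (s ^+ 2 *+ 2).
  by apply: divr_gt0 => //; rewrite pmulrn_lgt0// exprn_gt0.
have := expRN_le_inv z0; rewrite invf_div -mulNr => e1.
rewrite [leRHS](_ : _ = (2 * s)^-1 * (s ^+ 2 *+ 2 / x ^+ 2)); last first.
  by field; rewrite x0 s1.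
by apply: ler_pM => //; [exact: normal_peak_ge0|exact: normal_peak_le].
Qed.

End GaussianBounds.

Section DistanceToIntegers.
Variable R : realType.
Implicit Types (a b r v : R) (m : int).

Definition dint a : R := Num.min (a - (Num.floor a)%:~R) (1 - (a - (Num.floor a)%:~R)).

Lemma dint_le a m : dint a <= `|a - m%:~R|.
Proof.
have := floor_le a; have := floorD1_gt a; rewrite /dint intrD.
set f := (Num.floor a)%:~R : R => h1 h2.
have [mf|fm] := leP m (Num.floor a).
  apply: le_trans (_ : a - f <= _); first by rewrite ge_min lexx.
  apply: le_trans (ler_norm _); rewrite lerB// /f ler_int//.
apply: le_trans (_ : 1 - (a - f) <= _); first by rewrite ge_min lexx orbT.
rewrite distrC; apply: le_trans (ler_norm _).
have : f + 1 <= m%:~R by rewrite /f -(intrD _ _ 1) ler_int -ltzD1 ltrD2r.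
by lra.
Qed.

Lemma dint_attained a : exists m, dint a = `|a - m%:~R|.
Proof.
have := floor_le a; have := floorD1_gt a; rewrite /dint intrD.
set f := (Num.floor a)%:~R : R => h1 h2.
have [h|h] := leP (a - f) (1 - (a - f)).
  by exists (Num.floor a); rewrite ger0_norm// subr_ge0.
by exists (Num.floor a + 1); rewrite intrD distrC ger0_norm; rewrite -/f; lra.
Qed.

Lemma dint_ltP a r : reflect (exists m, `|a - m%:~R| < r) (dint a < r).
Proof.
apply: (iffP idP) => [|[m]]; last by apply: le_lt_trans; exact: dint_le.
by have [m ->] := dint_attained a; exists m.
Qed.

Lemma dint_ge0 a : 0 <= dint a.
Proof. by have [m ->] := dint_attained a. Qed.

Lemma dint_le_half a : dint a <= 1 / 2.
Proof.
rewrite /dint; set z := a - _; have [h|h] := leP z (1 - z); lra.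
Qed.

Lemma dintDz a m : dint (a + m%:~R) = dint a.
Proof.
suff le b k : dint (b + k%:~R) <= dint b.
  by apply/eqP; rewrite eq_le le/= -{1}(addrK m%:~R a) -intrN le.
have [j ->] := dint_attained b.
have := dint_le (b + k%:~R) (j + k).
by rewrite intrD opprD addrACA subrr addr0.
Qed.

Lemma dintD a b : dint (a + b) <= dint a + dint b.
Proof.
have [m ->] := dint_attained a; have [k ->] := dint_attained b.
apply: le_trans (dint_le _ (m + k)) _.
by rewrite intrD opprD addrACA ler_normD.
Qed.

Lemma dintN a : dint (- a) = dint a.
Proof.
suff le b : dint (- b) <= dint b.
  by apply/eqP; rewrite eq_le le/= -{1}(opprK a) le.
have [j ->] := dint_attained b; have := dint_le (- b) (- j).
by rewrite intrN -opprD normrN.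
Qed.

Lemma dint_le_norm a : dint a <= `|a|.
Proof. by have := dint_le a 0; rewrite subr0. Qed.

Lemma dint_dist a b : dint a <= dint b + `|a - b|.
Proof.
rewrite -{1}(subrK b a) addrC (le_trans (dintD _ _))// lerD2l.
exact: dint_le_norm.
Qed.

(** Passing to the antipode exchanges near and far; this will turn an upper bound for the
    probability of balls into an equality. *)
Lemma dintD_half a : dint (a + 1 / 2) = 1 / 2 - dint a.
Proof.
apply/eqP; rewrite eq_le; apply/andP; split.
  have := dint_le_half a; have [m ->] := dint_attained a.
  have [h|h] := leP 0 (a - m%:~R); rewrite ?(ger0_norm h) ?(ltr0_norm h) => hl.
    apply: le_trans (dint_le _ (m + 1)) _; rewrite intrD.
    by rewrite distrC ger0_norm; lra.
  apply: le_trans (dint_le _ m) _.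
  by rewrite ger0_norm; lra.
have [m ->] := dint_attained a; have [k ->] := dint_attained (a + 1 / 2).
have half_le : 1 / 2 <= `|(1 / 2 : R) + (m - k)%:~R|.
  have [j0|j0] := leP 0 (m - k).
    have : 0 <= (m - k)%:~R :> R by rewrite ler0z.
    by move=> ?; rewrite ger0_norm; lra.
  have : (m - k)%:~R <= -1 :> R by rewrite -[-1]/((-1)%:~R) ler_int; lia.
  by move=> ?; rewrite ler0_norm; lra.
rewrite lerBlDr; apply: le_trans half_le _.
rewrite [X in `|X|](_ : _ = (a + 1 / 2 - k%:~R) - (a - m%:~R)); last first.
  by rewrite intrB; ring.
exact: ler_normB.
Qed.

Lemma continuous_dint : continuous dint.
Proof.
move=> a; apply/cvgrPdist_lt => e e0; near=> b.
apply: (@le_lt_trans _ _ `|a - b|).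
  rewrite ler_distlC; apply/andP; split.
    by rewrite lerBlDr (le_trans (dint_dist _ b)).
  by rewrite distrC dint_dist.
by near: b; apply: (@cvgr_dist_lt _ _ _ _ _ id) => //; exact: cvg_id.
Unshelve. all: by end_near. Qed.

Lemma measurable_dint : measurable_fun setT dint.
Proof. exact: continuous_measurable_fun continuous_dint. Qed.

End DistanceToIntegers.

Section LawsOfDint.
Variable R : realType.
Implicit Types (s r v : R).
Local Notation mu := (@lebesgue_measure R).

Lemma measurable_dint_sub (v : R) (A : set R) :
  measurable A -> measurable ((fun b => dint (b - v)) @^-1` A).
Proof.
move=> mA; have h : measurable_fun setT (fun b : R => dint (b - v)).
  apply: (measurableT_comp (@measurable_dint R)).
  exact: measurable_funB.
by have := h measurableT A mA; rewrite setTI.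
Qed.

Lemma uniform_dint_le v r : 0 <= r ->
  (uniform_prob (@ltr01 R) [set b | dint (b - v) <= r]%R <= (2 * r)%:E)%E.
Proof.
move=> r0; set A := [set b | _].
have mA : measurable A.
  rewrite (_ : A = (fun b => dint (b - v)) @^-1` `]-oo, r]); last first.
    by apply/seteqP; split => b; rewrite /A/= in_itv.
  exact: measurable_dint_sub.
have -> : uniform_prob (@ltr01 R) A = mu (A `&` `[0, 1]).
  rewrite /uniform_prob integral_mkcond/=.
  rewrite -[X in _ = mu X](setIT (A `&` `[0, 1])) -integral_indic//; last exact: measurableI.
  apply: eq_integral => x _; rewrite /patch /uniform_pdf indicE in_setI.
  case: (x \in A) => //=; rewrite subr0 invr1.
  case: ifPn => x01; first by rewrite mem_set//= in_itv.
  by rewrite memNset//= in_itv/=; exact/negP.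
pose f : R := (Num.floor v)%:~R; pose u := v - f.
have u0 : 0 <= u by rewrite subr_ge0 floor_le.
have u1 : u < 1 by have := floorD1_gt v; rewrite intrD -/f /u; lra.
(* The parts of the ball inside [0, 1] around [u], [u + 1] and [u - 1]. For [r < 1 / 2] their
   lengths add up to at most [2 r]; for larger [r] the bound is at least 1. *)
pose I1 := `[Num.max 0 (u - r), Num.min 1 (u + r)]%classic.
pose I2 := `[u + 1 - r, 1]%classic.
pose I3 := `[0, u - 1 + r]%classic.
have [r2|r2] := leP (1 / 2) r.
  apply: (@le_trans _ _ (mu `[0, 1])).
    by apply: le_measure; rewrite ?inE//; exact: measurableI.
  by rewrite lebesgue_measure_itv/= lte_fin ltr01 -EFinB lee_fin; lra.
have sub : A `&` `[0, 1] `<=` (I1 `|` I2) `|` I3.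
  move=> b [] ; rewrite /A /= in_itv/= => bv /andP[b0 b1].
  have [m em] := dint_attained (b - v + f).
  have bv' : `|b - v + f - m%:~R| <= r by rewrite -em /f dintDz.
  have h2 : - r <= b - u - m%:~R <= r.
    by rewrite -ler_norml /u (_ : b - (v - f) - _ = b - v + f - m%:~R)//; ring.
  have m1 : -2 < m by rewrite -(@ltr_int R); move: h2; rewrite (_ : (-2)%:~R = -2)//; lra.
  have m2 : m < 2 by rewrite -(@ltr_int R); move: h2; rewrite (_ : (2)%:~R = 2)//; lra.
  have : m = -1 \/ m = 0 \/ m = 1 by lia.
  rewrite /I1 /I2 /I3 /= !in_itv/=; move: h2 => /[swap] -[|[|]] ->.
  - by rewrite (_ : (-1)%:~R = -1 :> R)// => ?; right; lra.
  - rewrite (_ : 0%:~R = 0 :> R)// => ?; left; left.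
    by rewrite ge_max le_min; apply/andP; split; apply/andP; split; lra.
  - by rewrite (_ : 1%:~R = 1 :> R)// => ?; left; right; lra.
have mI1 : measurable I1 by exact: measurable_itv.
have mI2 : measurable I2 by exact: measurable_itv.
have mI3 : measurable I3 by exact: measurable_itv.
apply: (@le_trans _ _ (mu (I1 `|` I2 `|` I3))).
  by apply: le_measure; rewrite ?inE//; [exact: measurableI|repeat apply: measurableU].
apply: (@le_trans _ _ (mu I1 + mu I2 + mu I3)%E).
  apply: le_trans (measureU2 _ _ _) _ => //; first exact: measurableU.
  by rewrite leeD2r// measureU2.
have itvE (a b : R) : mu `[a, b] = (Num.max 0 (b - a))%:E.
  rewrite lebesgue_measure_itv/= lte_fin; case: ltP => ab.
    by rewrite -EFinB max_r// subr_ge0 ltW.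
  by rewrite max_l// subr_le0.
rewrite !itvE -!EFinD lee_fin.
rewrite /Num.max /Num.min; do ! case: ifPn; rewrite -?leNgt => *; lra.
Qed.

(** Around each pair [n], [- n] the set has length at most [4 r] and density at most [c n]. The
    majorant [c] telescopes to at most [24 / s], whence the constant 96; [s <= 1] serves to compare
    [s / x^2] with it. *)
Lemma normal_dint_le s r : 0 < s <= 1 -> 0 < r ->
  (normal_prob 0 s [set b | dint b < r]%R <= (96 * r / s)%:E)%E.
Proof.
move=> /andP[s0 s1] r0; set A := [set b | _].
have mA : measurable A.
  rewrite (_ : A = (fun b => dint (b - 0)) @^-1` `]-oo, r[); last first.
    by apply/seteqP; split => b; rewrite /A/= in_itv/= subr0.
  exact: measurable_dint_sub.
have [r2|r2] := leP (1 / 2) r.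
  apply: (@le_trans _ _ 1%E); first exact: (@probability_le1 _ _ R (normal_prob 0 s) A mA).
  by rewrite lee_fin ler_pdivlMr//; lra.
pose B n : set R := `]n%:R - r, n%:R + r[ `|` `]- n%:R - r, - n%:R + r[.
have mB n : measurable (B n) by exact: measurableU.
have AB : A `<=` \bigcup_n B n.
  move=> b /dint_ltP[m mr]; exists `|m|%N => //.
  rewrite /B/= !in_itv/=; move: mr; rewrite ltr_norml => mr.
  have [m0|m0] := leP 0 m.
    left; have -> : (`|m|%N)%:R = m%:~R :> R by rewrite -[in RHS](gez0_abs m0).
    lra.
  right; have -> : - (`|m|%N)%:R = m%:~R :> R.
    by rewrite -[in RHS](opprK m) -(ltz0_abs m0) intrN.
  lra.
apply: le_trans (@measure_sigma_subadditive _ _ _ (normal_prob 0 s) _ _ mB mA AB) _.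
pose c n : R := 24 / s * (n.+1%:R^-1 - n.+2%:R^-1).
have cE n : c n = 24 / s / (n.+1%:R * n.+2%:R).
  by rewrite /c -!natr1; field; rewrite !gt_eqF//; have := ler0n R n; lra.
have c0 n : 0 <= c n by rewrite cE !divr_ge0 ?mulr_ge0 ?ltW.
have pdf_le n x : B n x -> normal_pdf 0 s x <= c n.
  move=> Bx; have [h1 h2] := normal_pdf_near x s0.
  case: n Bx => [|n] Bx.
    apply: le_trans h1 _; rewrite cE.
    have i0 : 0 < (2 * s)^-1 by rewrite invr_gt0 mulr_gt0.
    have -> : 24 / s / (1%:R * 2%:R) = 24 * (2 * s)^-1 by field; rewrite gt_eqF.
    lra.
  have x1 : n.+1%:R / 2 <= `|x|.
    have := ler0n R n; move: Bx; rewrite /B /= !in_itv/= -natr1 => -[|] ? ?.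
      by apply: le_trans (ler_norm _); lra.
    by rewrite -normrN; apply: le_trans (ler_norm _); lra.
  have nn := ler0n R n; have n1 : 0 < n.+1%:R :> R by [].
  have x0 : x != 0 by rewrite -normr_gt0; lra.
  apply: le_trans (h2 x0) _.
  have x2 : n.+1%:R ^+ 2 / 4 <= x ^+ 2 by rewrite -[x ^+ 2]real_normK ?num_real//; nra.
  apply: (@le_trans _ _ (s * (4 / n.+1%:R ^+ 2))).
    apply: ler_wpM2l; first exact: ltW.
    have q0 : 0 < n.+1%:R ^+ 2 / 4 :> R by rewrite divr_gt0 ?exprn_gt0.
    have q1 := lt_le_trans q0 x2.
    by rewrite -[leRHS]invf_div lef_pV2 ?posrE.
  apply: (@le_trans _ _ (s^-1 * (4 / n.+1%:R ^+ 2))).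
    rewrite ler_wpM2r ?divr_ge0 ?sqr_ge0//.
    by apply: (le_trans s1); rewrite invf_ge1.
  rewrite cE -[in leRHS](natr1 n.+2) -[in leRHS](natr1 n.+1).
  move: (n.+1%:R : R) n1 (natr1 n : _ = n.+1%:R :> R) => N N0 nN.
  have -> : 24 / s / ((N + 1) * (N + 1 + 1)) = s^-1 * (24 / ((N + 1) * (N + 1 + 1))).
    by field; rewrite !gt_eqF//; lra.
  apply: ler_wpM2l; first by rewrite invr_ge0 ltW.
  rewrite ler_pdivrMr ?exprn_gt0// mulrAC.
  by rewrite ler_pdivlMr; nra.
have muB n : (mu (B n) <= (4 * r)%:E)%E.
  apply: (@le_trans _ _ (mu `](n%:R - r)%R, (n%:R + r)%R[ + mu `](- n%:R - r)%R, (- n%:R + r)%R[)%E).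
    by apply: measureU2.
  rewrite !lebesgue_measure_itv/= !lte_fin !ifT; [|lra..].
  by rewrite -!EFinB -EFinD lee_fin; lra.
apply: (@le_trans _ _ (\sum_(0 <= n <oo) (4 * r * c n)%:E)%E).
  apply: lee_nneseries => // n _.
  apply: le_trans (normal_prob_le_lebesgue (mB n) (c0 n) (@pdf_le n)) _.
  have -> : (4 * r * c n)%:E = ((c n)%:E * (4 * r)%:E)%E by rewrite -EFinM mulrC.
  by apply: lee_wpmul2l; rewrite ?lee_fin.
apply: lime_le.
  by apply: is_cvg_nneseries => n _ _; rewrite lee_fin mulr_ge0// mulr_ge0// ltW.
apply: nearW => N; rewrite sumEFin lee_fin -mulr_sumr /c -mulr_sumr.
have -> : \sum_(0 <= n < N) (n.+1%:R^-1 - n.+2%:R^-1) = 1 - N.+1%:R^-1 :> R.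
  rewrite (@telescope_sumr_eq _ 0 N (fun n => - n.+1%:R^-1))//.
    by rewrite opprK invr1 addrC.
  by move=> k _; rewrite opprK addrC.
have N0 : 0 < N.+1%:R^-1 :> R by rewrite invr_gt0.
rewrite [leRHS](_ : _ = 4 * r * (24 / s * 1)); last by field; rewrite gt_eqF.
apply: ler_wpM2l; first by rewrite mulr_ge0// ltW.
by apply: ler_wpM2l; [rewrite divr_ge0// ltW|rewrite gerBl ltW].
Qed.

End LawsOfDint.

Section CircleDistance.
Variable R : realType.
Implicit Types (u v r : R) (x y : circle R).

Lemma circle_projP u v : reflect (circle_proj u = circle_proj v) ((u - v) \is a Num.int).
Proof. exact: (@eqquotP _ _ _ u v). Qed.

Lemma circle_proj_repr x : circle_proj (repr x) = x.
Proof. exact: reprK. Qed.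

Lemma circle_distE u v : circle_dist (circle_proj u) (circle_proj v) = dint (u - v).
Proof.
rewrite /circle_dist; set S := [set r | _].
have lbS : lbound S (dint (u - v)).
  move=> r [u' [v' [/circle_projP/intrP[m em] /circle_projP/intrP[k ek] ->]]].
  apply: le_trans (dint_le _ (k - m)) _.
  rewrite (_ : u - v - _ = u' - v')//; rewrite intrB -em -ek; ring.
have [m em] := dint_attained (u - v).
have Sm : S (dint (u - v)).
  exists u, (v + m%:~R); split => //.
    by apply/circle_projP; rewrite addrC addKr intr_int.
  by rewrite em opprD addrA.
apply/eqP; rewrite eq_le; apply/andP; split.
  by apply: ge_inf => //; exists (dint (u - v)).
by apply: lb_le_inf => //; exists (dint (u - v)).
Qed.

Lemma circle_dist_lt_open x r : open [set y | circle_dist y x < r].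
Proof.
rewrite -(circle_proj_repr x); set v := repr x.
change (open (@circle_proj R @^-1` [set y | circle_dist y (circle_proj v) < r])).
rewrite (_ : _ @^-1` _ = (fun u => dint (u - v)) @^-1` `]-oo, r[); last first.
  by apply/seteqP; split => u /=; rewrite circle_distE in_itv.
apply: open_comp; last exact: interval_open.
move=> u _; apply: (@continuous_comp _ _ _ (fun u : R => u - v) (@dint R)); last exact: continuous_dint.
by apply: cvgB; [exact: cvg_id|exact: cvg_cst].
Qed.

Lemma circle_dist_lt_borel x r : circle_borel [set y | circle_dist y x < r].
Proof. by apply: sub_gen_smallest; exact: circle_dist_lt_open. Qed.

Lemma circle_dist_le_borel x r : circle_borel [set y | circle_dist y x <= r].
Proof.
have s := smallest_sigma_algebra setT (@open (circle R)).
rewrite (_ : [set y | _] = \bigcap_n [set y | circle_dist y x < r + n.+1%:R^-1]).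
  by apply: (sigma_bigcap s) => n _; exact: circle_dist_lt_borel.
apply/seteqP; split => y /=.
  by move=> h n _ /=; rewrite (le_lt_trans h)// ltrDl invr_gt0.
move=> h; apply/ler_addgt0Pl => e e0.
have [n ne] : exists n : nat, n.+1%:R^-1 < e.
  by exists (Num.truncn e^-1); rewrite invf_plt ?posrE// truncnS_gt.
by rewrite (le_trans (ltW (h n I)))// [leRHS]addrC lerD2l ltW.
Qed.

Lemma measurable_circle_proj (A : set (circle R)) :
  circle_borel A -> measurable (@circle_proj R @^-1` A).
Proof.
pose G := [set A : set (circle R) | measurable (@circle_proj R @^-1` A)].
suff : @circle_borel R `<=` G by apply.
apply: smallest_sub; last first.
  by move=> B oB; apply: open_measurable; exact: oB.
split; first by rewrite /G/= preimage_set0.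
- by move=> B GB; rewrite /G/= setTD preimage_setC; exact: measurableC.
- by move=> F GF; rewrite /G/= preimage_bigcup; exact: bigcupT_measurable.
Qed.

End CircleDistance.

Section MonotoneLimits.
Context d (Omega : measurableType d) (R : realType) (P : probability Omega R).
Local Notation pr := (pr P).

Lemma pr_bigcup_le (F : nat -> set Omega) (c : R) :
  (forall n, measurable (F n)) -> (forall n, F n `<=` F n.+1) ->
  (forall n, pr (F n) <= c) -> pr (\bigcup_n F n) <= c.
Proof.
move=> mF ndF Fc.
have mU : measurable (\bigcup_n F n) by exact: bigcupT_measurable.
have hF : {homo F : n m / (n <= m)%N >-> (n <= m)%O}.
  apply: homo_leq => //; first exact: le_trans.
  by move=> n; apply/subsetPset.
rewrite -lee_fin -prE//.
have cF := @nondecreasing_cvg_mu _ _ _ P F mF mU hF.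
rewrite -(cvg_lim _ cF)//; apply: lime_le.
  by apply/cvg_ex; exists (P (\bigcup_n F n)).
by apply: nearW => n /=; rewrite prE// lee_fin.
Qed.

Lemma pr_bigcap_ge (F : nat -> set Omega) (c : R) :
  (forall n, measurable (F n)) -> (forall n, F n.+1 `<=` F n) ->
  (forall n, c <= pr (F n)) -> c <= pr (\bigcap_n F n).
Proof.
move=> mF niF Fc.
have mI : measurable (\bigcap_n F n) by exact: bigcapT_measurable.
have := @pr_bigcup_le (fun n => ~` F n) (1 - c).
rewrite -setC_bigcap pr_setC// => h.
suff : 1 - pr (\bigcap_n F n) <= 1 - c by lra.
apply: h => n; first exact: measurableC.
  exact: subsetC.
by rewrite pr_setC// lerB.
Qed.

End MonotoneLimits.

Lemma measurable_normr_ge (R : realType) (r : R) : measurable [set x : R | r <= `|x|].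
Proof.
rewrite (_ : [set x | _] = ~` `]- r, r[); first exact: measurableC.
apply/seteqP; split => x; rewrite /= in_itv/= -ltr_norml.
  by rewrite leNgt => /negP.
by move/negP; rewrite -leNgt.
Qed.

(** Freezing the path at its value at 0 for negative times makes it continuous on the whole line, so
    that neighbourhoods need no restriction to the half line. *)
Lemma continuous_max0 (R : realType) (f : R -> R) :
  {within `[0, +oo[, continuous f} -> continuous (fun t : R => f (Num.max t 0)).
Proof.
move=> /subspace_continuousP cf t; apply/cvgrPdist_lt => e e0.
have t0 : `[0, +oo[%classic (Num.max t 0) by rewrite /= in_itv/= andbT le_max lexx orbT.
have /cvgrPdist_lt/(_ e e0) := cf _ t0.
rewrite near_withinE => -[r /= r0 hr]; exists r => // u /= tu; apply: hr => /=.
  apply: le_lt_trans tu; rewrite /=.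
  have := ler_norm (t - u); have := ler_norm (u - t); rewrite (distrC u t) ler_norml.
  by rewrite /Num.max; do 2 case: ifPn; rewrite -?leNgt => *; apply/andP; split; lra.
by rewrite in_itv/= andbT le_max lexx orbT.
Qed.

(** * Brownian motion on the circle *)

Section BrownianMotion.
Context d (Omega : measurableType d) (R : realType) (P : probability Omega R).
Local Notation pr := (pr P).
Variable B : R -> Omega -> R.
Hypothesis BM : brownian_motion P B.
Implicit Types (s t u r h : R).

Definition hist s := process_sigma (@measurable _ R) `[0, s] B.

Lemma hist_sigma s : sigma_algebra setT (hist s).
Proof. exact: smallest_sigma_algebra. Qed.

Lemma hist_preimage s u (A : set R) :
  0 <= u <= s -> measurable A -> hist s (B u @^-1` A).
Proof.
move=> us mA; apply: sub_gen_smallest; exists u => /=; first by rewrite in_itv.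
by exists A => //; rewrite setTI.
Qed.

Lemma hist_measurable s : hist s `<=` measurable.
Proof.
apply: smallest_sub; first exact: sigma_algebra_measurable.
move=> C [u /=]; rewrite in_itv/= => /andP[u0 _] [A mA <-].
exact: (bm_measurable BM u0 measurableT).
Qed.

(** [hist s] is a bare set of events, so measurability of a difference is rebuilt by separating the
    two values by a rational. *)
Lemma hist_incr_gt s u u' r : 0 <= u <= s -> 0 <= u' <= s ->
  hist s [set w | r < B u w - B u' w].
Proof.
move=> us us'; have sH := hist_sigma s.
rewrite (_ : [set w | _] = \bigcup_(q in [set: rat])
    (B u @^-1` `](ratr q + r), +oo[ `&` B u' @^-1` `]-oo, (ratr q)[)).
  by apply: (sigma_bigcup sH) => q _; apply: (sigmaI sH); exact: hist_preimage.
apply/seteqP; split => w /=.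
  move=> h; have h' : B u' w < B u w - r by lra.
  have [q] := rat_in_itvoo h'; rewrite in_itv/= => /andP[q1 q2].
  by exists q => //=; split; rewrite in_itv/= ?andbT//; lra.
by move=> [q _] /=; rewrite !in_itv/= andbT => -[? ?]; lra.
Qed.

Lemma hist_absincr_gt s u u' r : 0 <= u <= s -> 0 <= u' <= s ->
  hist s [set w | r < `|B u w - B u' w|].
Proof.
move=> us us'; have sH := hist_sigma s.
rewrite (_ : [set w | _] = [set w | r < B u w - B u' w] `|` [set w | r < B u' w - B u w]).
  by apply: (sigmaU sH); exact: hist_incr_gt.
by apply/seteqP; split => w /=; rewrite ltr_normr opprB => /orP.
Qed.

Lemma measurable_incr s t (A : set R) : 0 <= s -> 0 <= t -> measurable A ->
  measurable ((B t \- B s) @^-1` A).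
Proof.
move=> s0 t0 mA; rewrite -[X in measurable X]setTI.
by apply: measurable_funB => //; exact: (bm_measurable BM).
Qed.

Lemma indep_incr_pr s t (E : set Omega) (A : set R) : 0 <= s < t ->
  hist s E -> measurable A ->
  pr (E `&` (B t \- B s) @^-1` A) = pr E * pr ((B t \- B s) @^-1` A).
Proof.
move=> st hE mA; have /andP[s0 sltt] := st.
have t0 : 0 <= t by rewrite (le_trans s0)// ltW.
have mE := hist_measurable hE; have mi := measurable_incr s0 t0 mA.
by apply: EFin_inj; rewrite EFinM -!prE ?(bm_indep BM)//; exact: measurableI.
Qed.

Lemma incr_tail s t r : 0 <= s < t -> 0 < r ->
  pr [set w | r <= `|B t w - B s w|] <= 6 * (t - s) / r ^+ 2.
Proof.
move=> st r0; have /andP[s0 sltt] := st.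
have mA := measurable_normr_ge r.
have q0 : 0 < Num.sqrt (t - s) by rewrite sqrtr_gt0 subr_gt0.
have := normal_prob_tail q0 r0; rewrite sqr_sqrtr ?subr_ge0 ?(ltW sltt)// => h.
have t0 : 0 <= t by rewrite (le_trans s0)// ltW.
rewrite -lee_fin -prE; last exact: (measurable_incr s0 t0 mA).
by rewrite (bm_gaussian BM st mA).
Qed.

Lemma incr_dint s t r : 0 <= s < t -> t - s <= 1 -> 0 < r ->
  pr [set w | dint (B t w - B s w) < r] <= 96 * r / Num.sqrt (t - s).
Proof.
move=> st ts1 r0; have /andP[s0 sltt] := st.
have mA : measurable [set x : R | dint x < r].
  rewrite (_ : [set x | _] = (fun x => dint (x - 0)) @^-1` `]-oo, r[).
    exact: measurable_dint_sub.
  by apply/seteqP; split => b; rewrite /= in_itv/= subr0.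
have q0 : 0 < Num.sqrt (t - s) <= 1.
  by rewrite sqrtr_gt0 subr_gt0 sltt -sqrtr1 ler_wsqrtr.
have := normal_dint_le q0 r0 => h.
have t0 : 0 <= t by rewrite (le_trans s0)// ltW.
rewrite -lee_fin -prE; last exact: (measurable_incr s0 t0 mA).
by rewrite (bm_gaussian BM st mA).
Qed.

(* Ottaviani's inequality: at the first grid time where the path is 2r away
   from its starting point it has conditional probability at least 1/2 of
   ending up at least r away. *)
Lemma ottaviani_grid s t r (f : nat -> R) (E : set Omega) m :
  0 <= s -> 0 < r -> 12 * (t - s) <= r ^+ 2 ->
  {homo f : i j / (i <= j)%N >-> i <= j} ->
  (forall i, (i < m)%N -> s <= f i < t) -> hist s E ->
  pr (E `&` \bigcup_(i in [set i | (i < m)%N]) [set w | 2 * r < `|B (f i) w - B s w|])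
    <= 2 * (pr E * pr [set w | r <= `|B t w - B s w|]).
Proof.
move=> s0 r0 hr fmono fst hE.
case: m fst => [|m0] fst.
  rewrite (_ : _ `&` _ = set0); first by rewrite pr_set0 !mulr_ge0// pr_ge0.
  by rewrite -subset0 => w [_ [i]].
have slt : s < t by have /andP[h1 h2] := fst 0%N isT; exact: le_lt_trans h2.
have t0 : 0 <= t by rewrite (le_trans s0)// ltW.
pose H i := [set w | 2 * r < `|B (f i) w - B s w|].
pose G j := E `&` \bigcup_(i in [set i | (i < j)%N]) H i.
pose K := [set w | `|B t w - B s w| < r].
have hs u : s <= u -> hist u `<=` measurable by move=> _; exact: hist_measurable.
have histW u A : s <= u -> hist s A -> hist u A.
  move=> su; apply: sub_smallest2r; first exact: hist_sigma.
  move=> C [v /=]; rewrite in_itv/= => /andP[v0 vs] hC.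
  by exists v => //=; rewrite in_itv/= v0 (le_trans vs).
have hG i j : (i < m0.+1)%N -> (j <= i.+1)%N -> hist (f i) (G j).
  move=> im ji; have /andP[sfi fit] := fst i im.
  apply: (sigmaI (hist_sigma _)); first exact: histW hE.
  apply: (sigma_bigcup (hist_sigma _)) => k /= kj.
  have ki : (k <= i)%N by rewrite -ltnS (leq_trans kj).
  have /andP[sfk _] := fst k (leq_ltn_trans ki im).
  by apply: hist_absincr_gt; rewrite ?s0 ?(le_trans s0 sfk) ?fmono.
have mH i : (i < m0.+1)%N -> measurable (H i).
  move=> im; have /andP[sfi fit] := fst i im.
  apply: (@hist_measurable (f i)).
  by apply: hist_absincr_gt; rewrite ?s0 ?(le_trans s0 sfi) ?lexx.
have mG j : (j <= m0.+1)%N -> measurable (G j).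
  case: j => [_|j jm].
    by rewrite /G (_ : _ `&` _ = set0)// -subset0 => w [_ [i]].
  by apply: (@hist_measurable (f j)); apply: hG.
have mK : measurable K.
  rewrite (_ : K = (B t \- B s) @^-1` `]- r, r[); first exact: measurable_incr.
  by apply/seteqP; split => w; rewrite /K /= in_itv/= ltr_norml.
have mL : measurable [set w | r <= `|B t w - B s w|].
  rewrite (_ : [set w | _] = ~` K); first exact: measurableC.
  by apply/seteqP; split => w; rewrite /K /=; [rewrite leNgt => /negP|move/negP; rewrite -leNgt].
(* The first passage is decomposed by induction: on [G j.+1] minus [G j] the first passage is at
   [f j], which is known at time [f j]. To end in [K] the path must then move back by at least [r],
   with conditional probability at most [6 (t - f j) / r^2 <= 1 / 2]. *)
have key j : (j <= m0.+1)%N -> pr (G j `&` K) <= 1 / 2 * pr (G j).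
  elim: j => [_|j IH jm].
    rewrite (_ : G 0%N = set0); first by rewrite set0I pr_set0 mulr0.
    by rewrite -subset0 => w [_ [i]].
  have IH' := IH (ltnW jm).
  have /andP[sfj fjt] := fst j jm.
  have mGj := mG j (ltnW jm); have mGj1 := mG j.+1 jm.
  have subG : G j `<=` G j.+1.
    by move=> w [Ew [i /= ij Hi]]; split=> //; exists i => //=; rewrite ltnW.
  have e1 : pr (G j.+1 `&` K) = pr (G j `&` K) + pr ((G j.+1 `&` ~` G j) `&` K).
    have -> : (G j.+1 `&` ~` G j) `&` K = (G j.+1 `&` K) `&` ~` G j by rewrite setIAC.
    rewrite prD//; last exact: measurableI.
    have -> : (G j.+1 `&` K) `&` G j = G j `&` K by rewrite setIAC (setIidr subG).
    by rewrite addrC subrK.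
  have e2 : pr (G j.+1) = pr (G j) + pr (G j.+1 `&` ~` G j).
    by rewrite prD// (setIidr subG) addrC subrK.
  rewrite e1 e2 mulrDr lerD//.
  have hF : hist (f j) (G j.+1 `&` ~` G j).
    by apply: (sigmaI (hist_sigma _)); [exact: hG|apply: (sigmaC (hist_sigma _)); exact: hG].
  have mA := measurable_normr_ge r.
  have fjt' : 0 <= f j < t by rewrite (le_trans s0 sfj).
  apply: (@le_trans _ _ (pr ((G j.+1 `&` ~` G j) `&` (B t \- B (f j)) @^-1` [set x : R | r <= `|x|]))).
    apply: pr_mono.
    - by apply: measurableI => //; exact: hist_measurable hF.
    - by apply: measurableI; [exact: hist_measurable hF|apply: measurable_incr => //; case/andP: fjt'].
    move=> w [[[Ew [i /= ij Hi]] nG] Kw]; split; first by split=> //; split => //; exists i.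
    move: ij; rewrite ltnS leq_eqVlt => /predU1P[ei|ij]; last first.
      by exfalso; apply: nG; split=> //; exists i.
    move: Hi Kw; rewrite ei /H /K /= => h1 h2.
    have := ler_distD (B t w) (B (f j) w) (B s w).
    rewrite (distrC (B (f j) w) (B t w)); lra.
  rewrite indep_incr_pr// mulrC ler_wpM2r ?pr_ge0//.
  apply: le_trans (incr_tail fjt' r0) _.
  by rewrite ler_pdivrMr ?exprn_gt0//; lra.
have := key m0.+1 (leqnn _) => k1.
have e := prD P (mG m0.+1 (leqnn _)) mK.
have le2 : pr (G m0.+1 `&` ~` K) <= pr E * pr [set w | r <= `|B t w - B s w|].
  have mA := measurable_normr_ge r.
  rewrite -(indep_incr_pr (t := t) (A := [set x : R | r <= `|x|]) _ hE)//; last by rewrite s0.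
  apply: pr_mono.
  - by apply: measurableI; [exact: mG|exact: measurableC].
  - by apply: measurableI; [exact: hist_measurable hE|exact: measurable_incr].
  by move=> w [[Ew _] /negP]; rewrite -leNgt.
have g0 := pr_ge0 P (G m0.+1).
rewrite -/(G m0.+1); lra.
Qed.
End BrownianMotion.

Lemma grid_dense (R : realType) (a h t : R) (U : set R) :
  0 < h -> a <= t <= a + h -> nbhs t U ->
  exists p i, (i < 2 ^ p)%N /\ U (a + h * i%:R / (2 ^ p)%:R).
Proof.
move=> h0 /andP[at_ ta] [e /= e0 eU].
have [p pe] : exists p, h / (2 ^ p)%:R < e.
  exists (Num.truncn (h / e)); rewrite ltr_pdivrMr ?ltr0n ?expn_gt0//.
  rewrite mulrC -ltr_pdivrMr//; apply: lt_le_trans (truncnS_gt _) _.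
  by rewrite ler_nat ltn_expl.
pose q : R := (2 ^ p)%:R.
have q0 : 0 < q by rewrite ltr0n expn_gt0.
(* The minimum only matters at [t = a + h], since the grid omits the right endpoint. *)
pose i := minn (Num.truncn ((t - a) * q / h)) (2 ^ p).-1.
have n0 : (0 < 2 ^ p)%N by rewrite expn_gt0.
exists p, i; split; first by rewrite /i; lia.
apply: eU; rewrite /= -/q.
have z0 : 0 <= (t - a) * q / h by rewrite divr_ge0 ?mulr_ge0 ?subr_ge0// ltW.
have /andP[tr1 tr2] := truncn_itv z0.
have ti : a + h * i%:R / q <= t.
  rewrite -lerBrDl ler_pdivrMr// -ler_pdivlMl// mulrC.
  by apply: le_trans tr1; rewrite ler_nat geq_minl.
have it : t <= a + h * i%:R / q + h / q.
  rewrite [leRHS](_ : _ = a + h * (i%:R + 1) / q); last by field; rewrite gt_eqF.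
  rewrite -lerBlDl ler_pdivlMr// natr1 -ler_pdivrMl// mulrC /i.
  case: (leqP (Num.truncn ((t - a) * q / h)) (2 ^ p).-1) => hh; first by rewrite ltW.
  by rewrite prednK// -/q ler_pdivrMr// mulrC ler_wpM2l ?(ltW q0)//; lra.
rewrite ger0_norm ?subr_ge0//; apply: le_lt_trans pe; rewrite -/q; lra.
Qed.

Section BrownianEscape.
Context d (Omega : measurableType d) (R : realType) (P : probability Omega R).
Local Notation pr := (pr P).
Variable B : R -> Omega -> R.
Hypothesis BM : brownian_motion P B.
Implicit Types (s t u r h : R).

Definition escape s h r := [set w | exists2 t, s <= t <= s + h & r < `|B t w - B s w|].

Definition grid_escape s h r p := \bigcup_(i in [set i | (i < 2 ^ p)%N])
  [set w | r < `|B (s + h * i%:R / (2 ^ p)%:R) w - B s w|].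

Lemma grid_in s h p i : 0 < h -> (i < 2 ^ p)%N ->
  s <= s + h * i%:R / (2 ^ p)%:R < s + h.
Proof.
move=> h0 ip; have q0 : 0 < (2 ^ p)%:R :> R by rewrite ltr0n expn_gt0.
apply/andP; split; first by rewrite lerDl divr_ge0// mulr_ge0// ltW.
by rewrite ltrD2l ltr_pdivrMr// ltr_pM2l// ltr_nat.
Qed.

(** The condition is open in time, so a continuous path that meets it at some time meets it at a
    dyadic time. The grids being nested, the event is an increasing limit of events covered by the
    grid inequality. *)
Lemma escapeE s h r : 0 <= s -> 0 < h -> escape s h r = \bigcup_p grid_escape s h r p.
Proof.
move=> s0 h0; apply/seteqP; split => w.
  move=> [t st rt]; have t0 : 0 <= t by case/andP: st => st _; exact: le_trans st.
  pose X u := `|B (Num.max u 0) w - B s w|.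
  have cX : {for t, continuous X}.
    apply: continuous_comp; last exact: norm_continuous.
    have cB := @continuous_max0 R (fun u => B u w) (@bm_continuous _ _ _ _ _ BM w) t.
    by apply: (@cvgB _ R^o); [exact: cB|exact: cvg_cst].
  have Xt : r < X t by rewrite /X max_l.
  have := cX _ (lt_nbhsr Xt) => /(grid_dense h0 st)[p [i [ip]]].
  rewrite /= /X => hi; exists p => //; exists i => //=.
  by move: hi; rewrite max_l//; have /andP[h1 _] := grid_in s h0 ip; exact: le_trans h1.
move=> [p _ [i /= ip hi]]; exists (s + h * i%:R / (2 ^ p)%:R) => //.
by have /andP[-> /ltW] := grid_in s h0 ip.
Qed.

Lemma measurable_absincr s t r : 0 <= s -> 0 <= t ->
  measurable [set w | r < `|B t w - B s w|].
Proof.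
move=> s0 t0; apply: (@hist_measurable _ _ _ _ _ BM (Num.max s t)).
by apply: hist_absincr_gt; rewrite ?s0 ?t0 ?le_max lexx ?orbT.
Qed.

Lemma measurable_grid_escape s h r p : 0 <= s -> 0 < h -> measurable (grid_escape s h r p).
Proof.
move=> s0 h0; apply: bigcup_measurable => i /= ip; apply: measurable_absincr => //.
by have /andP[h1 _] := grid_in s h0 ip; exact: le_trans h1.
Qed.

Lemma measurable_escape s h r : 0 <= s -> 0 < h -> measurable (escape s h r).
Proof.
move=> s0 h0; rewrite escapeE//; apply: bigcupT_measurable => p.
exact: measurable_grid_escape.
Qed.

Lemma escape_le s h r (E : set Omega) : 0 <= s -> 0 < h -> 0 < r ->
  12 * h <= r ^+ 2 -> hist B s E ->
  pr (E `&` escape s h (2 * r)) <= 12 * h / r ^+ 2 * pr E.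
Proof.
move=> s0 h0 r0 hr hE; rewrite escapeE// setI_bigcupr.
have mE := hist_measurable BM hE.
apply: pr_bigcup_le.
- by move=> p; apply: measurableI => //; exact: measurable_grid_escape.
- move=> p w [Ew [i /= ip hi]]; split=> //; exists (2 * i)%N => /=.
    by rewrite expnS ltn_pmul2l.
  by rewrite expnS !natrM mulrCA -mulf_div divff ?mul1r.
- move=> p; have st : 0 <= s < s + h by rewrite s0 ltrDl.
  have hs : s + h - s = h by rewrite addrC addKr.
  apply: le_trans (ottaviani_grid BM (t := s + h) (f := fun i => s + h * i%:R / (2 ^ p)%:R) s0 r0 _ _ _ hE) _.
  + by rewrite hs.
  + move=> i j ij; rewrite lerD2l ler_wpM2r ?invr_ge0// ler_wpM2l ?ler_nat// ltW//.
  + by move=> i ip; exact: grid_in.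
  have := incr_tail BM st r0; rewrite hs => hh.
  have := ler_wpM2l (pr_ge0 P E) hh; have := pr_ge0 P E.
  rewrite [12 * h / _](_ : _ = 2 * (6 * h / r ^+ 2)); last by field; rewrite gt_eqF.
  by nra.
Qed.

End BrownianEscape.

Section CircleBrownianMotion.
Context d (Omega : measurableType d) (R : realType) (P : probability Omega R).
Local Notation pr := (pr P).
Variable B : R -> Omega -> R.
Hypothesis BM : brownian_motion P B.
Hypothesis B0_uniform : forall v r, 0 <= r -> pr [set w | dint (B 0 w - v) <= r] <= 2 * r.
Implicit Types (s t u r h v y : R).

Lemma measurable_dint_B t v (A : set R) : 0 <= t -> measurable A ->
  measurable ((fun w => dint (B t w - v)) @^-1` A).
Proof.
move=> t0 mA; have := bm_measurable BM t0 measurableT (measurable_dint_sub v mA).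
by rewrite setTI.
Qed.

Lemma measurable_dint_le t v r : 0 <= t -> measurable [set w | dint (B t w - v) <= r].
Proof.
move=> t0; rewrite (_ : [set w | _] = (fun w => dint (B t w - v)) @^-1` `]-oo, r]).
  exact: measurable_dint_B.
by apply/seteqP; split => w /=; rewrite in_itv.
Qed.

Lemma measurable_dint_lt t v r : 0 <= t -> measurable [set w | dint (B t w - v) < r].
Proof.
move=> t0; rewrite (_ : [set w | _] = (fun w => dint (B t w - v)) @^-1` `]-oo, r[).
  exact: measurable_dint_B.
by apply/seteqP; split => w /=; rewrite in_itv.
Qed.

Lemma hist_dint_lt t v r : 0 <= t -> hist B t [set w | dint (B t w - v) < r].
Proof.
move=> t0; rewrite (_ : [set w | _] = B t @^-1` ((fun b => dint (b - v)) @^-1` `]-oo, r[)).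
  by apply: hist_preimage; [rewrite t0 lexx|exact: measurable_dint_sub].
by apply/seteqP; split => w /=; rewrite in_itv.
Qed.

Lemma hist_dint_le t v r : 0 <= t -> hist B t [set w | dint (B t w - v) <= r].
Proof.
move=> t0; rewrite (_ : [set w | _] = B t @^-1` ((fun b => dint (b - v)) @^-1` `]-oo, r])).
  by apply: hist_preimage; [rewrite t0 lexx|exact: measurable_dint_sub].
by apply/seteqP; split => w /=; rewrite in_itv.
Qed.

(** For [j < q], the reals with fractional part in [j/q, (j+1)/q[; these cells discretize an
    increment modulo 1. *)
Definition frac_cell (q j : nat) : set R :=
  \bigcup_(m in [set: int]) `[(m%:~R + j%:R / q%:R : R), (m%:~R + j.+1%:R / q%:R)[%classic.

Lemma measurable_frac_cell q j : measurable (frac_cell q j).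
Proof.
apply: (sigma_bigcup (@sigma_algebra_measurable _ _)) => m _; exact: measurable_itv.
Qed.

Lemma frac_cell_floor q j y : (0 < q)%N -> (j < q)%N -> frac_cell q j y ->
  Num.floor ((y - (Num.floor y)%:~R) * q%:R) = j.
Proof.
move=> q0 jq [m _] /=; rewrite in_itv/= => /andP[h1 h2].
have q1 : 0 < q%:R :> R by rewrite ltr0n.
have j1 : j.+1%:R / q%:R <= 1 :> R by rewrite ler_pdivrMr// mul1r ler_nat.
have j0 : 0 <= j%:R / q%:R :> R by rewrite divr_ge0.
have -> : Num.floor y = m.
  by apply: floor_def; rewrite intrD; apply/andP; split; lra.
apply: floor_def; rewrite -[(j%:Z + 1)]/(Posz (j + 1)) addn1 -!pmulrn.
rewrite -ler_pdivrMr// -ltr_pdivlMr//; apply/andP; split; lra.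
Qed.

Lemma frac_cell_exists q y : (0 < q)%N -> exists2 j, (j < q)%N & frac_cell q j y.
Proof.
move=> q0; have q1 : 0 < q%:R :> R by rewrite ltr0n.
have /andP[y1 y2] := floor_itv y; rewrite intrD in y2.
pose z := (y - (Num.floor y)%:~R) * q%:R.
have z0 : 0 <= z by rewrite mulr_ge0 ?subr_ge0.
have zq : z < q%:R by rewrite -[ltRHS]mul1r ltr_pM2r//; lra.
have /andP[t1 t2] := truncn_itv z0.
exists (Num.truncn z); first by rewrite -(ltr_nat R) (le_lt_trans t1).
exists (Num.floor y) => //; rewrite /= in_itv/= -!lerBrDl -ltrBlDl.
by rewrite ler_pdivrMr// ltr_pdivlMr// t1 t2.
Qed.

(* The increment is replaced by the left end of its cell modulo 1, a constant,
   so that only the law of the starting point is needed. *)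
Lemma dint_B_le t v r : 0 <= t -> 0 <= r -> pr [set w | dint (B t w - v) <= r] <= 2 * r.
Proof.
rewrite le_eqVlt => /predU1P[<-|t0] r0; first exact: B0_uniform.
have st : 0 <= (0:R) < t by rewrite lexx.
apply/ler_addgt0Pl => e e0.
have [q [q0 qe]] : exists q, (0 < q)%N /\ 2 / q%:R < e.
  exists (Num.truncn (2 / e)).+1; split=> //.
  by rewrite ltr_pdivrMr// mulrC -ltr_pdivrMr// truncnS_gt.
have q1 : 0 < q%:R :> R by rewrite ltr0n.
pose C j := (B t \- B 0) @^-1` frac_cell q j.
have mC j : measurable (C j).
  by apply: (measurable_incr BM) => //; [exact: ltW|exact: measurable_frac_cell].
pose E j := [set w | dint (B 0 w - (v - j%:R / q%:R)) <= r + q%:R^-1].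
have hE j : hist B 0 (E j).
  rewrite (_ : E j = B 0 @^-1` ((fun b => dint (b - (v - j%:R / q%:R))) @^-1` `]-oo, (r + q%:R^-1)])).
    by apply: hist_preimage; [rewrite lexx|exact: measurable_dint_sub].
  by apply/seteqP; split => w; rewrite /E /= in_itv.
have mE j : measurable (E j) := hist_measurable BM (hE j).
apply: (@le_trans _ _ (\sum_(j <- iota 0 q) pr (E j `&` C j))).
  apply: pr_cover; first by apply: measurable_dint_le; exact: ltW.
    by move=> j; exact: measurableI.
  move=> w /= hw; have [j jq cj] := frac_cell_exists (B t w - B 0 w) q0.
  exists j; first by rewrite mem_iota.
  split=> //; rewrite /E /=; have [m _] := cj.
  rewrite /= in_itv/= -natr1 => /andP[m1 m2].
  rewrite -(dintDz _ m); apply: le_trans (dint_dist _ (B t w - v)) _.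
  rewrite lerD// ler_norml.
  have -> : q%:R^-1 = 1 / q%:R :> R by rewrite mul1r.
  move: m2; rewrite mulrDl => m2; apply/andP; split; lra.
apply: (@le_trans _ _ (\sum_(j <- iota 0 q) (2 * (r + q%:R^-1)) * pr (C j))).
  apply: ler_sum => j _; rewrite (indep_incr_pr BM st (hE j) (measurable_frac_cell _ _)).
  by rewrite ler_wpM2r ?pr_ge0// B0_uniform// addr_ge0// invr_ge0.
rewrite -mulr_sumr; apply: (@le_trans _ _ (2 * (r + q%:R^-1) * 1)).
  apply: ler_wpM2l; first by rewrite mulr_ge0// addr_ge0// invr_ge0.
  rewrite -(pr_setT P); apply: pr_sum_le => // w; rewrite indicT.
  have [j0 j0q cj0] := frac_cell_exists (B t w - B 0 w) q0.
  rewrite (bigD1_seq j0)/= ?mem_iota ?iota_uniq//= big_seq_cond big1 ?addr0.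
    by rewrite indicE; case: (_ \in _).
  move=> j /andP[]; rewrite mem_iota /= add0n => jq jj0.
  rewrite indicE memNset// => cj; move/eqP: jj0; apply.
  have := frac_cell_floor q0 jq cj.
  by rewrite (frac_cell_floor q0 j0q cj0) => -[].
rewrite mulr1 mulrDr [X in _ + X <= _](_ : _ = 2 / q%:R)//; lra.
Qed.

(** The points at distance at least [r] from [v] are those at distance at most [1 / 2 - r] from its
    antipode, so the upper bound applied to both balls leaves no room. *)
Lemma dint_B_lt t v r : 0 <= t -> 0 <= r <= 1 / 2 ->
  pr [set w | dint (B t w - v) < r] = 2 * r.
Proof.
move=> t0 /andP[r0 r1]; have mL := measurable_dint_lt v r t0.
apply/eqP; rewrite eq_le; apply/andP; split.
  apply: le_trans (dint_B_le v t0 r0); apply: pr_mono => //; first exact: measurable_dint_le.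
  by move=> w /= /ltW.
have h : 0 <= 1 / 2 - r by lra.
have := dint_B_le (v - 1 / 2) t0 h.
rewrite (_ : [set w | _] = ~` [set w | dint (B t w - v) < r]).
  rewrite pr_setC//; lra.
apply/seteqP; split => w /=; rewrite (_ : B t w - (v - 1 / 2) = B t w - v + 1 / 2); try ring.
  by rewrite dintD_half => ?; apply/negP; rewrite -leNgt; lra.
by move/negP; rewrite -leNgt dintD_half; lra.
Qed.

(** If both positions are within [r] of [v], the increment is within [2 r] of an integer, and it is
    independent of the position at time [s]. The constant is [2 * 96 * 2 = 384], rounded up. *)
Lemma dint_B_pair s t v r : 0 <= s < t -> t - s <= 1 -> 0 < r ->
  pr ([set w | dint (B s w - v) < r] `&` [set w | dint (B t w - v) < r])
    <= 400 * r ^+ 2 / Num.sqrt (t - s).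
Proof.
move=> st ts r0; have /andP[s0 sltt] := st.
have t0 : 0 <= t by rewrite (le_trans s0)// ltW.
have r20 : 0 < 2 * r by rewrite mulr_gt0.
have q0 : 0 < Num.sqrt (t - s) by rewrite sqrtr_gt0 subr_gt0.
have mA : measurable [set x : R | dint x < 2 * r].
  rewrite (_ : [set x | _] = (fun x => dint (x - 0)) @^-1` `]-oo, (2 * r)[).
    exact: measurable_dint_sub.
  by apply/seteqP; split => b; rewrite /= in_itv/= subr0.
apply: (@le_trans _ _ (pr ([set w | dint (B s w - v) < r] `&`
    (B t \- B s) @^-1` [set x : R | dint x < 2 * r]))).
  apply: pr_mono.
  - by apply: measurableI; exact: measurable_dint_lt.
  - by apply: measurableI; [exact: measurable_dint_lt|exact: (measurable_incr BM)].
  move=> w /= [h1 h2]; split=> //.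
  have := dintD (B t w - v) (- (B s w - v)).
  rewrite dintN (_ : B t w - v + _ = B t w - B s w); first by lra.
  by ring.
rewrite (indep_incr_pr BM st (hist_dint_lt v r s0) mA).
have h1 : pr [set w | dint (B s w - v) < r] <= 2 * r.
  apply: le_trans (dint_B_le v s0 (ltW r0)); apply: pr_mono.
  - exact: measurable_dint_lt.
  - exact: measurable_dint_le.
  - by move=> w /= /ltW.
have h2 := incr_dint BM st ts r20.
apply: (le_trans (ler_pM (pr_ge0 _ _) (pr_ge0 _ _) h1 h2)).
rewrite [leLHS](_ : _ = 384 * r ^+ 2 / Num.sqrt (t - s)); last by field; rewrite gt_eqF.
apply: ler_wpM2r; first by rewrite invr_ge0 ltW.
by apply: ler_wpM2r; [exact: sqr_ge0|lra].
Qed.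

(* The start is split into shells at depth about j sqrt h below r; leaving from
   the j-th shell requires a displacement of at least j sqrt h. *)
Lemma dint_B_exit s v r h (X : set Omega) : 0 <= s -> 0 < h -> r <= 1 / 2 ->
  measurable X ->
  X `<=` [set w | exists2 t, s <= t <= s + h & r <= dint (B t w - v)] ->
  pr ([set w | dint (B s w - v) < r] `&` X) <= 400 * Num.sqrt h.
Proof.
move=> s0 h0 r1 mX Xexit; set g := Num.sqrt h.
have g0 : 0 < g by rewrite sqrtr_gt0.
have g2 : g ^+ 2 = h by rewrite sqr_sqrtr// ltW.
pose D w := dint (B s w - v).
pose Sh (j : nat) := [set w | D w <= r - j%:R * g] `&` ~` [set w | D w < r - j.+1%:R * g].
have hSh j : hist B s (Sh j).
  apply: (sigmaI (hist_sigma _ _)); first exact: hist_dint_le.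
  by apply: (sigmaC (hist_sigma _ _)); exact: hist_dint_lt.
have mSh j : measurable (Sh j) := hist_measurable BM (hSh j).
have prD0 a : a <= 1 / 2 -> pr [set w | D w < a] = 2 * Num.max a 0.
  move=> a2; have [a0|a0] := leP 0 a; first by rewrite dint_B_lt// a0.
  rewrite (_ : [set w | _] = set0) ?pr_set0 ?mulr0// -subset0 => w /= h1.
  by have := dint_ge0 (B s w - v); rewrite /D in h1; lra.
have prD1 a : pr [set w | D w <= a] <= 2 * Num.max a 0.
  have [a0|a0] := leP 0 a; first by rewrite dint_B_le.
  rewrite (_ : [set w | _] = set0) ?pr_set0 ?mulr0// -subset0 => w /= h1.
  by have := dint_ge0 (B s w - v); rewrite /D in h1; lra.
have prSh j : pr (Sh j) <= 2 * g.
  rewrite prD; [|exact: measurable_dint_le|exact: measurable_dint_lt].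
  have sub : [set w | D w < r - j.+1%:R * g] `<=` [set w | D w <= r - j%:R * g].
    by move=> w /= /ltW h1; rewrite (le_trans h1)// lerB// ler_wpM2r ?(ltW g0)// ler_nat.
  have jg : 0 <= j%:R * g by rewrite mulr_ge0// ltW.
  have jg1 : j.+1%:R * g = j%:R * g + g by rewrite -natr1 mulrDl mul1r.
  have := prD1 (r - j%:R * g); rewrite (setIidr sub) prD0 ?jg1; last lra.
  by rewrite /Num.max; do 2 case: ifPn; rewrite -?leNgt => *; lra.
(* [escape_le] requires [12 h <= ((j - 1) g / 2)^2], which [j >= 9] guarantees; nearer shells are
   counted in full. Taking [j - 1] instead of [j] leaves room for the strict inequality in
   [escape]. *)
pose E (j : nat) := if (j < 9)%N then Sh j else Sh j `&` escape B s h (2 * ((j%:R - 1) * g / 2)).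
have mE j : measurable (E j).
  by rewrite /E; case: ifP => // _; apply: measurableI => //; exact: (measurable_escape BM).
have [J hJ] : exists J, forall z : R, z <= r / g -> (Num.truncn z < J)%N.
  by exists (Num.truncn (r / g)).+1 => z zr; rewrite ltnS le_truncn.
have cover : pr ([set w | D w < r] `&` X) <= \sum_(j <- iota 0 J) pr (E j).
  apply: pr_cover => //; first by apply: measurableI => //; exact: measurable_dint_lt.
  move=> w [/= Dr Xw]; have z0 : 0 <= (r - D w) / g.
    by rewrite divr_ge0 ?(ltW g0)// subr_ge0 ltW.
  have /andP[t1 t2] := truncn_itv z0.
  set j := Num.truncn ((r - D w) / g) in t1 t2 *.
  have D0 : 0 <= D w := dint_ge0 _.
  move: t1 t2; rewrite ler_pdivlMr// ltr_pdivrMr// => t1 t2.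
  exists j.
    rewrite mem_iota /=; apply: hJ.
    by rewrite ler_wpM2r ?invr_ge0 ?(ltW g0)//; lra.
  have [t st rt] := Xexit _ Xw.
  have := dint_dist (B t w - v) (B s w - v); rewrite -/(D w).
  rewrite (_ : B t w - v - _ = B t w - B s w); last by ring.
  move=> hd; have Shj : Sh j w.
    split; rewrite /= -?natr1 ?mulrDl ?mul1r; first by lra.
    by move=> h1; move: t2; rewrite -natr1 mulrDl mul1r; lra.
  rewrite /E; case: ltnP => // j9; split=> //.
  by exists t => //; have [h1 _] := Shj; move: h1 => /= h1; lra.
apply: (le_trans cover).
(* A telescoping majorant: a shell has mass at most [2 g] and, when far, is left with conditional
   probability at most [48 / (j - 1)^2]. *)
have Ele j : pr (E j) <= 200 * g * (j.+1%:R^-1 - j.+2%:R^-1).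
  have j0 := ler0n R j.
  have -> : j.+1%:R^-1 - j.+2%:R^-1 = ((j%:R + 1) * (j%:R + 2))^-1 :> R.
    by rewrite -!natr1; field; rewrite !gt_eqF//; lra.
  have p0 : 0 < (j%:R + 1) * (j%:R + 2) :> R by apply: mulr_gt0; lra.
  rewrite ler_pdivlMr// /E; case: ltnP => j9.
    have j8 : j%:R <= 8 :> R by rewrite (ler_nat R j 8).
    have : (j%:R + 1) * (j%:R + 2) <= 100 :> R by nra.
    by have := prSh j; have := pr_ge0 P (Sh j); nra.
  have j9' : 9 <= j%:R :> R by rewrite (ler_nat R 9 j).
  pose a : R := (j%:R - 1) * g / 2.
  have a0 : 0 < a by rewrite divr_gt0// mulr_gt0//; lra.
  have a2 : 12 * h <= a ^+ 2.
    have -> : a ^+ 2 = (j%:R - 1) ^+ 2 / 4 * g ^+ 2 by rewrite /a; field.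
    by rewrite -g2 ler_wpM2r ?sqr_ge0//; nra.
  have := escape_le BM s0 h0 a0 a2 (hSh j); rewrite -/a => h1.
  apply: le_trans (ler_wpM2r (ltW p0) h1) _.
  have e : 12 * h / a ^+ 2 = 48 / (j%:R - 1) ^+ 2.
    by rewrite /a -g2; field; rewrite !gt_eqF//; lra.
  have d0 : 0 < (j%:R - 1) ^+ 2 :> R by rewrite exprn_gt0//; lra.
  have h2 : 48 / (j%:R - 1) ^+ 2 * ((j%:R + 1) * (j%:R + 2)) <= 100 :> R.
    by rewrite mulrAC ler_pdivrMr//; nra.
  rewrite e mulrAC.
  have c0 : 0 <= 48 / (j%:R - 1) ^+ 2 * ((j%:R + 1) * (j%:R + 2)) :> R.
    by rewrite mulr_ge0// ?ltW// divr_gt0.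
  by have := prSh j; have := pr_ge0 P (Sh j); nra.
apply: (@le_trans _ _ (\sum_(j <- iota 0 J) 200 * g * (j.+1%:R^-1 - j.+2%:R^-1))).
  by apply: ler_sum => j _.
rewrite -mulr_sumr (_ : iota 0 J = index_iota 0 J); last by rewrite /index_iota subn0.
rewrite (@telescope_sumr_eq _ 0 J (fun n => - n.+1%:R^-1))//; last first.
  by move=> k _; rewrite opprK addrC.
rewrite opprK invr1.
have J0 : 0 < J.+1%:R^-1 :> R by rewrite invr_gt0.
apply: (@le_trans _ _ (200 * g * 1)); last by lra.
by apply: ler_wpM2l; [rewrite mulr_ge0// ltW|rewrite gerDr oppr_le0 ltW].
Qed.

End CircleBrownianMotion.

(** Bolzano-Weierstrass, phrased with a cluster point so that no subsequence has to be extracted. *)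
Lemma segment_cluster (R : realType) (a b : R) (u : nat -> R) :
  (forall k, a <= u k <= b) ->
  exists2 t, a <= t <= b & forall V, nbhs t V -> forall K, exists2 k, (K <= k)%N & V (u k).
Proof.
move=> uab; have := @segment_compact R a b (u x @[x --> \oo]) _.
have Fab : (u x @[x --> \oo]) `[a, b]%classic.
  by exists 0%N => // k _ /=; rewrite in_itv/= uab.
move=> /(_ _ Fab) [t [tab ct]]; exists t; first by move: tab; rewrite /= in_itv.
move=> V tV K.
have FK : (u x @[x --> \oo]) [set u k | k in [set k | (K <= k)%N]].
  by exists K => // k /= Kk; exists k.
by have [_ [[k /= Kk <-] Vk]] := ct _ _ FK tV; exists k.
Qed.

(** * Uncovered times *)

Section HittingEvents.
Context (Omega : Type) (R : realType) (G : set (set Omega)).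
Hypothesis sG : sigma_algebra setT G.
Variables (X : nat -> R -> Omega -> R) (c : nat -> R).
Implicit Types (a h t r : R) (s : seq nat).

Definition hit s a h := [set w | exists2 t, a <= t <= a + h & forall n, n \in s -> c n <= X n t w].

(** The slack [e] serves two purposes: it is zero when the conditions hold exactly, and
    [1 / (k + 1)] when they were relaxed to become visible on a grid. *)
Lemma hit_limit (u : nat -> R) (e : nat -> R) (w : Omega) (n : nat) t :
  {for t, continuous (fun t => X n t w)} ->
  (forall V, nbhs t V -> forall K, exists2 k, (K <= k)%N & V (u k)) ->
  (forall eps, 0 < eps -> exists K, forall k, (K <= k)%N -> e k < eps) ->
  (exists K, forall k, (K <= k)%N -> c n - e k <= X n (u k) w) ->
  c n <= X n t w.
Proof.
move=> cX ut e0 [K1 hK1]; apply/ler_addgt0Pl => eps eps0.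
have eps2 : 0 < eps / 2 by rewrite divr_gt0.
have lt1 : X n t w < X n t w + eps / 2 by rewrite ltrDl.
have tV := cX _ (lt_nbhsl lt1).
have [K hK] := e0 _ eps2.
have [k] := ut _ tV (maxn K K1); rewrite geq_max => /andP[Kk K1k] /= hk.
by have := hK k Kk; have := hK1 k K1k; lra.
Qed.

(** Compactness: times that meet the conditions below [m] cluster, as [m] grows, at a time that
    meets them all, the conditions being closed. *)
Lemma hit_bigcap N a h w :
  (forall n, (N <= n)%N -> continuous (fun t => X n t w)) ->
  (forall m, hit (index_iota N m) a h w) ->
  exists2 t, a <= t <= a + h & forall n, (N <= n)%N -> c n <= X n t w.
Proof.
move=> cX hm; have hm' m : exists t, a <= t <= a + h /\ forall n, n \in index_iota N m -> c n <= X n t w.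
  by have [t ? ?] := hm m; exists t.
have /choice[u hu] := hm'.
have [t tab ut] := @segment_cluster R a (a + h) u (fun k => (hu k).1).
exists t => // n Nn; apply: (@hit_limit u (fun=> 0) w n t (cX n Nn t) ut).
  by move=> eps eps0; exists 0%N.
exists n.+1 => k nk; rewrite subr0; apply: (hu k).2.
by rewrite mem_index_iota Nn.
Qed.

(** A closed condition can hold at a single time that no grid contains. Relaxed by [1 / (k + 1)] it
    becomes open and is seen at dyadic times; a cluster point of the relaxed solutions brings back
    the exact one. *)
Lemma hit_sigma s a h : 0 < h ->
  (forall n w, n \in s -> continuous (fun t => X n t w)) ->
  (forall n t r, n \in s -> a <= t -> G [set w | X n t w < r]) ->
  G (hit s a h).
Proof.
move=> h0 cX GX.
pose g (z : nat * nat) : R := a + h * z.2%:R / (2 ^ z.1)%:R.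
rewrite (_ : hit s a h = \bigcap_(k in [set: nat])
    \bigcup_(z in [set z : nat * nat | (z.2 < 2 ^ z.1)%N])
      \bigcap_(n in [set n | n \in s]) ~` [set w | X n (g z) w < c n - k.+1%:R^-1]).
  apply: (sigma_bigcap sG) => k _; apply: (sigma_bigcup sG) => z /= zz.
  apply: (sigma_bigcap sG) => n /= ns; apply: (sigmaC sG); apply: GX => //.
  by have /andP[] := grid_in a h0 zz.
apply/seteqP; split => w /=.
  move=> [t tab ht] k _.
  have V : nbhs t [set u | forall n, n \in s -> c n - k.+1%:R^-1 < X n u w].
    elim: s cX ht {GX} => [|n s IH] cX ht; first by apply: (@filterE _ (nbhs t)) => u m; rewrite in_nil.
    have cs m w' : m \in s -> continuous (fun t => X m t w').
      by move=> ms; apply: cX; rewrite inE ms orbT.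
    have hs m : m \in s -> c m <= X m t w by move=> ms; apply: ht; rewrite inE ms orbT.
    have lt1 : c n - k.+1%:R^-1 < X n t w.
      by apply: lt_le_trans (ht n (mem_head _ _)); rewrite gtrBl invr_gt0.
    have nV := cX n w (mem_head _ _) t _ (lt_nbhsr lt1).
    apply: (@filterS2 _ (nbhs t) _ _ _ _ _ nV (IH cs hs)) => u /= h1 h2 m.
    by rewrite inE => /predU1P[->|]; [exact: h1|exact: h2].
  have [p [i [ip hi]]] := grid_dense h0 tab V.
  exists (p, i) => //= n /= ns; apply/negP; rewrite -leNgt ltW//; exact: hi.
move=> hk; have hk' k : exists t, a <= t <= a + h /\ forall n, n \in s -> c n - k.+1%:R^-1 <= X n t w.
  have [z /= zz hz] := hk k I; exists (g z); split.
    by have /andP[-> /ltW] := grid_in a h0 zz.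
  by move=> n ns; have := hz n ns; move/negP; rewrite -leNgt.
have /choice[u hu] := hk'.
have [t tab ut] := @segment_cluster R a (a + h) u (fun k => (hu k).1).
exists t => // n ns; apply: (@hit_limit u (fun k => k.+1%:R^-1) w n t (cX n w ns t) ut).
  move=> eps eps0; exists (Num.truncn eps^-1) => k hk1.
  rewrite invf_plt ?posrE//; apply: lt_le_trans (truncnS_gt _) _.
  by rewrite ler_nat ltnS.
by exists 0%N => k _; exact: (hu k).2.
Qed.

End HittingEvents.

(** * Reduction of the model to distances from the fixed point *)

Section CoveringModel.
Context d (Omega : measurableType d) (R : realType) (P : probability Omega R).
Local Notation pr := (pr P).

(* What the covering argument uses about the distances [D n t] from the fixed
   point to the centres of the arcs. *)
Record distance_model (F : nat -> set (set Omega)) (D : nat -> R -> Omega -> R) (C : R) : Prop :=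
  DistanceModel {
    dm_sigma : forall n, (1 <= n)%N -> F n `<=` measurable /\ sigma_algebra setT (F n) ;
    dm_lt : forall n t r, (1 <= n)%N -> F n [set w | D n t w < r] ;
    dm_cont : forall n w, (1 <= n)%N -> continuous (fun t => D n t w) ;
    dm_indep : mutually_independent P [set n | (1 <= n)%N] F ;
    dm_law : forall n t r, (1 <= n)%N -> 0 <= t -> 0 <= r <= 1 / 2 ->
      pr [set w | D n t w < r] = 2 * r ;
    dm_pair : forall n s t r, (1 <= n)%N -> 0 <= s < t -> t - s <= 1 -> 0 < r ->
      pr ([set w | D n s w < r] `&` [set w | D n t w < r]) <= C * r ^+ 2 / Num.sqrt (t - s) ;
    dm_exit : forall n s h r, (1 <= n)%N -> 0 <= s -> 0 < h -> r <= 1 / 2 ->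
      pr ([set w | D n s w < r] `&` [set w | exists2 t, s <= t <= s + h & r <= D n t w])
        <= C * Num.sqrt h }.

(** Each [U n] has a lift [B] whose starting law is known only modulo 1, which is all that [dint]
    sees. Times are cut off at 0 so that the distances are continuous on the whole line. *)
Lemma brownian_distance_model (U : nat -> R -> Omega -> circle R) (x : circle R) :
  brownian_circle_model P U ->
  distance_model (fun n => process_sigma (@circle_borel R) `[0, +oo[ (U n))
    (fun n t w => circle_dist (U n (Num.max t 0) w) x) 400.
Proof.
move=> M; set F := fun n => _; set D := fun n t w => _.
have sF n : sigma_algebra setT (F n) by exact: smallest_sigma_algebra.
have DF n t r : (1 <= n)%N -> F n [set w | D n t w < r].
  move=> n1; apply: sub_gen_smallest; exists (Num.max t 0) => /=.
    by rewrite in_itv/= andbT le_max lexx orbT.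
  by exists [set y | circle_dist y x < r]; [exact: circle_dist_lt_borel|rewrite setTI].
pose v := repr x.
have DE n B t w : (forall t w, 0 <= t -> U n t w = circle_proj (B t w)) ->
    D n t w = dint (B (Num.max t 0) w - v).
  move=> UB; rewrite /D -(circle_proj_repr x) UB ?circle_distE//.
  by rewrite le_max lexx orbT.
have B0 n B : (1 <= n)%N -> (forall t w, 0 <= t -> U n t w = circle_proj (B t w)) ->
    forall v' r, 0 <= r -> pr [set w | dint (B 0 w - v') <= r] <= 2 * r.
  move=> n1 UB v' r r0; have := bcm_uniform M n1.
  move=> /(_ _ (circle_dist_le_borel (circle_proj v') r)).
  have := uniform_dint_le v' r0.
  rewrite /pr (_ : _ @^-1` _ = [set w | dint (B 0 w - v') <= r]); last first.
    by apply/seteqP; split => w /=; rewrite UB// circle_distE.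
  rewrite (_ : _ @^-1` _ = [set b | dint (b - v') <= r]); last first.
    by apply/seteqP; split => w /=; rewrite circle_distE.
  move=> h ->; rewrite -lee_fin fineK//.
  rewrite ge0_fin_numE; first by apply: le_lt_trans h _; rewrite ltry.
  exact: measure_ge0.
have m0 t : 0 <= t -> Num.max t 0 = t by move=> ?; rewrite max_l.
have cD n w : (1 <= n)%N -> continuous (fun t => D n t w).
  move=> n1; have [B BM UB] := bcm_brownian M n1.
  rewrite (_ : (fun t => _) = @dint R \o (fun t => B (Num.max t 0) w - v)); last first.
    by apply/funext => t; rewrite (DE n B).
  move=> t; apply: continuous_comp; last exact: continuous_dint.
  have cB := @continuous_max0 R (fun u => B u w) (@bm_continuous _ _ _ _ _ BM w) t.
  by apply: (@cvgB _ R^o); [exact: cB|exact: cvg_cst].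
split.
- move=> n n1; split=> //; apply: smallest_sub; first exact: sigma_algebra_measurable.
  have [B BM UB] := bcm_brownian M n1.
  move=> A [t /=]; rewrite in_itv/= andbT => t0 [S bS <-].
  rewrite (_ : _ `&` _ = setT `&` B t @^-1` (@circle_proj R @^-1` S)).
    exact: (bm_measurable BM t0 measurableT (measurable_circle_proj bS)).
  by apply/seteqP; split => w /=; rewrite UB.
- by move=> n t r n1; exact: DF.
- exact: cD.
- exact: bcm_indep M.
- move=> n t r n1 t0 r01; have [B BM UB] := bcm_brownian M n1.
  rewrite -(dint_B_lt BM (B0 n B n1 UB) v t0 r01); congr pr.
  by apply/seteqP; split => w /=; rewrite (DE n B)// m0.
- move=> n s t r n1 st ts r0; have [B BM UB] := bcm_brownian M n1.
  have /andP[s0 sltt] := st; have t0 : 0 <= t by rewrite (le_trans s0)// ltW.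
  apply: le_trans (dint_B_pair BM (B0 n B n1 UB) v st ts r0).
  by rewrite le_eqVlt; apply/orP; left; apply/eqP; congr pr;
    apply/seteqP; split => w /=; rewrite !(DE n B)// !m0.
- move=> n s h r n1 s0 h0 r1; have [B BM UB] := bcm_brownian M n1.
  set X := [set w | exists2 t, _ & _].
  rewrite (_ : [set w | D n s w < r] = [set w | dint (B s w - v) < r]); last first.
    by apply/seteqP; split => w /=; rewrite (DE n B)// m0.
  apply: (dint_B_exit BM (B0 n B n1 UB)) => //.
    have -> : X = hit D (fun=> r) [:: n] s h.
      apply/seteqP; split => w [t st ht]; exists t => //.
        by move=> m; rewrite inE => /eqP ->.
      exact/ht/mem_head.
    apply: (hit_sigma (@sigma_algebra_measurable _ _)) => //.
      by move=> m w; rewrite inE => /eqP ->; exact: cD.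
    move=> m t r'; rewrite inE => /eqP -> _.
    rewrite (_ : [set w | _] = [set w | dint (B (Num.max t 0) w - v) < r']).
      by apply: (measurable_dint_lt BM); rewrite le_max lexx orbT.
    by apply/seteqP; split => w /=; rewrite (DE n B).
  move=> w [t st ht]; exists t => //; move: ht; rewrite (DE n B)// m0//.
  by case/andP: st => st _; exact: le_trans st.
Qed.

End CoveringModel.

(** * Hausdorff measure *)

Section HausdorffCovers.
Variable R : realType.
Implicit Types (A V : set R) (s delta e : R).

Lemma sum_inv_exp2 n : \sum_(i < n) (2 ^ i.+1)%:R^-1 = 1 - (2 ^ n)%:R^-1 :> R.
Proof.
elim: n => [|n IH]; first by rewrite big_ord0 expn0 invr1 subrr.
rewrite big_ord_recr/= IH expnS natrM; field.
by rewrite gt_eqF// ltr0n expn_gt0.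
Qed.

(** Open balls replace arbitrary sets because compactness needs an open cover; a radius 0 gives an
    empty ball. Constant factors between radii and diameters do not affect null sets. *)
Definition ball_cover s delta e A := exists c r : nat -> R,
  [/\ forall i, 0 <= r i <= delta, A `<=` \bigcup_i [set x | `|x - c i| < r i] &
      forall n, \sum_(i < n) r i `^ s <= e].

Lemma ediam_ge0 V : (0 <= ediam V)%E.
Proof. by apply: ereal_sup_ubound; left. Qed.

Lemma ediam_dist V x y : V x -> V y -> (`|x - y|%:E <= ediam V)%E.
Proof. by move=> Vx Vy; apply: ereal_sup_ubound; right; exists (x, y). Qed.

Lemma ediam_le V e : 0 <= e -> (forall x y, V x -> V y -> `|x - y| <= e) ->
  (ediam V <= e%:E)%E.
Proof.
move=> e0 h; apply: ge_ereal_sup => z [->|[[x y] /= [Vx Vy] <-]]; rewrite lee_fin//.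
exact: h.
Qed.

Lemma hausdorff_content_ge0 s delta A : (0 <= hausdorff_content s delta A)%E.
Proof.
apply: le_ereal_inf_tmp => z [V _ <-]; apply: nneseries_ge0 => i _ _; exact: poweR_ge0.
Qed.

Lemma hausdorff_measure_ge0 s A : (0 <= hausdorff_measure s A)%E.
Proof.
apply: (@le_trans _ _ (hausdorff_content s 1 A)); first exact: hausdorff_content_ge0.
by apply: ereal_sup_ubound; exists 1 => //=; rewrite in_itv/= ltr01.
Qed.

Lemma hausdorff_dim_ge0 A : (0 <= hausdorff_dim A)%E.
Proof. by apply: le_ereal_inf_tmp => z [s [s0 _] <-]; rewrite lee_fin ltW. Qed.

Lemma hausdorff_dim_le s A : 0 < s -> hausdorff_measure s A = 0%E ->
  (hausdorff_dim A <= s%:E)%E.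
Proof. by move=> s0 hA; apply: ereal_inf_lbound; exists s. Qed.

Lemma hausdorff_dim_ge a A :
  (forall s, 0 < s < a -> hausdorff_measure s A <> 0%E) -> (a%:E <= hausdorff_dim A)%E.
Proof.
move=> h; apply: le_ereal_inf_tmp => z [s [s0 hs] <-]; rewrite lee_fin leNgt.
by apply/negP => sa; apply: (h s) hs; rewrite s0.
Qed.

Lemma ball_cover_measure0 s A : 0 < s ->
  (forall delta e, 0 < delta -> 0 < e -> ball_cover s delta e A) ->
  hausdorff_measure s A = 0%E.
Proof.
move=> s0 h; apply/eqP; rewrite eq_le hausdorff_measure_ge0 andbT.
apply: ge_ereal_sup => z [delta /=]; rewrite in_itv/= andbT => d0 <-.
apply/lee_addgt0Pr => e e0; rewrite add0e.
have p2 : 0 < 2 `^ s :> R by rewrite powR_gt0.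
have [c [r [r0 Ar rs]]] := h (delta / 2) (e / 2 `^ s) (divr_gt0 d0 (ltr0Sn _ 1)) (divr_gt0 e0 p2).
have dV i : (ediam [set x | (`|x - c i| < r i)%R] <= (2 * r i)%:E)%E.
  have /andP[ri0 _] := r0 i.
  apply: ediam_le; first by rewrite mulr_ge0.
  move=> x y /= hx hy; rewrite (_ : x - y = (x - c i) - (y - c i)); last by ring.
  by apply: (le_trans (ler_normB _ _)); lra.
apply: (@le_trans _ _ (\sum_(0 <= i <oo) (ediam [set x | (`|x - c i| < r i)%R] `^ s)%E)%E).
  apply: ereal_inf_lbound; exists (fun i => [set x | `|x - c i| < r i]) => //=; split=> // i.
  by apply: le_trans (dV i) _; rewrite lee_fin; have /andP[] := r0 i; lra.
apply: lime_le; first by apply: is_cvg_nneseries => i _ _; exact: poweR_ge0.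
apply: nearW => n.
apply: (@le_trans _ _ (\sum_(0 <= i < n) ((2 * r i) `^ s)%:E)%E).
  apply: lee_sum => i _; rewrite -poweR_EFin; have /andP[ri0 _] := r0 i.
  apply: gt0_ler_poweR => //; rewrite ?(ltW s0)// in_itv/= leey ?ediam_ge0//.
  by rewrite lee_fin mulr_ge0.
rewrite sumEFin lee_fin big_mkord.
rewrite (eq_bigr (fun i : 'I_n => 2 `^ s * r i `^ s)); last first.
  by move=> i _; rewrite powRM//; have /andP[] := r0 i.
by rewrite -mulr_sumr mulrC -ler_pdivlMr//; exact: rs.
Qed.

Lemma measure0_ball_cover s A delta e : 0 < s -> hausdorff_measure s A = 0%E ->
  0 < delta -> 0 < e -> ball_cover s delta e A.
Proof.
move=> s0 hA d0 e0.
have p2 : 0 < 2 `^ s :> R by rewrite powR_gt0.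
pose e' := e / (2 * 2 `^ s).
have e'0 : 0 < e' by rewrite divr_gt0// mulr_gt0.
have d2 : 0 < delta / 2 by rewrite divr_gt0.
have c0 : (hausdorff_content s (delta / 2) A < e'%:E)%E.
  apply: (@le_lt_trans _ _ 0%E); last by rewrite lte_fin.
  rewrite -hA; apply: ereal_sup_ubound; exists (delta / 2) => //=.
  by rewrite in_itv/= d2.
have [_ [V [AV Vd] <-] Vsum] := ereal_inf_lt c0.
have dfin i : ediam (V i) = (fine (ediam (V i)))%:E.
  rewrite fineK// ge0_fin_numE ?ediam_ge0//; exact: le_lt_trans (Vd i) (ltry _).
pose D i := fine (ediam (V i)).
have D0 i : 0 <= D i by rewrite fine_ge0// ediam_ge0.
have Dd i : D i <= delta / 2 by rewrite -lee_fin -dfin.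
(* The enlargement that makes room for open balls. Its s-th powers add up to at most [e'], and the
   factor 2 in [e'] shares [e] between diameters and enlargements. *)
pose eta i := Num.min (delta / 2) ((e' / (2 ^ i.+1)%:R) `^ s^-1).
have q0 i : 0 < e' / (2 ^ i.+1)%:R by rewrite divr_gt0// ltr0n expn_gt0.
have eta0 i : 0 < eta i by rewrite /eta lt_min d2 powR_gt0.
have etas i : eta i `^ s <= e' / (2 ^ i.+1)%:R.
  apply: (@le_trans _ _ (((e' / (2 ^ i.+1)%:R) `^ s^-1) `^ s)).
    apply: ge0_ler_powR; rewrite ?nnegrE ?powR_ge0 ?(ltW s0) ?(ltW (eta0 i))//.
    by rewrite ge_min lexx orbT.
  by rewrite -powRrM mulVf ?gt_eqF// powRr1// ltW.
(* Any point of [V i] will do as a centre; the default 0 is taken only when [V i] is empty and has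
   nothing to cover. *)
pose c i := if pselect (exists x, V i x) is left h then projT1 (cid h) else 0.
exists c, (fun i => D i + eta i); split.
- move=> i; rewrite addr_ge0//= ?(ltW (eta0 i))//; have : eta i <= delta / 2 by rewrite /eta ge_min lexx.
  by have := Dd i; lra.
- move=> x /AV[i _ Vix]; exists i => //=; rewrite /c; case: pselect => [h|h]; last by case: h; exists x.
  case: cid => y /= Viy; have := ediam_dist Vix Viy.
  by rewrite dfin lee_fin => h'; have := eta0 i; rewrite -/(D i) in h' *; lra.
- move=> n.
  have term i : (D i + eta i) `^ s <= 2 `^ s * (D i `^ s + e' / (2 ^ i.+1)%:R).
    apply: (@le_trans _ _ ((2 * Num.max (D i) (eta i)) `^ s)).
      have De0 : 0 <= D i + eta i by rewrite addr_ge0// ltW.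
      have m0 : 0 <= 2 * Num.max (D i) (eta i) by rewrite mulr_ge0// le_max D0.
      apply: ge0_ler_powR; rewrite ?nnegrE ?(ltW s0)//.
      by rewrite /Num.max; case: ifPn; rewrite -?leNgt => ?; lra.
    rewrite powRM ?le_max ?D0// ler_wpM2l ?powR_ge0//.
    have := etas i; have := powR_ge0 (D i) s; have := powR_ge0 (eta i) s.
    by rewrite /Num.max; case: ifPn => _ ? ? ?; lra.
  apply: (@le_trans _ _ (\sum_(i < n) 2 `^ s * (D i `^ s + e' / (2 ^ i.+1)%:R))).
    by apply: ler_sum => i _.
  rewrite -mulr_sumr big_split/= mulrDr.
  have h1 : \sum_(i < n) D i `^ s <= e'.
    rewrite -lee_fin -sumEFin; apply: le_trans (ltW Vsum).
    rewrite (eq_bigr (fun i : 'I_n => (ediam (V i) `^ s)%E)); last first.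
      by move=> i _; rewrite dfin poweR_EFin.
    rewrite -(big_mkord xpredT (fun i => (ediam (V i) `^ s)%E)).
    by apply: nneseries_lim_ge => i _ _; exact: poweR_ge0.
  have h2 : \sum_(i < n) e' / (2 ^ i.+1)%:R <= e'.
    rewrite -mulr_sumr -[leRHS]mulr1; apply: ler_wpM2l; first exact: ltW.
    by rewrite sum_inv_exp2 gerBl invr_ge0.
  have -> : e = 2 `^ s * e' + 2 `^ s * e' by rewrite /e'; field; rewrite gt_eqF.
  by rewrite lerD// ler_wpM2l// ltW.
Qed.

Lemma bigcup_measure0 s (A : nat -> set R) : 0 < s ->
  (forall n, hausdorff_measure s (A n) = 0%E) ->
  hausdorff_measure s (\bigcup_n A n) = 0%E.
Proof.
move=> s0 hA; apply: ball_cover_measure0 => // delta e d0 e0.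
have q0 j : 0 < e / (2 ^ j.+1)%:R by rewrite divr_gt0// ltr0n expn_gt0.
have /choice[c /choice[r hr]] : forall j, exists c r : nat -> R,
  [/\ forall i, 0 <= r i <= delta, A j `<=` \bigcup_i [set x | `|x - c i| < r i] &
      forall n, \sum_(i < n) r i `^ s <= e / (2 ^ j.+1)%:R].
  by move=> j; exact: measure0_ball_cover.
have /card_esym/ppcard_eqP[f] := card_nat2.
exists (fun k => c (f k).1 (f k).2), (fun k => r (f k).1 (f k).2); split.
- by move=> i; have [h _ _] := hr (f i).1; exact: h.
- move=> x [j _ Ajx]; have [_ h _] := hr j; have [i _ hi] := h _ Ajx.
  by exists (f^-1%FUN (j, i)) => //=; rewrite invK ?inE.
move=> n.
(* The first [n] pairs lie in an [N] by [N] square, where the double sum can be bounded row by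
   row. *)
pose N := (\max_(k < n) maxn (f k).1 (f k).2).+1.
have fN (k : 'I_n) : ((f k).1 < N)%N /\ ((f k).2 < N)%N.
  have := leq_bigmax (F := fun k : 'I_n => maxn (f k).1 (f k).2) k.
  by rewrite geq_max /N !ltnS => /andP[].
pose phi (k : 'I_n) : 'I_N * 'I_N := (Ordinal (fN k).1, Ordinal (fN k).2).
have phi_inj : injective phi.
  move=> k l [h1 h2]; apply: val_inj.
  have /(congr1 f^-1%FUN) : f k = f l by rewrite (surjective_pairing (f k)) h1 h2 -surjective_pairing.
  by rewrite !funK ?inE.
pose F (p : 'I_N * 'I_N) := r p.1 p.2 `^ s.
have F0 p : 0 <= F p by exact: powR_ge0.
apply: (@le_trans _ _ (\sum_p F p)).
  rewrite (eq_bigr (fun k : 'I_n => F (phi k)))//.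
  rewrite -(big_imset F (in2W phi_inj))/= [leRHS](bigID (mem [set phi k | k : 'I_n]%SET))/=.
  rewrite lerDl; exact: sumr_ge0.
rewrite -(pair_bigA _ (fun j i : 'I_N => r j i `^ s))/=.
apply: (@le_trans _ _ (\sum_(j < N) e / (2 ^ j.+1)%:R)).
  by apply: ler_sum => j _; have [_ _ h] := hr j; exact: h.
rewrite -mulr_sumr -[leRHS]mulr1; apply: ler_wpM2l; first exact: ltW.
by rewrite sum_inv_exp2 gerBl invr_ge0.
Qed.

End HausdorffCovers.

(** * Upper bounds *)

Section HittingEstimates.
Context d (Omega : measurableType d) (R : realType) (P : probability Omega R).
Local Notation pr := (pr P).
Variables (F : nat -> set (set Omega)) (D : nat -> R -> Omega -> R) (C : R).
Hypothesis dm : distance_model P F D C.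
Variable ell : nat -> R.
Hypothesis ell_gt0 : forall n, (1 <= n)%N -> 0 < ell n.
Implicit Types (a h t r : R) (s : seq nat) (N n k M : nat).

Definition radius n : R := ell n / 2.
Definition uncovered s a h := hit D radius s a h.
Definition past m := <<s \bigcup_(j in [set j | (1 <= j < m)%N]) F j >>.

Lemma past_sigma m : sigma_algebra setT (past m).
Proof. exact: smallest_sigma_algebra. Qed.

Lemma past_in m k E : (1 <= k < m)%N -> F k E -> past m E.
Proof. by move=> km FE; apply: sub_gen_smallest; exists k. Qed.

Lemma past_mono m m' E : (m <= m')%N -> past m E -> past m' E.
Proof.
move=> mm; apply: sub_smallest2r; first exact: past_sigma.
by move=> A [k /= /andP[k1 km] FA]; exists k => //=; rewrite k1 (leq_trans km).
Qed.

Lemma past_measurable m : past m `<=` measurable.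
Proof.
apply: smallest_sub; first exact: sigma_algebra_measurable.
by move=> A [k /= /andP[k1 km] FA]; apply: (dm_sigma dm k1).1.
Qed.

Lemma uncovered_sigma k a h : (1 <= k)%N -> 0 < h -> F k (uncovered [:: k] a h).
Proof.
move=> k1 h0; apply: (hit_sigma (dm_sigma dm k1).2) => //.
  by move=> m w; rewrite inE => /eqP ->; exact: (dm_cont dm).
by move=> m t r; rewrite inE => /eqP -> _; exact: (dm_lt dm).
Qed.

Lemma uncovered_past s a h m : (forall k, k \in s -> (1 <= k < m)%N) -> 0 < h ->
  past m (uncovered s a h).
Proof.
move=> sm h0; apply: (hit_sigma (past_sigma _)) => //.
  by move=> k w ks; apply: (dm_cont dm); have /andP[] := sm k ks.
move=> k t r ks _; apply: (past_in (sm k ks)).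
by apply: (dm_lt dm); have /andP[] := sm k ks.
Qed.

Lemma measurable_uncovered s a h : (forall k, k \in s -> (1 <= k)%N) -> 0 < h ->
  measurable (uncovered s a h).
Proof.
move=> s1 h0; apply: (@past_measurable (\max_(k <- s) k).+1).
apply: uncovered_past => // k ks; rewrite s1//= ltnS.
by rewrite (big_rem k)//= leq_maxl.
Qed.

Lemma exit_const_ge0 : 0 <= C.
Proof.
have h : (0 : R) <= 1 / 2 by rewrite divr_ge0.
have := dm_exit dm (leqnn 1) (lexx 0) ltr01 h; rewrite sqrtr1 mulr1.
by apply: le_trans; exact: pr_ge0.
Qed.

(** Either the arc misses the point at time [a], or it covers it then and leaves it by time
    [a + h]. *)
Lemma uncovered1_le k a h : (1 <= k)%N -> ell k <= 1 -> 0 <= a -> 0 < h ->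
  pr (uncovered [:: k] a h) <= 1 - ell k + C * Num.sqrt h.
Proof.
move=> k1 l1 a0 h0; have l0 := ell_gt0 k1.
have r12 : radius k <= 1 / 2 by rewrite /radius; lra.
have r0 : 0 <= radius k <= 1 / 2 by rewrite r12 andbT /radius; lra.
pose L := [set w | D k a w < radius k].
have mL : measurable L by apply: (dm_sigma dm k1).1; exact: (dm_lt dm).
have mU : measurable (uncovered [:: k] a h).
  by apply: measurable_uncovered => // m; rewrite inE => /eqP ->.
have := dm_exit dm k1 a0 h0 r12.
rewrite (_ : [set w | exists2 t, _ & _] = uncovered [:: k] a h); last first.
  apply/seteqP; split => w [t st ht]; exists t => //.
    by move=> m; rewrite inE => /eqP ->.
  exact/ht/mem_head.
rewrite -/L => hexit.
have : pr (uncovered [:: k] a h) <= pr (~` L `|` (L `&` uncovered [:: k] a h)).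
  apply: pr_mono => //.
    by apply: measurableU; [exact: measurableC|exact: measurableI].
  by move=> w Uw; have [Lw|Lw] := pselect (L w); [right|left].
move=> /le_trans; apply; apply: le_trans (prU_le P _ _) _.
- exact: measurableC.
- exact: measurableI.
rewrite lerD// pr_setC// (dm_law dm k1 a0 r0) /radius; lra.
Qed.

(** Each arc may choose its own time in the interval. This is weaker than a common uncovered time,
    but it is an intersection of independent events. *)
Definition uncovered_each N n a h :=
  \bigcap_(k in [set k | k \in index_iota N n.+1]) uncovered [:: k] a h.

Lemma uncovered_each_past N n a h : (1 <= N)%N -> 0 < h ->
  past n.+1 (uncovered_each N n a h).
Proof.
move=> N1 h0; apply: (sigma_bigcap (past_sigma _)) => k /=.
rewrite mem_index_iota => /andP[Nk kn]; have k1 := leq_trans N1 Nk.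
by apply: (@past_in _ k); [rewrite k1|exact: uncovered_sigma].
Qed.

Lemma uncovered_each_le N n a h : (1 <= N)%N ->
  (forall k, (N <= k)%N -> ell k <= 1) -> 0 <= a -> 0 < h ->
  pr (uncovered_each N n a h) <= expR (\sum_(N <= k < n.+1) (C * Num.sqrt h - ell k)).
Proof.
move=> N1 l1 a0 h0.
rewrite (@mutually_independent_pr _ _ _ _ [set n | (1 <= n)%N] F) ?iota_uniq//; last 3 first.
- exact: (dm_indep dm).
- by move=> m m1; have [] := dm_sigma dm m1.
- move=> m; rewrite mem_index_iota => /andP[Nm _].
  by split; [exact: leq_trans Nm|apply: uncovered_sigma => //; exact: leq_trans Nm].
rewrite expR_sum big_seq [leRHS]big_seq; apply: ler_prod => k.
rewrite mem_index_iota => /andP[Nk _]; rewrite pr_ge0/=.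
apply: le_trans (uncovered1_le (leq_trans N1 Nk) (l1 k Nk) a0 h0) _.
by apply: le_trans (expR_ge1Dx _); lra.
Qed.

End HittingEstimates.

(** * The critical case: survival has probability zero *)

Section CriticalCovering.
Context d (Omega : measurableType d) (R : realType) (P : probability Omega R).
Local Notation pr := (pr P).
Variables (F : nat -> set (set Omega)) (D : nat -> R -> Omega -> R) (C : R).
Hypothesis dm : distance_model P F D C.
Variable ell : nat -> R.
Hypothesis ell_gt0 : forall n, (1 <= n)%N -> 0 < ell n.
Implicit Types (a h t r : R) (s : seq nat) (N n k M : nat).

Local Notation uncovered := (uncovered D ell).
Local Notation uncovered_each := (uncovered_each D ell).
Local Notation past := (past F).

Definition mesh M : R := ((M ^ 2)%:R)^-1.
Definition meshpt M (i : nat) : R := i%:R * mesh M.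

Lemma mesh_gt0 M : (0 < M)%N -> 0 < mesh M.
Proof. by move=> M0; rewrite invr_gt0 ltr0n expn_gt0 M0. Qed.

Lemma sqrt_mesh M : Num.sqrt (mesh M) = M%:R^-1.
Proof. by rewrite /mesh natrX -exprVn sqrtr_sqr ger0_norm// invr_ge0. Qed.

Lemma meshpt_ge0 M i : 0 <= meshpt M i.
Proof. by rewrite mulr_ge0// invr_ge0. Qed.

Lemma meshpt_exists M t : (0 < M)%N -> 0 <= t <= 1 ->
  exists i : 'I_(M ^ 2), meshpt M i <= t <= meshpt M i + mesh M.
Proof.
move=> M0 /andP[t0 t1]; have m0 := mesh_gt0 M0.
have n0 : (0 < M ^ 2)%N by rewrite expn_gt0 M0.
pose i := minn (Num.truncn (t / mesh M)) (M ^ 2).-1.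
have iM : (i < M ^ 2)%N by rewrite /i; lia.
have /andP[h1 h2] := truncn_itv (divr_ge0 t0 (ltW m0)).
exists (Ordinal iM); rewrite /meshpt /=; apply/andP; split.
  by rewrite -ler_pdivlMr//; apply: le_trans h1; rewrite ler_nat geq_minl.
rewrite -[X in _ + X]mul1r -mulrDl natr1 -ler_pdivrMr// /i.
case: (leqP (Num.truncn (t / mesh M)) (M ^ 2).-1) => hh; first by rewrite ltW.
by rewrite prednK// /mesh invrK -[leRHS]mul1r ler_wpM2r.
Qed.

(** Recorded as a finite set of indices, so that conditioning on it is a finite partition into
    events of the past. *)
Definition crossed N n M w : {set 'I_(M ^ 2)} :=
  [set i : 'I_(M ^ 2) | `[< uncovered_each N n (meshpt M i) (mesh M) w >]]%SET.

Lemma crossed_past N n M (S : {set 'I_(M ^ 2)}) : (1 <= N)%N -> (0 < M)%N ->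
  past n.+1 [set w | crossed N n M w = S].
Proof.
move=> N1 M0; have sP := past_sigma F n.+1.
have UP i : past n.+1 (uncovered_each N n (meshpt M i) (mesh M)).
  by apply: (uncovered_each_past dm) => //; exact: mesh_gt0.
rewrite (_ : [set w | _] = \bigcap_(i in [set: 'I_(M ^ 2)])
    (if i \in S then uncovered_each N n (meshpt M i) (mesh M)
     else ~` uncovered_each N n (meshpt M i) (mesh M))).
  by apply: (sigma_bigcap sP) => i _; case: ifP => _; [exact: UP|apply: (sigmaC sP); exact: UP].
apply/seteqP; split => w /=.
  by move=> <- i _; rewrite inE; case: asboolP.
move=> h; apply/setP => i; rewrite inE; have := h i I.
by case: ifP => _ hi; apply/asboolP.
Qed.

Lemma crossed_pred_past N n M (Q : pred {set 'I_(M ^ 2)}) : (1 <= N)%N -> (0 < M)%N ->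
  past n.+1 [set w | Q (crossed N n M w)].
Proof.
move=> N1 M0; rewrite (_ : [set w | _] =
    \bigcup_(S in [set S : {set 'I_(M ^ 2)} | Q S]) [set w | crossed N n M w = S]).
  by apply: (sigma_bigcup (past_sigma F _)) => S _; exact: crossed_past.
apply/seteqP; split => w /=; first by move=> h; exists (crossed N n M w).
by move=> [S QS ->].
Qed.

Lemma pr_crossed_gt N n M (z : R) : (1 <= N)%N -> (0 < M)%N -> 0 < z ->
  (forall k, (N <= k)%N -> ell k <= 1) ->
  pr [set w | z <= #|crossed N n M w|%:R] <=
    (M ^ 2)%:R * expR (\sum_(N <= k < n.+1) (C / M%:R - ell k)) / z.
Proof.
move=> N1 M0 z0 l1.
pose E (i : 'I_(M ^ 2)) := uncovered_each N n (meshpt M i) (mesh M).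
have mE i : measurable (E i).
  apply: (past_measurable dm); apply: (uncovered_each_past dm) => //.
  exact: mesh_gt0.
apply: (@le_trans _ _ (\sum_(i <- enum 'I_(M ^ 2)) z^-1 * pr (E i))).
  apply: pr_le_sum => //.
    by apply: (past_measurable dm); exact: crossed_pred_past (fun S => z <= #|S|%:R) _ _.
  move=> w; rewrite big_enum/= -mulr_sumr.
  have -> : \sum_(i : 'I_(M ^ 2)) (\1_(E i) w : R) = #|crossed N n M w|%:R.
    rewrite -sum1_card natr_sum [RHS]big_mkcond/=; apply: eq_bigr => i _.
    rewrite indicE inE; case: asboolP => h; first by rewrite mem_set.
    by rewrite memNset.
  rewrite indicE; have [/set_mem/= h|_] := boolP (w \in _).
    by rewrite mulrC ler_pdivlMr// mul1r.
  by rewrite mulr_ge0// invr_ge0 ltW.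
rewrite big_enum/= -mulr_sumr mulrC ler_wpM2r ?invr_ge0 ?(ltW z0)//.
have -> : (M ^ 2)%:R * expR (\sum_(N <= k < n.+1) (C / M%:R - ell k)) =
    \sum_(i : 'I_(M ^ 2)) expR (\sum_(N <= k < n.+1) (C / M%:R - ell k)).
  by rewrite sumr_const card_ord mulr_natl.
apply: ler_sum => i _; rewrite /E -sqrt_mesh.
by apply: (uncovered_each_le dm) => //; [exact: meshpt_ge0|exact: mesh_gt0].
Qed.

(** Each further arc of the block is independent of [X] and of the previous arcs, and contributes
    one more factor [1 - theta]. *)
Lemma block_le p b a h (theta : R) (X : set Omega) : past p.+1 X -> 0 < h ->
  0 <= theta <= 1 ->
  (forall k, (p < k <= p + b)%N -> pr (uncovered [:: k] a h) <= 1 - theta) ->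
  past (p + b).+1 (X `&` \bigcap_(k in [set k | (p < k <= p + b)%N]) uncovered [:: k] a h) /\
  pr (X `&` \bigcap_(k in [set k | (p < k <= p + b)%N]) uncovered [:: k] a h)
    <= (1 - theta) ^+ b * pr X.
Proof.
move=> pX h0 /andP[t0 t1]; elim: b => [|b IH] hk.
  rewrite (_ : \bigcap_(k in _) _ = setT) ?setIT ?addn0 ?expr0 ?mul1r//.
  by apply/seteqP; split => w // _ k /=; lia.
have [|IHp IHl] := IH; first by move=> k kb; apply: hk; lia.
set Y := X `&` _ in IHp IHl.
have -> : X `&` \bigcap_(k in [set k | (p < k <= p + b.+1)%N]) uncovered [:: k] a h =
    Y `&` uncovered [:: (p + b).+1] a h.
  apply/seteqP; split => w.
    move=> [Xw hw]; split; first by split=> // k /= kb; apply: hw => /=; lia.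
    by apply: hw => /=; lia.
  move=> [[Xw hw] hl]; split=> // k /= kb.
  have [kb'|kb'] := leqP k (p + b); first by apply: hw => /=; lia.
  by rewrite (_ : k = (p + b).+1)//; lia.
have FU : F (p + b).+1 (uncovered [:: (p + b).+1] a h) by apply: (uncovered_sigma dm).
have [mY] := indep_past (dm_indep dm) (dm_sigma dm) (ltn0Sn (p + b)) IHp FU.
rewrite /pr => e; split.
  rewrite addnS; apply: (sigmaI (past_sigma F _)); first exact: past_mono IHp.
  by apply: past_in FU; lia.
rewrite -/(pr _) in e *; rewrite e exprSr -mulrA (mulrCA _ (1 - theta)) mulrC.
apply: ler_pM; rewrite ?pr_ge0//; last by apply: hk; lia.
Qed.

Definition covered_all n (l : seq R) h := \bigcap_(a in [set a | a \in l])
  \bigcup_(k in [set k | (n < k <= 2 * n)%N]) ~` uncovered [:: k] a h.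

Lemma measurable_covered_all n l h : 0 < h -> measurable (covered_all n l h).
Proof.
move=> h0; rewrite /covered_all bigcap_seq.
apply: (big_ind measurable) => [|A B|a _]; [exact: measurableT|exact: measurableI|].
apply: bigcup_measurable => k /= kn; apply: measurableC.
by apply: (measurable_uncovered dm) => // m; rewrite inE => /eqP ->; lia.
Qed.

(** The intervals of [l] are served by consecutive disjoint blocks of [b] arcs. In the induction the
    part of [X] on which the first block fails is removed; what remains belongs to the past of the
    next block. *)
Lemma covered_all_ge n p b l h (theta : R) (X : set Omega) : past p.+1 X -> 0 < h ->
  0 <= theta <= 1 -> (n <= p)%N -> (p + b * size l <= 2 * n)%N ->
  (forall a k, a \in l -> (n < k <= 2 * n)%N -> pr (uncovered [:: k] a h) <= 1 - theta) ->
  (1 - (1 - theta) ^+ b) ^+ size l * pr X <= pr (X `&` covered_all n l h).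
Proof.
move=> pX h0 t01; have /andP[t0 t1] := t01.
elim: l p X pX => [|a l IH] p X pX np pb hk.
  by rewrite expr0 mul1r /covered_all (_ : \bigcap_(a in _) _ = setT) ?setIT// -subTset => w _ a.
have kappa0 : 0 <= 1 - (1 - theta) ^+ b by rewrite subr_ge0 exprn_ile1//; lra.
have hk' k : (p < k <= p + b)%N -> pr (uncovered [:: k] a h) <= 1 - theta.
  by move=> kb; apply: hk; [exact: mem_head|move: pb; rewrite /= mulnS; lia].
have [pY Yle] := block_le pX h0 t01 hk'.
set Y := X `&` _ in pY Yle.
have mX := past_measurable dm pX; have mY := past_measurable dm pY.
pose X' := X `&` ~` Y.
have pX' : past (p + b).+1 X'.
  apply: (sigmaI (past_sigma F _)); last exact: (sigmaC (past_sigma F _)).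
  by apply: past_mono pX; lia.
have := IH (p + b)%N X' pX' _ _ _; rewrite /= => IH'.
apply: (@le_trans _ _ (pr (X' `&` covered_all n l h))); last first.
  apply: pr_mono.
  - by apply: measurableI; [exact: (past_measurable dm pX')|exact: measurable_covered_all].
  - by apply: measurableI => //; exact: measurable_covered_all.
  move=> w [[Xw nY] Cw]; split=> // a'; rewrite /= inE => /predU1P[->|]; last exact: Cw.
  apply: contrapT => nex; apply: nY; split=> // k /= kb; apply: contrapT => nU.
  by apply: nex; exists k => //=; move: pb; rewrite /= mulnS; lia.
apply: le_trans (IH' _ _ _); last 3 first.
- by lia.
- by move: pb; rewrite /= mulnS; lia.
- by move=> a' k al; apply: hk; rewrite inE al orbT.
rewrite exprSr -mulrA ler_wpM2l ?exprn_ge0// /X' prD//.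
rewrite (_ : X `&` Y = Y); last by rewrite /Y setIA setIid.
by rewrite mulrBl mul1r lerB.
Qed.

Definition survival N m := uncovered (index_iota N m.+1) 0 1.

Lemma survival_past N m : (1 <= N)%N -> past m.+1 (survival N m).
Proof.
move=> N1; apply: (uncovered_past dm) => // k; rewrite mem_index_iota => /andP[Nk km].
by rewrite (leq_trans N1 Nk).
Qed.

Lemma survival_mono N m m' : (m <= m')%N -> survival N m' `<=` survival N m.
Proof.
move=> mm w [t st ht]; exists t => // k; rewrite mem_index_iota => /andP[Nk km].
by apply: ht; rewrite mem_index_iota Nk (leq_trans km).
Qed.

(* Given which mesh intervals the arcs up to n leave uncovered at some time,
   the arcs n+1, .., 2n, cut into blocks of length b, cover each of them with
   probability bounded below. *)
Lemma survival_step N m n M b z (theta : R) : (1 <= N)%N -> (0 < M)%N ->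
  (m <= n)%N -> (N <= n)%N -> (b * z <= n)%N -> 0 <= theta <= 1 ->
  (forall a k, 0 <= a -> (n < k <= 2 * n)%N ->
    pr (uncovered [:: k] a (mesh M)) <= 1 - theta) ->
  pr (survival N (2 * n)) <= pr (survival N m) -
    (1 - (1 - theta) ^+ b) ^+ z * pr (survival N m `&` [set w | (#|crossed N n M w| <= z)%N]).
Proof.
move=> N1 M0 mn Nn bz t01 hk; have /andP[t0 t1] := t01.
have h0 := mesh_gt0 M0.
set kappa := 1 - _ ^+ b.
have kappa0 : 0 <= kappa by rewrite subr_ge0 exprn_ile1//; lra.
have kappa1 : kappa <= 1 by rewrite gerBl exprn_ge0//; lra.
have pEm : past n.+1 (survival N m) by apply: (past_mono _ (survival_past N1)); lia.
have mEm := past_measurable dm pEm.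
have mE2 := past_measurable dm (survival_past (m := (2 * n)%N) N1).
have pQ := crossed_pred_past (n := n) (fun S => (#|S| <= z)%N) N1 M0.
have mQ := past_measurable dm pQ.
have mC (S : {set 'I_(M ^ 2)}) : measurable [set w | crossed N n M w = S].
  exact: (past_measurable dm (crossed_past _ N1 M0)).
have sub : survival N (2 * n) `<=` survival N m by apply: survival_mono; lia.
(* The loss between [m] and [2 * n] is bounded below separately on each event where the crossed set
   equals a given [S] of size at most [z]. *)
suff : kappa ^+ z * pr (survival N m `&` [set w | (#|crossed N n M w| <= z)%N]) <=
    pr (survival N m `&` ~` survival N (2 * n)).
  by rewrite prD// (setIidr sub); lra.
rewrite (pr_image_partition P (measurableI _ _ mEm mQ) mC).
rewrite (pr_image_partition P (measurableI _ _ mEm (measurableC mE2)) mC).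
rewrite mulr_sumr; apply: ler_sum => S _.
have [Sz|Sz] := leqP #|S| z; last first.
  rewrite (_ : _ `&` _ `&` _ = set0) ?pr_set0 ?mulr0 ?pr_ge0//.
  by rewrite -subset0 => w [[_ /= h] /= h']; move: h; rewrite h' leqNgt Sz.
pose X := survival N m `&` [set w | crossed N n M w = S].
have pX : past n.+1 X by apply: (sigmaI (past_sigma F _)) => //; exact: crossed_past.
pose l := [seq meshpt M i | i : 'I_(M ^ 2) <- enum S].
have sl : size l = #|S| by rewrite size_map cardE.
have := @covered_all_ge n n b l (mesh M) theta X pX h0 t01 (leqnn n) _ _.
rewrite sl => hX.
apply: (@le_trans _ _ (pr (X `&` covered_all n l (mesh M)))).
  apply: le_trans (hX _ _); last 2 first.
  - by have := leq_mul (leqnn b) Sz; lia.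
  - by move=> a k /mapP[i _ ->]; apply: hk; exact: meshpt_ge0.
  apply: (@le_trans _ _ (kappa ^+ z * pr X)).
    rewrite ler_wpM2l ?exprn_ge0//; apply: pr_mono.
    - by repeat apply: measurableI.
    - exact: (past_measurable dm pX).
    by move=> w [[h1 _] h2].
  by rewrite ler_wpM2r ?pr_ge0// ler_wiXn2l// kappa0.
apply: pr_mono.
- apply: measurableI; first exact: (past_measurable dm pX).
  exact: measurable_covered_all.
- by apply: measurableI => //; apply: measurableI => //; exact: measurableC.
(* A time surviving up to [2 * n] would lie in an interval indexed by [S], although [covered_all]
   provides an arc that covers the point throughout that interval. *)
move=> w [[Em cS] cov]; split=> //; split=> // -[t]; rewrite add0r => t01' ht.
have [i it] := meshpt_exists M0 t01'.
have iS : i \in S.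
  rewrite -cS inE; apply/asboolP => k /=; rewrite mem_index_iota => /andP[Nk kn].
  exists t => // k'; rewrite inE => /eqP ->; apply: ht; rewrite mem_index_iota Nk /=.
  by apply: (leq_trans kn); rewrite ltnS mul2n -addnn leq_addr.
have il : meshpt M i \in l by apply/mapP; exists i => //; rewrite mem_enum.
have [k /= kn] := cov _ il.
have /andP[nk k2n] := kn.
apply; exists t => // k'; rewrite inE => /eqP ->; apply: ht.
by rewrite mem_index_iota (leq_trans Nn (ltnW nk)).
Qed.

End CriticalCovering.

Section CriticalSurvival.
Context d (Omega : measurableType d) (R : realType) (P : probability Omega R).
Local Notation pr := (pr P).
Variables (F : nat -> set (set Omega)) (D : nat -> R -> Omega -> R) (C : R).
Hypothesis dm : distance_model P F D C.
Variable ell : nat -> R.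
Hypothesis ell_gt0 : forall n, (1 <= n)%N -> 0 < ell n.
Implicit Types (N n k M : nat).

(** If the infimum [p] of the survival probabilities were positive, a step from some [m] with
    probability below [p + eps] would lose at least [eps]: with probability at least [p / 2] the
    point survives and at most [z] intervals are crossed, and these are then all covered with
    conditional probability at least [kappa0 ^+ z]. *)
Lemma survival_vanishes (M0 A : R) N : 0 < M0 -> (1 <= N)%N ->
  (forall k, (1 <= k)%N -> M0 / k%:R <= ell k) ->
  (forall k, (N <= k)%N -> ell k <= 1) ->
  (forall m, exists2 n, (m <= n)%N &
    n%:R ^+ 2 * expR (- \sum_(N <= k < n.+1) ell k) <= A) ->
  forall eta, 0 < eta -> exists m, pr (survival D ell N m) <= eta.
Proof.
move=> M00 N1 lM l1 freq eta eta0; apply: contrapT => nex.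
have big m : eta < pr (survival D ell N m).
  by rewrite ltNge; apply/negP => h; apply: nex; exists m.
have C0 := exit_const_ge0 dm.
(* The mesh is refined by [q] so that the exit correction [C / (q n)] is at most [theta], half of
   the lower bound [M0 / (2 n)] for the arcs up to [2 n]. *)
have [q [q0 qC]] : exists q : nat, (0 < q)%N /\ 4 * C / M0 <= q%:R.
  by exists (Num.truncn (4 * C / M0)).+1; split=> //; exact/ltW/truncnS_gt.
have q1 : 0 < q%:R :> R by rewrite ltr0n.
have A0 : 0 <= A.
  by have [n _] := freq 0%N; apply: le_trans; rewrite mulr_ge0 ?exprn_ge0 ?expR_ge0.
(* The square comes from the refined mesh, [expR C] from the total exit correction of at most [n]
   arcs. *)
pose A' := q%:R ^+ 2 * expR C * A.
have A'0 : 0 <= A' by rewrite !mulr_ge0 ?expR_ge0.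
pose S := [set pr (survival D ell N m) | m in [set: nat]].
have S0 : S !=set0 by exists (pr (survival D ell N 0)), 0%N.
have lbS : lbound S eta by move=> _ [m _ <-]; exact: ltW.
pose p := inf S.
have infS : has_inf S by split=> //; exists eta.
have p_le m : p <= pr (survival D ell N m) by apply: ge_inf; [exists eta|exists m].
have p0 : 0 < p by apply: lt_le_trans eta0 _; exact: lb_le_inf.
(* By Markov's inequality more than [z] intervals are crossed with probability at most [p / 2]. *)
have [z [z0 zA]] : exists z : nat, (0 < z)%N /\ A' / z.+1%:R <= p / 2.
  exists (Num.truncn (2 * A' / p)).+1; split=> //.
  have h : 2 * A' / p <= (Num.truncn (2 * A' / p)).+2%:R.
    by apply: le_trans (ltW (truncnS_gt _)) _; rewrite ler_nat.
  by move: h; rewrite !ler_pdivrMr//; lra.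
have z1 : 0 < z%:R :> R by rewrite ltr0n.
(* The block length [b = n %/ z] is at least [n / (2 z)], so [theta * b >= M0 / (8 z)] whatever [n]
   is. *)
pose kappa0 := 1 - expR (- (M0 / (8 * z%:R))).
have k0 : 0 < kappa0 by rewrite subr_gt0 -[ltRHS]expR0 ltr_expR oppr_lt0 divr_gt0// mulr_gt0.
pose eps := kappa0 ^+ z * (p / 2).
have eps0 : 0 < eps by rewrite mulr_gt0 ?exprn_gt0// divr_gt0.
have [_ [m _ <-] pm] : exists2 x, S x & x < p + eps by exact: inf_adherent.
have [n nm nA] := freq (maxn m (maxn N (maxn z (Num.truncn M0).+1))).
move: nm; rewrite !geq_max => /and4P[mn Nn zn M0n].
have n0 : (0 < n)%N by exact: leq_trans zn.
have n1 : 0 < n%:R :> R by rewrite ltr0n.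
have nM0 : M0 <= n%:R by rewrite (le_trans (ltW (truncnS_gt _)))// ler_nat.
pose M := (q * n)%N.
have M0' : (0 < M)%N by rewrite muln_gt0 q0.
pose theta := M0 / (4 * n%:R).
have t01 : 0 <= theta <= 1.
  rewrite /theta divr_ge0 ?mulr_ge0 ?(ltW M00)//= ler_pdivrMr ?mulr_gt0// mul1r; lra.
have CM : C / M%:R <= theta.
  rewrite /theta natrM ler_pdivrMr ?mulr_gt0// mulrAC ler_pdivlMr ?mulr_gt0//.
  move: qC; rewrite ler_pdivrMr// => qC; nra.
have hk a k : 0 <= a -> (n < k <= 2 * n)%N ->
    pr (uncovered D ell [:: k] a (mesh R M)) <= 1 - theta.
  move=> a0 /andP[nk k2n]; have k1 : (1 <= k)%N by exact: leq_ltn_trans nk.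
  apply: le_trans (uncovered1_le dm ell_gt0 k1 (l1 k (leq_trans Nn (ltnW nk))) a0 (mesh_gt0 _ M0')) _.
  rewrite sqrt_mesh.
  have : M0 / (2 * n%:R) <= ell k.
    apply: le_trans (lM k k1); rewrite ler_wpM2l ?(ltW M00)//.
    by rewrite lef_pV2 ?posrE ?mulr_gt0 ?ltr0n// -natrM ler_nat.
  have -> : M0 / (2 * n%:R) = 2 * theta by rewrite /theta; field; rewrite gt_eqF.
  by lra.
pose b := (n %/ z)%N.
have bz : (b * z <= n)%N by exact: leq_trunc_div.
have := survival_step dm (b := b) N1 M0' mn Nn bz t01 hk.
set Q := [set w | _].
have mQ : measurable Q.
  exact: (past_measurable dm (crossed_pred_past dm ell (n := n) (fun S => (#|S| <= z)%N) N1 M0')).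
have mE : measurable (survival D ell N m).
  exact: (past_measurable dm (survival_past dm ell N1)).
have EQ : pr (survival D ell N m) - A' / z.+1%:R <= pr (survival D ell N m `&` Q).
  have e := prD P mE mQ.
  have : pr (survival D ell N m `&` ~` Q) <= A' / z.+1%:R.
    have z10 : 0 < z.+1%:R :> R by [].
    apply: le_trans (le_trans (pr_crossed_gt dm ell_gt0 n N1 M0' z10 l1) _).
      apply: pr_mono.
      - by apply: measurableI => //; exact: measurableC.
      - exact: (past_measurable dm (crossed_pred_past dm ell (n := n)
          (fun S => z.+1%:R <= #|S|%:R :> R) N1 M0')).
      by move=> w [_ /negP]; rewrite /= ler_nat -ltnNge.
    have hv : expR (\sum_(N <= i < n.+1) C / M%:R) <= expR C.
      rewrite ler_expR sumr_const_nat -[leLHS]mulr_natr [leLHS]mulrAC ler_pdivrMr ?ltr0n//.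
      rewrite ler_wpM2l// ler_nat leq_subLR -add1n leq_add// /M.
      by rewrite leq_pmull.
    apply: ler_wpM2r; first by rewrite invr_ge0.
    rewrite sumrB expRD; set v := expR _ in hv *; set u := expR _ in nA *.
    rewrite [leLHS](_ : _ = (q%:R ^+ 2 * v) * (n%:R ^+ 2 * u)); last first.
      by rewrite natrX natrM; ring.
    apply: ler_pM => //.
    - by rewrite mulr_ge0 ?exprn_ge0 ?expR_ge0.
    - by rewrite mulr_ge0 ?exprn_ge0 ?expR_ge0.
    - by rewrite ler_wpM2l ?exprn_ge0.
  by rewrite e => hQ; rewrite lerBlDr addrC -lerBlDr.
have kk : kappa0 <= 1 - (1 - theta) ^+ b.
  rewrite /kappa0 lerB//; have /andP[t0 t1] := t01.
  apply: (@le_trans _ _ (expR (- theta) ^+ b)).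
    by apply: lerXn2r; rewrite ?nnegrE ?expR_ge0 ?subr_ge0//; exact: expR_ge1Dx.
  rewrite -expRM_natl ler_expR mulrN lerN2 /theta.
  have : n%:R <= 2 * z%:R * b%:R :> R.
    rewrite -!natrM ler_nat; apply: leq_trans (ltnW (ltn_ceil n z0)) _.
    rewrite mulnAC leq_mul2r; apply/orP; right; rewrite -/b mul2n -addnn -addn1 leq_add2l.
    by rewrite divn_gt0.
  move=> nb; rewrite mulrA ler_pdivlMr ?mulr_gt0// mulrAC ler_pdivrMr ?mulr_gt0//.
  by nra.
have kz : kappa0 ^+ z <= (1 - (1 - theta) ^+ b) ^+ z.
  by rewrite lerXn2r ?nnegrE ?(ltW k0)// (le_trans (ltW k0)).
have Q2 : p / 2 <= pr (survival D ell N m `&` Q).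
  by have := p_le m; move: EQ zA; move: (A' / _) => y; lra.
have : eps <= (1 - (1 - theta) ^+ b) ^+ z * pr (survival D ell N m `&` Q).
  by apply: ler_pM; rewrite ?exprn_ge0 ?(ltW k0)// divr_ge0// ltW.
have := p_le (2 * n)%N; lra.
Qed.

End CriticalSurvival.

Lemma sum_prefix_le (R : realType) (x : R) (l n : nat) : 0 <= x ->
  \sum_(i < n) (if (i < l)%N then x else 0) <= l%:R * x.
Proof.
move=> x0; suff -> : \sum_(i < n) (if (i < l)%N then x else 0) = (minn n l)%:R * x.
  by rewrite ler_wpM2r// ler_nat geq_minr.
elim: n => [|n IH]; first by rewrite big_ord0 min0n mul0r.
rewrite big_ord_recr/= IH; case: ltnP => nl.
  by rewrite (minn_idPl nl) -natr1 mulrDl mul1r.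
by rewrite addr0 (minn_idPr (leq_trans nl _)).
Qed.

(** * Null Hausdorff measure of the uncovered times *)

Section DimensionUpperBound.
Context d (Omega : measurableType d) (R : realType) (P : probability Omega R).
Local Notation pr := (pr P).
Variables (F : nat -> set (set Omega)) (D : nat -> R -> Omega -> R) (C : R).
Hypothesis dm : distance_model P F D C.
Variable ell : nat -> R.
Hypothesis ell_gt0 : forall n, (1 <= n)%N -> 0 < ell n.
Implicit Types (N n k M : nat).

Definition survivors N w := [set t : R | 0 <= t <= 1 /\ forall k, (N <= k)%N -> radius ell k <= D k t w].

(** The radius is twice the mesh because an open ball about the left end has to contain the closed
    mesh interval. Beyond the list of crossed intervals the radius is 0. *)
Lemma survivors_ball_cover (s delta e : R) N n w : 0 < s -> (0 < n)%N ->
  2 * mesh R n <= delta -> (2 * mesh R n) `^ s * #|crossed D ell N n n w|%:R <= e ->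
  ball_cover s delta e (survivors N w).
Proof.
move=> s0 n0 nd ne; have m0 := mesh_gt0 R n0.
pose l := [seq meshpt R n i | i : 'I_(n ^ 2) <- enum (crossed D ell N n n w)].
have sl : size l = #|crossed D ell N n n w| by rewrite size_map cardE.
exists (nth 0 l), (fun i => if (i < size l)%N then 2 * mesh R n else 0); split.
- move=> i; have d0 : 0 <= delta by apply: le_trans nd; rewrite mulr_ge0// ltW.
  by case: ifP => _; rewrite ?lexx// nd mulr_ge0// ltW.
- move=> t [t01 ht]; have [i /andP[it1 it2]] := meshpt_exists n0 t01.
  have il : meshpt R n i \in l.
    apply/mapP; exists i => //; rewrite mem_enum inE; apply/asboolP => k /=.
    rewrite mem_index_iota => /andP[Nk _]; exists t; first by rewrite it1.
    by move=> k'; rewrite inE => /eqP ->; exact: ht.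
  exists (index (meshpt R n i) l) => //=.
  rewrite index_mem il nth_index// ger0_norm ?subr_ge0//; lra.
- move=> K; apply: le_trans ne.
  rewrite (eq_bigr (fun i : 'I_K => if (i < size l)%N then (2 * mesh R n) `^ s else 0)).
    by rewrite [leRHS]mulrC -sl; apply: sum_prefix_le; exact: powR_ge0.
  by move=> i _; case: ifP => // _; rewrite powR0// gt_eqF.
Qed.

(** Smallness along a subsequence suffices, without summability over [n]: if the covers from some
    stage on all cost at least a fixed amount, Markov's inequality at one well chosen stage gives
    this event an arbitrarily small probability. *)
Lemma survivors_measure0 (s : R) N : 0 < s -> (1 <= N)%N ->
  (forall k, (N <= k)%N -> ell k <= 1) ->
  (forall m eps, 0 < eps -> exists2 n, (m <= n)%N &
    (n ^ 2)%:R * mesh R n `^ s * expR (- \sum_(N <= k < n.+1) ell k) <= eps) ->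
  {ae P, forall w, hausdorff_measure s (survivors N w) = 0%E}.
Proof.
move=> s0 N1 l1 small; have C0 := exit_const_ge0 dm.
pose Big j n := [set w | j.+1%:R^-1 / mesh R n `^ s <= #|crossed D ell N n n w|%:R].
have mBig j n : (0 < n)%N -> measurable (Big j n).
  move=> n0; exact: (past_measurable dm (crossed_pred_past dm ell (n := n)
    (fun S => j.+1%:R^-1 / mesh R n `^ s <= #|S|%:R) N1 n0)).
pose Bad j m := \bigcap_(n in [set n | (m < n)%N]) Big j n.
have mBad j m : measurable (Bad j m).
  by apply: bigcap_measurableType => n /= mn; apply: mBig; exact: leq_trans mn.
have null j m : pr (Bad j m) = 0.
  apply/eqP; rewrite eq_le pr_ge0 andbT; apply/ler_addgt0Pl => e e0; rewrite addr0.
  have e'0 : 0 < e / (j.+1%:R * expR C) by rewrite divr_gt0// mulr_gt0// expR_gt0.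
  have [n mn hn] := small m.+1 _ e'0.
  have n0 : (0 < n)%N by apply: leq_trans mn.
  have n1 : 0 < n%:R :> R by rewrite ltr0n.
  have ms0 : 0 < mesh R n `^ s by rewrite powR_gt0// mesh_gt0.
  have z0 : 0 < j.+1%:R^-1 / mesh R n `^ s by rewrite divr_gt0// invr_gt0.
  apply: (@le_trans _ _ (pr (Big j n))).
    by apply: pr_mono => //; [exact: mBig|move=> w; exact].
  apply: le_trans (pr_crossed_gt dm ell_gt0 n N1 n0 z0 l1) _.
  rewrite ler_pdivrMr// sumrB expRD.
  have hC : expR (\sum_(N <= i < n.+1) C / n%:R) <= expR C.
    rewrite ler_expR sumr_const_nat -[leLHS]mulr_natr [leLHS]mulrAC ler_pdivrMr//.
    by rewrite ler_wpM2l// ler_nat; lia.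
  set x := (n ^ 2)%:R in hn *; set y := mesh R n `^ s in hn ms0 *.
  set u := expR (- _) in hn *; set v := expR (\sum_(_ <= _ < _) _) in hC *.
  have u0 : 0 <= u := expR_ge0 _.
  have x0 : 0 <= x by [].
  move: hn; rewrite ler_pdivlMr ?mulr_gt0 ?expR_gt0// => hn.
  rewrite [leRHS](_ : _ = e / (j.+1%:R * y)); last by rewrite invfM.
  rewrite ler_pdivlMr ?mulr_gt0//; apply: le_trans hn.
  rewrite [leLHS](_ : _ = x * y * u * j.+1%:R * v); last by ring.
  rewrite [leRHS](_ : _ = x * y * u * j.+1%:R * expR C); last by ring.
  by apply: ler_wpM2l => //; rewrite !mulr_ge0// ltW.
have negl j m : P.-negligible (Bad j m).
  by exists (Bad j m); split=> //; rewrite prE// null.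
apply: (@negligibleS _ _ _ P (\bigcup_j \bigcup_m Bad j m)); last first.
  by apply: negligible_bigcup => j; apply: negligible_bigcup => m.
move=> w /= hw; apply: contrapT => good; apply: hw.
apply: ball_cover_measure0 => // delta e delta0 e0.
have p2 : 0 < 2 `^ s :> R by rewrite powR_gt0.
pose j := Num.truncn (2 `^ s / e); pose m := Num.truncn (2 / delta).
have [n [mn hn]] : exists n, (m < n)%N /\ ~ Big j n w.
  apply: contrapT => nex; apply: good; exists j => //; exists m => // n /= mn.
  by apply: contrapT => hn; apply: nex; exists n.
have n0 : (0 < n)%N by apply: leq_trans mn.
have n1 : 0 < n%:R :> R by rewrite ltr0n.
apply: (survivors_ball_cover s0 n0).
  have h : 2 / delta <= n%:R.
    by apply: le_trans (ltW (truncnS_gt _)) _; rewrite ler_nat.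
  rewrite /mesh ler_pdivrMr ?ltr0n ?expn_gt0 ?n0// natrX.
  move: h; rewrite ler_pdivrMr// => h.
  have n11 : 1 <= n%:R :> R by rewrite ler1n.
  by rewrite mulrC; nra.
have ms0 : 0 < mesh R n `^ s by rewrite powR_gt0// mesh_gt0.
move/negP: hn; rewrite -ltNge ltr_pdivlMr// => hn.
rewrite powRM// ?(ltW (mesh_gt0 R n0))//.
have h : 2 `^ s / e <= j.+1%:R by exact/ltW/truncnS_gt.
apply: (@le_trans _ _ (2 `^ s * j.+1%:R^-1)).
  by rewrite -mulrA ler_wpM2l ?(ltW p2)// mulrC ltW.
by rewrite ler_pdivrMr// -ler_pdivrMl// mulrC.
Qed.

End DimensionUpperBound.

(** * Lower bounds by the second moment of the energy *)

Section Energy.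
Variable R : realType.
Implicit Types (a t r x tau : R).

(* A step version of the Riesz kernel [tau ^ - a]. *)
Definition kernel a tau : R := (Num.truncn (Num.sqrt tau)^-1)%:R `^ (2 * a).

(** Since [x >= 1], truncation at most halves it; this is the factor 4 inside the power. *)
Lemma kernel_ge a tau : 0 <= a -> 0 < tau <= 1 -> 1 <= kernel a tau * (4 * tau) `^ a.
Proof.
move=> a0 /andP[t0 t1]; set x := (Num.sqrt tau)^-1.
have st0 : 0 < Num.sqrt tau by rewrite sqrtr_gt0.
have x1 : 1 <= x.
  by rewrite /x invf_ge1// -[leRHS](@sqrtr1 R) ler_wsqrtr.
have x0 : 0 <= x by lra.
have x2 : x ^+ 2 = tau^-1 by rewrite /x exprVn sqr_sqrtr// ltW.
have /andP[h1 h2] := truncn_itv x0.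
have k1 : 1 <= (Num.truncn x)%:R :> R.
  by rewrite ler1n truncn_gt0.
have hx : x / 2 <= (Num.truncn x)%:R by move: h2; rewrite -natr1; lra.
have -> : kernel a tau = ((Num.truncn x)%:R ^+ 2) `^ a by rewrite /kernel -/x powRrM powR_mulrn.
rewrite -powRM ?sqr_ge0 ?mulr_ge0 ?(ltW t0)//.
have h : 1 <= (Num.truncn x)%:R ^+ 2 * (4 * tau).
  have : (x / 2) ^+ 2 <= (Num.truncn x)%:R ^+ 2.
    by rewrite lerXn2r ?nnegrE ?divr_ge0.
  rewrite expr_div_n x2 => hh.
  apply: (@le_trans _ _ (tau^-1 / 2 ^+ 2 * (4 * tau))).
    rewrite (_ : _ / _ * _ = 1)//; by field; rewrite gt_eqF.
  by rewrite ler_wpM2r// mulr_ge0// ltW.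
apply: (@le_trans _ _ (1 `^ a)); first by rewrite powR1.
by apply: ge0_ler_powR; rewrite ?nnegrE//; lra.
Qed.

(* At least 1, so that the kernel is also meaningful on the diagonal. *)
Definition gap (i j : nat) : nat := maxn 1 ((i - j) + (j - i)).

Lemma gap_le q i j : (i < q)%N -> (j < q)%N -> (gap i j <= q)%N.
Proof. by rewrite /gap; lia. Qed.

Lemma natr_absdiff i j : ((i - j + (j - i))%N)%:R = `|i%:R - j%:R| :> R.
Proof.
case: (leqP j i) => ij.
  rewrite (_ : (j - i = 0)%N); last by apply/eqP; rewrite subn_eq0.
  by rewrite addn0 natrB// ger0_norm// subr_ge0 ler_nat.
rewrite (_ : (i - j = 0)%N); last by apply/eqP; rewrite subn_eq0 ltnW.
by rewrite add0n natrB ?(ltnW ij)// distrC ger0_norm// subr_ge0 ler_nat ltnW.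
Qed.

(* A ball of radius r and mass m carries energy at least m^2 / (8 r)^a. *)
Lemma energy_cover a q (S : {set 'I_q}) (c r : nat -> R) n0 (mu M : R) :
  0 <= a -> 0 < M -> 0 <= mu ->
  (forall i : nat, 0 <= r i) ->
  (forall k, (k < n0)%N -> 0 < r k -> q%:R^-1 <= r k) ->
  (forall i : 'I_q, i \in S -> exists2 k, (k < n0)%N & `|i%:R / q%:R - c k| < r k) ->
  1 / 2 <= mu * #|S|%:R ->
  mu ^+ 2 * \sum_(i in S) \sum_(j in S) kernel a ((gap i j)%:R / q%:R) <= M ->
  1 / (4 * M) <= \sum_(k < n0) (8 * r k) `^ a.
Proof.
move=> a0 M0 mu0 r0 rq cov Z I.
case: n0 rq cov => [|n1] rq cov.
  have S0 : S = finset.set0.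
    by apply/setP => i; rewrite inE; apply/negP => /cov[].
  by move: Z; rewrite S0 cards0 mulr0; lra.
pose Q (i : 'I_q) (k : 'I_n1.+1) := `|i%:R / q%:R - c k| < r k.
(* Every surviving time is charged to one ball that contains it; the default [ord0] is never met on
   [S]. *)
pose f (i : 'I_q) : 'I_n1.+1 := odflt ord0 [pick k | Q i k].
have fQ i : i \in S -> Q i (f i).
  move=> iS; rewrite /f; case: pickP => //= nQ.
  by have [k kn Qk] := cov i iS; have := nQ (Ordinal kn); rewrite /Q/= Qk.
pose m k := \sum_(i in S | f i == k) mu.
pose e k := mu ^+ 2 * \sum_(i in S | f i == k) \sum_(j in S | f j == k)
  kernel a ((gap i j)%:R / q%:R).
have K0 x : 0 <= kernel a x by exact: powR_ge0.
have mke k : m k ^+ 2 <= (8 * r k) `^ a * e k.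
  have -> : m k ^+ 2 = \sum_(i in S | f i == k) \sum_(j in S | f j == k) mu ^+ 2.
    by rewrite /m expr2 big_distrlr.
  have -> : (8 * r k) `^ a * e k = \sum_(i in S | f i == k) \sum_(j in S | f j == k)
      mu ^+ 2 * ((8 * r k) `^ a * kernel a ((gap i j)%:R / q%:R)).
    rewrite /e !mulr_sumr; apply: eq_bigr => i _; rewrite !mulr_sumr.
    by apply: eq_bigr => j _; rewrite mulrCA.
  apply: ler_sum => i /andP[iS fi]; apply: ler_sum => j /andP[jS fj].
  have := fQ i iS; have := fQ j jS; rewrite (eqP fi) (eqP fj) /Q => hj hi.
  have rk0 : 0 < r k by apply: le_lt_trans hi.
  have q0 : (0 < q)%N by apply: leq_ltn_trans (ltn_ord i).
  have q1 : 0 < q%:R :> R by rewrite ltr0n.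
  have rqk := rq k (ltn_ord k) rk0.
  have g0 : (0 < gap i j)%N by rewrite /gap leq_maxl.
  have t01 : 0 < ((gap i j)%:R / q%:R : R) <= 1.
    by rewrite divr_gt0 ?ltr0n//= ler_pdivrMr// mul1r ler_nat gap_le.
  (* Two distinct times in a ball of radius [r k] are at distance below [2 * r k]. On the diagonal
     the gap is 1, which is where [q^-1 <= r k] enters. *)
  have t2 : (gap i j)%:R / q%:R <= 2 * r k.
    rewrite /gap; case: (leqP 1 ((i - j) + (j - i))) => g1; last by rewrite mul1r; lra.
    rewrite natr_absdiff -[q%:R^-1]ger0_norm ?invr_ge0// -normrM mulrBl.
    rewrite (_ : _ - _ = (i%:R / q%:R - c k) - (j%:R / q%:R - c k)); last by ring.
    by apply: (le_trans (ler_normB _ _)); lra.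
  have h1 := kernel_ge a0 t01.
  have h2 : (4 * ((gap i j)%:R / q%:R)) `^ a <= (8 * r k) `^ a.
    have /andP[t0 _] := t01; move: t0 t2; move: ((gap i j)%:R / q%:R) => tau t0 t2.
    by apply: ge0_ler_powR => //; rewrite ?nnegrE; lra.
  have h3 : 1 <= (8 * r k) `^ a * kernel a ((gap i j)%:R / q%:R).
    by apply: le_trans h1 _; rewrite mulrC ler_wpM2r.
  by rewrite -[leLHS]mulr1; apply: ler_wpM2l => //; exact: sqr_ge0.
have summ : \sum_k m k = mu * #|S|%:R.
  rewrite /m -(partition_big f xpredT)//= sumr_const mulr_natr.
  by [].
have sume : \sum_k e k <= M.
  apply: le_trans I; rewrite -mulr_sumr ler_wpM2l ?sqr_ge0//.
  rewrite [leRHS](partition_big f xpredT)//=; apply: ler_sum => k _; apply: ler_sum => i _.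
  rewrite [leRHS](bigID (fun j => f j == k))/= lerDl; exact: sumr_ge0.
(* This linear form of [m^2 <= y * e] replaces the Cauchy-Schwarz inequality; summed over the balls
   it yields [1 / 2 <= M * sum y + 1 / 4]. *)
have amgm k : m k <= M * (8 * r k) `^ a + e k / (4 * M).
  have m0 : 0 <= m k by apply: sumr_ge0.
  have e0 : 0 <= e k.
    apply: mulr_ge0; first exact: sqr_ge0.
    by apply: sumr_ge0 => i _; apply: sumr_ge0 => j _; exact: K0.
  have := mke k; have := powR_ge0 (8 * r k) a; move: ((8 * r k) `^ a) => y y0 h.
  have M4 : 0 < 4 * M by lra.
  have : m k * (4 * M) <= 4 * M ^+ 2 * y + e k.
    apply: contraTT h; rewrite -!ltNge => h.
    have s0 : 0 <= 4 * M ^+ 2 * y by apply: mulr_ge0 => //; apply: mulr_ge0 => //; exact: sqr_ge0.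
    rewrite -(ltr_pM2r (_ : 0 < 16 * M ^+ 2)); last by rewrite mulr_gt0// exprn_gt0.
    have := sqr_ge0 (4 * M ^+ 2 * y - e k).
    have : (4 * M ^+ 2 * y + e k) ^+ 2 < (m k * (4 * M)) ^+ 2.
      by rewrite !expr2; apply: ltr_pM => //; exact: addr_ge0.
    by nra.
  rewrite -ler_pdivlMr// => /le_trans; apply.
  by rewrite mulrDl lerD2r (_ : _ / _ = M * y)//; field; rewrite gt_eqF.
have : \sum_k m k <= \sum_(k < n1.+1) (M * (8 * r k) `^ a + e k / (4 * M)).
  by apply: ler_sum => k _.
rewrite summ big_split/= -mulr_sumr -mulr_suml => h.
have : (\sum_k e k) / (4 * M) <= 1 / 4.
  rewrite ler_pdivrMr ?mulr_gt0//; lra.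
move: h; move: (\sum_(k < n1.+1) (8 * r k) `^ a) => y h1 h2.
rewrite ler_pdivrMr ?mulr_gt0//; nra.
Qed.

End Energy.

Lemma inv_nat_small (R : realType) (r : nat -> R) n0 :
  exists q0 : nat, forall q, (q0 <= q)%N -> forall k, (k < n0)%N -> 0 < r k -> q%:R^-1 <= r k.
Proof.
elim: n0 => [|n [q1 h1]]; first by exists 0%N.
exists (maxn q1 (Num.truncn (r n)^-1).+1) => q; rewrite geq_max => /andP[q1q hq] k.
rewrite ltnS leq_eqVlt => /predU1P[->|kn] rk; last exact: h1.
rewrite -[leRHS]invrK lef_pV2 ?posrE ?invr_gt0//.
  by apply: le_trans (ltW (truncnS_gt _)) _; rewrite ler_nat.
by rewrite ltr0n (leq_trans _ hq).
Qed.

(** * From discrete energies to Hausdorff dimension *)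

Section DimensionFromEnergy.
Context d (Omega : measurableType d) (R : realType) (P : probability Omega R).
Variables (F : nat -> set (set Omega)) (D : nat -> R -> Omega -> R) (C : R).
Hypothesis dm : distance_model P F D C.
Variable ell : nat -> R.
Implicit Types (N n k q : nat) (w : Omega).

Local Notation survivors := (survivors D ell).
Local Notation radius := (radius ell).

Definition alive N n t := [set w | forall k, (N <= k <= n)%N -> radius k <= D k t w].

Definition alive_set N n q w : {set 'I_q} :=
  [set i : 'I_q | `[< alive N n (i%:R / q%:R) w >]]%SET.

(** The measure that puts mass [mu] on every surviving grid time has total mass at least 1/2 and,
    for the step kernel, [a]-energy at most [M]. *)
Definition good (a : R) N n q (mu M : R) w :=
  1 / 2 <= mu * #|alive_set N n q w|%:R /\
  mu ^+ 2 * \sum_(i in alive_set N n q w) \sum_(j in alive_set N n q w)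
    kernel a ((gap i j)%:R / q%:R) <= M.

(** Otherwise, for every [n], some time surviving up to [n] lies outside the first [n] balls. Such
    times cluster at a survivor, whose open ball would contain them infinitely often. *)
Lemma cover_finite N w (c r : nat -> R) : (1 <= N)%N ->
  survivors N w `<=` \bigcup_i [set x | `|x - c i| < r i] ->
  exists n0, forall n t, (n0 <= n)%N -> 0 <= t <= 1 -> alive N n t w ->
    exists2 k, (k < n0)%N & `|t - c k| < r k.
Proof.
move=> N1 cov; apply: contrapT => nex.
have /choice[u hu] : forall n0, exists t, [/\ 0 <= t <= 1, alive N n0 t w &
    forall k, (k < n0)%N -> ~ `|t - c k| < r k].
  move=> n0; apply: contrapT => h; apply: nex; exists n0 => n t n0n t01 al.
  apply: contrapT => h'; apply: h; exists t; split=> //.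
    by move=> k /andP[Nk kn]; apply: al; rewrite Nk (leq_trans kn).
  by move=> k kn hk; apply: h'; exists k.
have u01 k : 0 <= u k <= 1 by have [] := hu k.
have [t t01 ut] := segment_cluster u01.
have st : survivors N w t.
  split=> // k Nk.
  have cD : continuous (fun t => D k t w) by apply: (dm_cont dm); exact: leq_trans Nk.
  apply: (@hit_limit _ _ D radius u (fun=> 0) w k t (cD t) ut).
    by move=> eps eps0; exists 0%N.
  exists k => j kj; rewrite subr0; have [_ h _] := hu j.
  by apply: h; rewrite Nk.
have [k _ /= hk] := cov t st.
have V : nbhs t [set x | `|x - c k| < r k].
  have cX : {for t, continuous (fun x : R => `|x - c k|)}.
    apply: continuous_comp; last exact: norm_continuous.
    by apply: (@cvgB _ R^o); [exact: cvg_id|exact: cvg_cst].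
  exact: cX _ (lt_nbhsl hk).
have [j kj] := ut _ V k.+1.
by have [_ _ h] := hu j; exact: h.
Qed.

Lemma good_dim N w (a M : R) : (1 <= N)%N -> 0 <= a <= 1 -> 0 < M ->
  (forall m, exists n q mu, [/\ (m <= n)%N, (n <= q)%N, 0 <= mu & good a N n q mu M w]) ->
  survivors N w !=set0 /\
  forall s, 0 < s < a -> hausdorff_measure s (survivors N w) <> 0%E.
Proof.
move=> N1 /andP[a0 a1] M0 hgood; split.
  have [||t t01 ht] := @hit_bigcap _ _ D radius N 0 1 w.
  - by move=> n Nn; apply: (dm_cont dm); exact: leq_trans Nn.
  - move=> m; have [n [q [mu [mn nq mu0 [Z _]]]]] := hgood m.
    have [i] : exists i, i \in alive_set N n q w.
      apply/set0Pn/negP => /eqP S0; move: Z; rewrite S0 cards0 mulr0; lra.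
    rewrite inE => /asboolP al; exists (i%:R / q%:R).
      rewrite add0r divr_ge0//= ler_pdivrMr ?mul1r ?ler_nat ?(ltnW (ltn_ord i))//.
      by rewrite ltr0n (leq_ltn_trans _ (ltn_ord i)).
    move=> k; rewrite mem_index_iota => /andP[Nk km]; apply: al.
    by rewrite Nk (leq_trans (ltnW km)).
  - by exists t; split=> //; rewrite -[1]add0r.
move=> s /andP[s0 sa] hs.
(* For radii at most 1 and [s < a <= 1], [(8 r)^a <= 8 r^s], so a total of [1 / (64 M)] yields
   [1 / (8 M)], half of what the energy bound demands. *)
have e0 : 0 < 1 / (64 * M) by rewrite divr_gt0// mulr_gt0.
have [c [r [r0 cov rs]]] := measure0_ball_cover s0 hs ltr01 e0.
have [n0 hn0] := cover_finite N1 cov.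
have [q0 hq0] := inv_nat_small r n0.
have [n [q [mu [mn nq mu0 [Z I]]]]] := hgood (maxn 1 (maxn n0 q0)).
move: mn; rewrite !geq_max => /and3P[n1 n0n q0n].
have q1 : 0 < q%:R :> R by rewrite ltr0n (leq_trans n1).
have := @energy_cover R a q (alive_set N n q w) c r n0 mu M a0 M0 mu0 _ _ _ Z I.
have hle : \sum_(k < n0) (8 * r k) `^ a <= 1 / (8 * M).
  apply: (@le_trans _ _ (\sum_(k < n0) 8 * r k `^ s)).
    apply: ler_sum => k _; have /andP[rk0 rk1] := r0 k.
    rewrite powRM//; apply: ler_pM; rewrite ?powR_ge0//.
      by rewrite -[leRHS](@powRr1 R 8)// ler_powR// ler1n.
    have [->|rk] := eqVneq (r k) 0; first by rewrite !powR0// gt_eqF// (lt_trans s0).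
    have rkp : 0 < r k by rewrite lt0r rk.
    rewrite /powR (negbTE rk) ler_expR ler_wnM2r ?(ltW sa)//.
    by rewrite -ln1 ler_ln ?posrE.
  rewrite -mulr_sumr; apply: (@le_trans _ _ (8 * (1 / (64 * M)))).
    by apply: ler_wpM2l => //; exact: rs.
  by rewrite [leLHS](_ : _ = 1 / (8 * M))//; field; rewrite gt_eqF.
move=> h; have : 1 / (4 * M) <= 1 / (8 * M).
  apply: le_trans hle; apply: h.
  - by move=> k; have /andP[] := r0 k.
  - by move=> k kn rk; apply: hq0 => //; exact: leq_trans nq.
  - move=> i; rewrite inE => /asboolP al; apply: (hn0 n) => //.
    by rewrite divr_ge0//= ler_pdivrMr// mul1r ler_nat ltnW.
by rewrite ler_pM2l// lef_pV2 ?posrE ?mulr_gt0//; lra.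
Qed.

End DimensionFromEnergy.

(** * Elementary sums *)

Section SumBounds.
Variable R : realType.
Implicit Types (f g : nat -> R) (K N n q : nat).

Lemma sum_inv_sq_tail K n : (0 < K)%N ->
  \sum_(1 <= k < n.+1) (if (K < k)%N then (k%:R ^+ 2)^-1 else 0) <= K%:R^-1 :> R.
Proof.
move=> K0; suff : \sum_(1 <= k < n.+1) (if (K < k)%N then (k%:R ^+ 2)^-1 else 0)
    <= K%:R^-1 - (maxn n K)%:R^-1 :> R.
  by move/le_trans; apply; rewrite gerBl invr_ge0.
elim: n => [|n IH]; first by rewrite big_geq// max0n subrr.
rewrite big_nat_recr//=; case: (boolP (K < n.+1)%N) => Kn; last first.
  rewrite -leqNgt in Kn.
  rewrite addr0; apply: le_trans IH _.
  by rewrite (maxn_idPr (ltnW Kn)) (maxn_idPr Kn).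
have nK : (K <= n)%N by [].
move: IH; rewrite (maxn_idPl nK) (maxn_idPl (leqW nK)) => IH.
have n0 : 0 < n%:R :> R by rewrite ltr0n (leq_trans K0).
have : (n.+1%:R ^+ 2)^-1 <= n%:R^-1 - n.+1%:R^-1 :> R.
  rewrite -natr1; have -> : n%:R^-1 - (n%:R + 1)^-1 = (n%:R * (n%:R + 1))^-1 :> R.
    by field; rewrite !gt_eqF//; lra.
  by rewrite lef_pV2 ?posrE ?exprn_gt0 ?mulr_gt0//; nra.
by move=> h; apply: le_trans (lerD IH h) _; rewrite addrA subrK.
Qed.

Lemma sum_inv_sq n : \sum_(1 <= k < n.+1) (k%:R ^+ 2)^-1 <= 2 :> R.
Proof.
case: n => [|n]; first by rewrite big_geq.
have := sum_inv_sq_tail n.+1 (ltn0Sn 0).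
rewrite big_ltn//= add0r invr1.
rewrite (eq_big_nat _ _ (F2 := fun k => (k%:R ^+ 2)^-1)); last first.
  by move=> k /andP[k1 _]; rewrite k1.
move=> h; rewrite big_ltn// expr1n invr1.
lra.
Qed.

Lemma ler_sum_nat_widen f N n : (forall k, 0 <= f k) -> (1 <= N)%N ->
  \sum_(N <= k < n) f k <= \sum_(1 <= k < n) f k.
Proof.
move=> f0 N1; have [Nn|nN] := leqP N n.
  by rewrite [leRHS](@big_cat_nat _ _ _ N)//= lerDr sumr_ge0.
by rewrite big_geq ?(ltnW nN)// sumr_ge0.
Qed.

Lemma sum_prefix f K n : (forall k, 0 <= f k) ->
  \sum_(1 <= k < n) (if (k <= K)%N then f k else 0) <= \sum_(1 <= k < K.+1) f k.
Proof.
move=> f0; elim: n => [|n IH]; first by rewrite big_geq// sumr_ge0.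
case: n IH => [_|n IH]; first by rewrite big_geq// sumr_ge0.
rewrite big_nat_recr//=; case: ifPn => [nK|_]; last by rewrite addr0.
rewrite [leRHS](@big_cat_nat _ _ _ n.+1)//=; last exact: leqW.
rewrite lerD//.
  by rewrite big_nat [leRHS]big_nat ler_sum// => k _; case: ifP.
by rewrite big_ltn// lerDl sumr_ge0.
Qed.

(* Abel summation, with [lev (K d) = \sum_(k <= K d) (lev k - lev k.-1)]. *)
Lemma sum_levels (lev : nat -> R) (Kf : nat -> nat) (T m : nat) (y : nat -> R) :
  lev 0%N = 0 -> (forall k, lev k <= lev k.+1) ->
  (forall d, (d < T)%N -> (Kf d <= m)%N) ->
  (forall k, (1 <= k <= m)%N -> \sum_(0 <= d < T) (if (k <= Kf d)%N then 1 else 0) <= y k) ->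
  \sum_(0 <= d < T) lev (Kf d) <= \sum_(1 <= k < m.+1) (lev k - lev k.-1) * y k.
Proof.
move=> l0 lmono Km hy.
have E d : (d < T)%N -> lev (Kf d) =
    \sum_(1 <= k < m.+1) (lev k - lev k.-1) * (if (k <= Kf d)%N then 1 else 0).
  move=> dT; have := Km d dT; move: (Kf d) => K Km'.
  have -> : lev K = \sum_(1 <= k < K.+1) (lev k - lev k.-1).
    rewrite big_add1/= (@telescope_sumr_eq _ 0 K lev)//; by rewrite l0 subr0.
  rewrite [RHS](@big_cat_nat _ _ _ K.+1)//=.
  rewrite [X in _ = _ + X]big_nat_cond [X in _ = _ + X]big1 ?addr0; last first.
    by move=> k /andP[/andP[Kk _] _]; rewrite leqNgt Kk mulr0.
  rewrite big_nat [RHS]big_nat; apply: eq_bigr => k /andP[_ kK].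
  by rewrite ltnS in kK; rewrite kK mulr1.
rewrite big_nat (eq_bigr _ (fun d hd => E d (proj2 (andP hd)))) -big_nat exchange_big/=.
rewrite big_nat [leRHS]big_nat; apply: ler_sum => k km.
rewrite -mulr_sumr ler_wpM2l ?hy//.
by case: k km => // k _ /=; rewrite subr_ge0.
Qed.

(** Every gap occurs at most once on each side of [i]. *)
Lemma sum_gap_le q g (i : nat) : (i < q)%N -> (forall k, 0 <= g k) ->
  \sum_(0 <= j < q | j != i) g (gap i j) <= 2 * \sum_(0 <= d < q) g d.+1.
Proof.
move=> iq g0; rewrite (@big_cat_nat _ _ _ i)//=; last exact: ltnW.
rewrite mulr_natl mulr2n lerD//.
  rewrite big_mkcond/= big_nat_rev/= add0n.
  rewrite [leRHS](@big_cat_nat _ _ _ i)//=; last exact: ltnW.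
  rewrite ler_wpDr ?sumr_ge0// big_nat [leRHS]big_nat; apply: ler_sum => j /andP[_ ji].
  rewrite (_ : gap i (i - j.+1) = j.+1); first by case: ifP.
  by rewrite /gap; lia.
rewrite big_ltn_cond//= eqxx/= big_mkcond/= -{1}[i.+1]addn0 addnC big_addn.
rewrite [leRHS](@big_cat_nat _ _ _ (q - i.+1))//=; last exact: leq_subr.
rewrite ler_wpDr ?sumr_ge0// big_nat [leRHS]big_nat; apply: ler_sum => j /andP[_ ji].
rewrite (_ : gap i (j + i.+1) = j.+1); first by case: ifP.
by rewrite /gap; lia.
Qed.

End SumBounds.

(** * Correlation of two times *)

Section PairCorrelation.
Context d (Omega : measurableType d) (R : realType) (P : probability Omega R).
Local Notation pr := (pr P).
Variables (F : nat -> set (set Omega)) (D : nat -> R -> Omega -> R) (C : R).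
Hypothesis dm : distance_model P F D C.
Variables (ell : nat -> R) (M1 : R).
Hypothesis ell_gt0 : forall n, (1 <= n)%N -> 0 < ell n.
Hypothesis ell_le : forall n, (1 <= n)%N -> ell n <= M1 / n%:R.
Implicit Types (N n k q K : nat) (s t : R).

Local Notation alive := (alive D ell).

Definition alive_prob N n : R := \prod_(N <= k < n.+1) (1 - ell k).

Lemma alive_bigcap N n t : alive N n t =
  \bigcap_(k in [set k | k \in index_iota N n.+1]) ~` [set w | D k t w < radius ell k].
Proof.
apply/seteqP; split => w /= h k; last first.
  by move=> kn; rewrite leNgt; apply/negP/h; rewrite /= mem_index_iota ltnS.
by rewrite /= mem_index_iota ltnS => kn; apply/negP; rewrite -leNgt; exact: h.
Qed.

Lemma far_sigma k t : (1 <= k)%N -> F k (~` [set w | D k t w < radius ell k]).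
Proof. by move=> k1; apply: (sigmaC (dm_sigma dm k1).2); exact: (dm_lt dm). Qed.

Lemma measurable_alive N n t : (1 <= N)%N -> measurable (alive N n t).
Proof.
move=> N1; rewrite alive_bigcap; apply: bigcap_measurableType => k /=.
rewrite mem_index_iota => /andP[Nk _]; have k1 := leq_trans N1 Nk.
by apply: (dm_sigma dm k1).1; exact: far_sigma.
Qed.

Lemma near_law k t : (1 <= k)%N -> 0 <= t -> ell k <= 1 / 2 ->
  pr [set w | D k t w < radius ell k] = ell k.
Proof.
move=> k1 t0 l12; have l0 := ell_gt0 k1.
by rewrite (dm_law dm k1 t0) /radius; [field|lra].
Qed.

Lemma alive_pr N n t : (1 <= N)%N -> 0 <= t -> (forall k, (N <= k)%N -> ell k <= 1 / 2) ->
  pr (alive N n t) = alive_prob N n.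
Proof.
move=> N1 t0 l12; rewrite alive_bigcap.
rewrite (@mutually_independent_pr _ _ _ _ [set n | (1 <= n)%N] F) ?iota_uniq//; last 3 first.
- exact: (dm_indep dm).
- by move=> m m1; have [] := dm_sigma dm m1.
- move=> m; rewrite mem_index_iota => /andP[Nm _].
  by have m1 := leq_trans N1 Nm; split=> //; exact: far_sigma.
apply: eq_big_nat => k /andP[Nk _]; have k1 := leq_trans N1 Nk.
rewrite pr_setC ?near_law//; first exact: l12.
by apply: (dm_sigma dm k1).1; exact: (dm_lt dm).
Qed.

Lemma alive_prob_gt0 N n : (forall k, (N <= k)%N -> ell k <= 1 / 2) -> 0 < alive_prob N n.
Proof.
move=> l12; rewrite /alive_prob big_nat_cond; apply: prodr_gt0 => k /andP[/andP[Nk _] _].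
by have := l12 k Nk; lra.
Qed.

(** A bound for the logarithm of the correlation due to the [k]-th arc. Up to [K] the arcs are too
    long for the two times to decouple, and one of the times is dropped; beyond [K] the two-point
    estimate is used. *)
Definition pair_exponent K s t k : R :=
  if (k <= K)%N then ell k + 2 * ell k ^+ 2 else C * ell k ^+ 2 / Num.sqrt (t - s).

(** For [l = ell k <= 1 / 2], the first case is [1 - l <= (1 - l)^2 * (1 + l + 2 l^2)]. In the
    second, the radius [l / 2] gives a joint near probability of at most a quarter of the exponent,
    and [1 / 4 <= (1 - l)^2]. *)
Lemma far_pair K s t k : (1 <= k)%N -> 0 <= s < t -> t - s <= 1 -> ell k <= 1 / 2 ->
  pr (~` [set w | D k s w < radius ell k] `&` ~` [set w | D k t w < radius ell k]) <=
    (1 - ell k) ^+ 2 * expR (pair_exponent K s t k).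
Proof.
move=> k1 st ts l12; have l0 := ell_gt0 k1; have /andP[s0 sltt] := st.
have t0 : 0 <= t by rewrite (le_trans s0)// ltW.
have C0 := exit_const_ge0 dm.
set A := [set w | D k s w < _]; set B := [set w | D k t w < _].
have mA : measurable A by apply: (dm_sigma dm k1).1; exact: (dm_lt dm).
have mB : measurable B by apply: (dm_sigma dm k1).1; exact: (dm_lt dm).
have pA : pr A = ell k by exact: near_law.
have pB : pr B = ell k by exact: near_law.
rewrite /pair_exponent; case: ifP => _.
  apply: (@le_trans _ _ (1 - ell k)).
    rewrite -{1}pA -pr_setC//; apply: pr_mono; [|exact: measurableC|exact: subIsetl].
    by apply: measurableI; exact: measurableC.
  have := expR_ge1Dx (ell k + 2 * ell k ^+ 2).
  set x := ell k in l0 l12 *; move=> h.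
  apply: (@le_trans _ _ ((1 - x) ^+ 2 * (1 + (x + 2 * x ^+ 2)))); last first.
    by rewrite ler_wpM2l// sqr_ge0.
  have -> : (1 - x) ^+ 2 * (1 + (x + 2 * x ^+ 2)) =
      (1 - x) + (1 - x) * x ^+ 2 * (1 - 2 * x) by ring.
  by rewrite lerDl !mulr_ge0 ?sqr_ge0//; lra.
have := dm_pair dm k1 st ts (_ : 0 < radius ell k) => hp.
have r0 : 0 < radius ell k by rewrite /radius divr_gt0.
have := hp r0; rewrite -/A -/B => hAB.
have q0 : 0 < Num.sqrt (t - s) by rewrite sqrtr_gt0 subr_gt0.
have -> : pr (~` A `&` ~` B) = 1 - 2 * ell k + pr (A `&` B).
  rewrite prD//; last exact: measurableC.
  rewrite pr_setC// (setIC (~` A)) prD// pA pB (setIC B); lra.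
have := expR_ge1Dx (C * ell k ^+ 2 / Num.sqrt (t - s)).
set e := C * ell k ^+ 2 / Num.sqrt (t - s) => he.
have e0 : 0 <= e by apply: divr_ge0; [apply: mulr_ge0 => //; exact: sqr_ge0|exact: ltW].
have hAB' : pr (A `&` B) <= e / 4.
  apply: le_trans hAB _; rewrite /e /radius.
  rewrite [leLHS](_ : _ = C * ell k ^+ 2 / Num.sqrt (t - s) / 4)//.
  by field; rewrite gt_eqF.
apply: (@le_trans _ _ ((1 - ell k) ^+ 2 * (1 + e))); last by rewrite ler_wpM2l// sqr_ge0.
have h4 : 1 / 4 <= (1 - ell k) ^+ 2 by nra.
have := ler_wpM2r e0 h4; have := sqr_ge0 (ell k).
have -> : (1 - ell k) ^+ 2 * (1 + e) = 1 - 2 * ell k + ell k ^+ 2 + (1 - ell k) ^+ 2 * e by ring.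
by move: ((1 - ell k) ^+ 2 * e) (ell k ^+ 2) => y z; lra.
Qed.

Lemma alive_pair K N n s t : (1 <= N)%N -> 0 <= s < t -> t - s <= 1 ->
  (forall k, (N <= k)%N -> ell k <= 1 / 2) ->
  pr (alive N n s `&` alive N n t) <=
    alive_prob N n ^+ 2 * expR (\sum_(N <= k < n.+1) pair_exponent K s t k).
Proof.
move=> N1 st ts l12; rewrite !alive_bigcap -bigcapI.
rewrite (@mutually_independent_pr _ _ _ _ [set n | (1 <= n)%N] F) ?iota_uniq//; last 3 first.
- exact: (dm_indep dm).
- by move=> m m1; have [] := dm_sigma dm m1.
- move=> m; rewrite mem_index_iota => /andP[Nm _]; have m1 := leq_trans N1 Nm.
  by split=> //; apply: (sigmaI (dm_sigma dm m1).2); exact: far_sigma.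
rewrite expR_sum /alive_prob -prodrXl -big_split/= big_seq [leRHS]big_seq.
apply: ler_prod => k; rewrite mem_index_iota => /andP[Nk _]; rewrite pr_ge0/=.
by apply: far_pair => //; [exact: leq_trans Nk|exact: l12].
Qed.

Definition partial_length n : R := \sum_(1 <= k < n.+1) ell k.

Lemma M1_gt0 : 0 < M1.
Proof. by have := ell_le (leqnn 1); have := ell_gt0 (leqnn 1); rewrite divr1; lra. Qed.

Lemma ell_sq_le k : (1 <= k)%N -> ell k ^+ 2 <= M1 ^+ 2 / k%:R ^+ 2.
Proof.
move=> k1; rewrite -exprVn -exprMn.
have h := ell_le k1; have l0 := ell_gt0 k1.
have p0 : 0 <= M1 / k%:R by apply: le_trans h; exact: ltW.
by apply: lerXn2r => //; exact: (ltW l0).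
Qed.

Lemma pair_term_le s t k : (1 <= k)%N -> s < t ->
  C * ell k ^+ 2 / Num.sqrt (t - s) <= C * M1 ^+ 2 / Num.sqrt (t - s) * (k%:R ^+ 2)^-1.
Proof.
move=> k1 st; have C0 := exit_const_ge0 dm.
have q0 : 0 < Num.sqrt (t - s) by rewrite sqrtr_gt0 subr_gt0.
rewrite [leLHS](_ : _ = C / Num.sqrt (t - s) * ell k ^+ 2); last by ring.
rewrite [leRHS](_ : _ = C / Num.sqrt (t - s) * (M1 ^+ 2 / k%:R ^+ 2)); last by ring.
by apply: ler_wpM2l; [exact: divr_ge0 C0 (ltW q0)|exact: ell_sq_le].
Qed.

(** With [K < N] no arc is bounded crudely, and the sum of [1 / k^2] beyond [K] is at most [1 / K].
    For separated times and large [K] the exponent is therefore small. *)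
Lemma pair_exponent_far K N n s t : (1 <= K < N)%N -> s < t ->
  \sum_(N <= k < n.+1) pair_exponent K s t k <= C * M1 ^+ 2 / (K%:R * Num.sqrt (t - s)).
Proof.
move=> /andP[K1 KN] st; have C0 := exit_const_ge0 dm.
have q0 : 0 < Num.sqrt (t - s) by rewrite sqrtr_gt0 subr_gt0.
pose c := C * M1 ^+ 2 / Num.sqrt (t - s).
have c0 : 0 <= c by apply: divr_ge0; [apply: mulr_ge0 => //; exact: sqr_ge0|exact: ltW].
pose g k : R := if (K < k)%N then (k%:R ^+ 2)^-1 else 0.
have g0 k : 0 <= g k by rewrite /g; case: ifP => // _; rewrite invr_ge0 sqr_ge0.
apply: (@le_trans _ _ (\sum_(N <= k < n.+1) c * g k)).
  rewrite big_nat [leRHS]big_nat; apply: ler_sum => k /andP[Nk _].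
  have Kk := leq_trans KN Nk; have k1 : (1 <= k)%N by exact: leq_ltn_trans Kk.
  by rewrite /pair_exponent leqNgt Kk /g Kk /=; exact: pair_term_le.
rewrite -mulr_sumr.
apply: (@le_trans _ _ (c * K%:R^-1)); last by rewrite /c -mulrA -invfM (mulrC K%:R).
apply: ler_wpM2l => //; apply: le_trans (sum_inv_sq_tail R n K1).
by apply: ler_sum_nat_widen => //; exact: leq_trans KN.
Qed.

(** The choice of [K] of order [(t - s)^(-1/2)] balances the two regimes: the last term becomes a
    constant, and the correlation is at most of order [expR (partial_length K)]. *)
Lemma pair_exponent_near K N n s t : (1 <= K)%N -> (1 <= N)%N -> s < t ->
  \sum_(N <= k < n.+1) pair_exponent K s t k <=
    partial_length K + 4 * M1 ^+ 2 + C * M1 ^+ 2 / (K%:R * Num.sqrt (t - s)).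
Proof.
move=> K1 N1 st; have C0 := exit_const_ge0 dm.
have q0 : 0 < Num.sqrt (t - s) by rewrite sqrtr_gt0 subr_gt0.
pose c := C * M1 ^+ 2 / Num.sqrt (t - s).
have c0 : 0 <= c by apply: divr_ge0; [apply: mulr_ge0 => //; exact: sqr_ge0|exact: ltW].
(* [ell 0] is replaced by 0 so that all terms are nonnegative when the range of summation is
   widened. *)
pose l' k := if (1 <= k)%N then ell k else 0.
have l'0 k : 0 <= l' k by rewrite /l'; case: ifP => // k1; rewrite ltW// ell_gt0.
pose f1 k := if (k <= K)%N then l' k else 0.
pose f2 k : R := (k%:R ^+ 2)^-1.
pose f3 k : R := if (K < k)%N then (k%:R ^+ 2)^-1 else 0.
have f10 k : 0 <= f1 k by rewrite /f1; case: ifP.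
have f20 k : 0 <= f2 k by rewrite /f2 invr_ge0 sqr_ge0.
have f30 k : 0 <= f3 k by rewrite /f3; case: ifP.
pose f k := f1 k + 2 * M1 ^+ 2 * f2 k + c * f3 k.
have M20 : 0 <= M1 ^+ 2 := sqr_ge0 _.
have f0 k : 0 <= f k.
  apply: addr_ge0; last exact: mulr_ge0.
  by apply: addr_ge0 => //; apply: mulr_ge0 => //; exact: mulr_ge0.
apply: (@le_trans _ _ (\sum_(N <= k < n.+1) f k)).
  rewrite big_nat [leRHS]big_nat; apply: ler_sum => k /andP[Nk _].
  have k1 : (1 <= k)%N by exact: leq_trans Nk.
  have l2 := ell_sq_le k1.
  rewrite /pair_exponent /f /f1 /f3 /l' k1 ltnNge; case: ifP => /= _.
    by rewrite mulr0 addr0 lerD2l -mulrA ler_wpM2l.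
  rewrite add0r ler_wpDl//; first by apply: mulr_ge0 => //; exact: mulr_ge0.
  exact: pair_term_le.
apply: (le_trans (ler_sum_nat_widen _ f0 N1)).
rewrite /f !big_split/= -!mulr_sumr.
rewrite lerD//; last first.
  apply: (@le_trans _ _ (c * K%:R^-1)); last by rewrite /c -mulrA -invfM (mulrC K%:R).
  by apply: ler_wpM2l => //; exact: sum_inv_sq_tail.
rewrite lerD//; last first.
  have := sum_inv_sq R n; rewrite -/f2 => h.
  by have := ler_wpM2l (mulr_ge0 (ler0n R 2) M20) h; rewrite /f2; lra.
apply: le_trans (sum_prefix K _ l'0) _.
rewrite /partial_length big_nat [leRHS]big_nat; apply: ler_sum => k /andP[k1 _].
by rewrite /l' k1.
Qed.

End PairCorrelation.

Lemma count_le (R : realType) (x : R) T : 0 <= x ->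
  \sum_(0 <= d < T) (if d.+1%:R <= x then 1 else 0) <= x.
Proof.
move=> x0; elim: T => [|T IH]; first by rewrite big_geq.
rewrite big_nat_recr//=; case: ifPn => h; last by rewrite addr0.
apply: le_trans h; rewrite -natr1 lerD2r.
apply: (@le_trans _ _ (\sum_(0 <= d < T) 1)).
  by apply: ler_sum => d _; case: ifP.
by rewrite sumr_const_nat subn0.
Qed.

(** * Energy sums over the grid *)

Section EnergyBounds.
Context disp (Omega : measurableType disp) (R : realType) (P : probability Omega R).
Local Notation pr := (pr P).
Variables (F : nat -> set (set Omega)) (D : nat -> R -> Omega -> R) (C : R).
Hypothesis dm : distance_model P F D C.
Variables (ell : nat -> R) (M1 : R).
Hypothesis ell_gt0 : forall n, (1 <= n)%N -> 0 < ell n.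
Hypothesis ell_le : forall n, (1 <= n)%N -> ell n <= M1 / n%:R.
Implicit Types (N n k q K T : nat) (a s t : R).

Local Notation alive := (alive D ell).
Local Notation alive_prob := (alive_prob ell).

(** Up to a constant, a bound for correlation times kernel at two times of distance about [k^-2].
    The value 0 at [k = 0] starts the Abel summation. *)
Definition level a k : R :=
  if k is 0%N then 0 else expR (partial_length ell k) * k%:R `^ (2 * a).

Lemma level_ge0 a k : 0 <= level a k.
Proof. by case: k => // k; rewrite mulr_ge0 ?expR_ge0 ?powR_ge0. Qed.

Lemma partial_lengthS k : partial_length ell k.+1 = partial_length ell k + ell k.+1.
Proof. by rewrite /partial_length big_nat_recr. Qed.

Lemma level_mono a k : 0 <= a -> level a k <= level a k.+1.
Proof.
move=> a0; case: k => [|k]; first exact: level_ge0.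
rewrite /level (partial_lengthS k.+1); apply: ler_pM; rewrite ?expR_ge0 ?powR_ge0//.
  by rewrite ler_expR lerDl ltW// ell_gt0.
by apply: ge0_ler_powR; rewrite ?nnegrE ?mulr_ge0// ler_nat.
Qed.

(** A discrete derivative: the step to [k] multiplies the exponential by at most [1 / (1 - ell k)]
    when [ell k < 1], and [k^(2a)] by at most [(1 - 1 / k)^(-2)], as [2 a <= 2]. To first order the
    loss is [ell k + 2 / k]. *)
Lemma level_step a k : 0 <= a <= 1 -> (1 <= k)%N ->
  level a k - level a k.-1 <= (M1 + 2) * level a k / k%:R.
Proof.
move=> /andP[a0 a1]; have m1 := M1_gt0 ell_gt0 ell_le.
case: k => // -[_|k _].
  by rewrite /= subr0 divr1 ler_peMl ?(level_ge0 a 1)//; lra.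
rewrite [k.+2.-1]/=; set K : R := k.+2%:R.
have K2 : 2 <= K by rewrite /K ler_nat.
have e1 : k.+1%:R = K * (1 - K^-1) :> R.
  by rewrite mulrBr mulr1 divff /K ?pnatr_eq0// -(natr1 k.+1) addrK.
have t01 : 0 <= K^-1 <= 1 / 2.
  by rewrite invr_ge0; apply/andP; split; [lra|rewrite mul1r lef_pV2 ?posrE//; lra].
set t := K^-1 in e1 t01 *; have /andP[t0 t1] := t01.
set l := ell k.+2; have l0 : 0 < l by exact: ell_gt0.
have lK : l <= M1 * t by exact: ell_le.
have lev1 : level a k.+2 * ((1 - l) * (1 - t) ^+ 2) <= level a k.+1.
  have [l1|l1] := leP 1 l.
    apply: (@le_trans _ _ 0); last exact: level_ge0.
    by rewrite mulr_ge0_le0 ?level_ge0// mulr_le0_ge0 ?sqr_ge0//; lra.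
  rewrite /level (partial_lengthS k.+1) -/l e1 expRD -/K.
  rewrite powRM; [|lra|lra].
  set E := expR _; set Y := K `^ _.
  have El : expR l * (1 - l) <= 1.
    have h : 1 - l <= expR (- l) by have := expR_ge1Dx (- l).
    apply: le_trans (ler_wpM2l (expR_ge0 l) h) _.
    by rewrite expRN mulfV// gt_eqF// expR_gt0.
  have Z : (1 - t) ^+ 2 <= (1 - t) `^ (2 * a).
    rewrite -powR_mulrn; last lra.
    by apply: ger_powR; lra.
  rewrite [leLHS](_ : _ = E * Y * ((expR l * (1 - l)) * (1 - t) ^+ 2)); last by ring.
  rewrite [leRHS](_ : _ = E * Y * (1 * (1 - t) `^ (2 * a))); last by ring.
  apply: ler_wpM2l; first by rewrite mulr_ge0 ?expR_ge0 ?powR_ge0.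
  apply: ler_pM => //; last exact: sqr_ge0.
  by rewrite mulr_ge0 ?expR_ge0//; lra.
have L0 := level_ge0 a k.+2.
rewrite -mulrA -/K -/t.
move: (level a k.+2) (level a k.+1) L0 lev1 => x y x0 h.
have h2 : x * (l + 2 * t) <= (M1 + 2) * (x * t) by nra.
apply: le_trans h2.
have h3 : x * (1 - (1 - l) * (1 - t) ^+ 2) <= x * (l + 2 * t).
  apply: ler_wpM2l => //; rewrite -subr_ge0.
  rewrite (_ : _ - _ = t ^+ 2 + l * t * (2 - t)); last by ring.
  by rewrite addr_ge0 ?sqr_ge0// mulr_ge0 ?mulr_ge0 ?(ltW l0)//; lra.
apply: le_trans h3; rewrite mulrBr mulr1; lra.
Qed.

(** The index [K] with [K^-2] comparable to the grid distance [(d + 1) / q]; thus [d = 0] stands for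
    neighbours. *)
Definition gridK q d : nat := Num.truncn (Num.sqrt (d.+1%:R / q%:R : R))^-1.

Lemma gridK_le q d k : (0 < q)%N -> (1 <= k)%N -> (k <= gridK q d)%N ->
  d.+1%:R <= q%:R / k%:R ^+ 2 :> R.
Proof.
move=> q0 k1 kK; have q1 : 0 < q%:R :> R by rewrite ltr0n.
have k0 : 0 < k%:R :> R by rewrite ltr0n.
set tau : R := d.+1%:R / q%:R.
have t0 : 0 < tau by rewrite divr_gt0.
have s0 : 0 < Num.sqrt tau by rewrite sqrtr_gt0.
have : k%:R <= (Num.sqrt tau)^-1.
  have x0 : 0 <= (Num.sqrt tau)^-1 by rewrite invr_ge0 ltW.
  by have /andP[h _] := truncn_itv x0; apply: le_trans h; rewrite ler_nat.
rewrite -[leLHS]invrK lef_pV2 ?posrE ?invr_gt0// => h.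
have : tau <= (k%:R ^+ 2)^-1.
  rewrite -[leLHS]sqr_sqrtr ?(ltW t0)// -exprVn.
  by apply: lerXn2r => //; rewrite nnegrE ?invr_ge0; exact: ltW.
by rewrite /tau ler_pdivrMr// mulrC.
Qed.

Lemma gridK_bounds q d : (0 < q)%N -> (d < q)%N -> (1 <= gridK q d <= q)%N /\
  ((gridK q d)%:R * Num.sqrt (d.+1%:R / q%:R : R))^-1 <= 2.
Proof.
move=> q0 dq; have q1 : 0 < q%:R :> R by rewrite ltr0n.
set tau : R := d.+1%:R / q%:R.
have t0 : 0 < tau by rewrite divr_gt0.
have t1 : tau <= 1 by rewrite ler_pdivrMr// mul1r ler_nat.
have s0 : 0 < Num.sqrt tau by rewrite sqrtr_gt0.
have s1 : Num.sqrt tau <= 1 by rewrite -[leRHS](@sqrtr1 R) ler_wsqrtr.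
have x1 : 1 <= (Num.sqrt tau)^-1 by rewrite invf_ge1.
have K1 : (1 <= gridK q d)%N by rewrite truncn_gt0.
have K1' : 1 <= (gridK q d)%:R :> R by rewrite ler1n.
split.
  rewrite K1/=; have := gridK_le q0 K1 (leqnn (gridK q d)).
  have K0 : 0 < (gridK q d)%:R :> R by rewrite ltr0n.
  rewrite ler_pdivlMr ?exprn_gt0// => h; rewrite -(ler_nat R).
  have d1 : 1 <= d.+1%:R :> R by rewrite ler1n.
  apply: le_trans h; move: (gridK q d)%:R K1' => y y1.
  by apply: (@le_trans _ _ (1 * y ^+ 2)); [nra|rewrite ler_wpM2r// sqr_ge0].
rewrite -[leRHS]invrK lef_pV2 ?posrE ?mulr_gt0 ?invr_gt0//; last by rewrite ltr0n.
have /andP[_ h] := truncn_itv (ltW (lt_le_trans ltr01 x1)).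
move: h; rewrite -/(gridK q d) -natr1 => h.
rewrite -ler_pdivrMr//; move: ((Num.sqrt tau)^-1) h => y h; lra.
Qed.

(** Abel summation together with a count: the [d < T] with [gridK q d >= k] number at most [T] and
    at most [q / k^2]. *)
Lemma level_grid_sum a q T : 0 <= a <= 1 -> (0 < q)%N -> (T <= q)%N ->
  q%:R^-1 * \sum_(0 <= d < T) level a (gridK q d) <=
    \sum_(1 <= k < q.+1) (level a k - level a k.-1) * Num.min (T%:R / q%:R) (k%:R ^+ 2)^-1.
Proof.
move=> a01 q0 Tq; have q1 : 0 < q%:R :> R by rewrite ltr0n.
have /andP[a0 a1] := a01.
pose y k : R := Num.min T%:R (q%:R / k%:R ^+ 2).
have := @sum_levels R (level a) (gridK q) T q y erefl (fun k => level_mono k a0) _ _ => h.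
rewrite mulrC ler_pdivrMr//; apply: le_trans (h _ _) _.
- by move=> d' dT; have [/andP[]] := gridK_bounds q0 (leq_trans dT Tq).
- move=> k /andP[k1 _]; have k0 : 0 < k%:R :> R by rewrite ltr0n.
  rewrite /y le_min; apply/andP; split.
    apply: (@le_trans _ _ (\sum_(0 <= d < T) 1)).
      by apply: ler_sum => d' _; case: ifP.
    by rewrite sumr_const_nat subn0.
  apply: le_trans (count_le T (_ : 0 <= q%:R / k%:R ^+ 2)); last first.
    by rewrite divr_ge0// exprn_ge0.
  apply: ler_sum => d' _; case: ifPn => [kK|_]; last by case: ifP.
  by rewrite gridK_le.
rewrite mulr_suml big_nat [leRHS]big_nat; apply: ler_sum => k /andP[k1 _].
rewrite -mulrA; apply: ler_wpM2l.
  by case: k k1 => // k _; rewrite subr_ge0 level_mono.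
rewrite /y minr_pMl ?(ltW q1)// mulfVK ?gt_eqF// (mulrC q%:R)//.
Qed.

Variables (a W : R).
Hypothesis a01 : 0 <= a < 1.
Hypothesis series_le : forall n, \sum_(1 <= k < n.+1) level a k / k%:R ^+ 3 <= W.

Let a01' : 0 <= a <= 1.
Proof. by have /andP[-> /ltW ->] := a01. Qed.

Lemma level_step_series n m : (1 <= m)%N ->
  \sum_(m <= k < n.+1) (level a k - level a k.-1) * (k%:R ^+ 2)^-1 <=
    (M1 + 2) * \sum_(m <= k < n.+1) level a k / k%:R ^+ 3.
Proof.
move=> m1; rewrite mulr_sumr big_nat [leRHS]big_nat; apply: ler_sum => k /andP[mk _].
have k1 : (1 <= k)%N by exact: leq_trans mk.
have k0 : 0 < k%:R :> R by rewrite ltr0n.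
apply: le_trans (ler_wpM2r _ (level_step a01' k1)) _.
  by rewrite invr_ge0 sqr_ge0.
rewrite [leRHS](_ : _ = (M1 + 2) * level a k / k%:R * (k%:R ^+ 2)^-1)//.
by field; rewrite gt_eqF.
Qed.

Lemma level_grid_total q : (0 < q)%N ->
  q%:R^-1 * \sum_(0 <= d < q) level a (gridK q d) <= (M1 + 2) * W.
Proof.
move=> q0; apply: le_trans (level_grid_sum a01' q0 (leqnn q)) _.
have m1 := M1_gt0 ell_gt0 ell_le.
apply: le_trans (_ : (M1 + 2) * \sum_(1 <= k < q.+1) level a k / k%:R ^+ 3 <= _); last first.
  by apply: ler_wpM2l (series_le q); lra.
apply: le_trans (level_step_series q (leqnn 1)).
rewrite big_nat [leRHS]big_nat; apply: ler_sum => k /andP[k1 _].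
apply: ler_wpM2l; last by rewrite ge_min lexx orbT.
by case: k k1 => // k _; rewrite subr_ge0 level_mono//; case/andP: a01.
Qed.

(** Uniformly in [q], pairs closer than [eta] contribute little. Indices beyond [k0] are controlled
    by the tail of the convergent series, the others by [level a k0 * eta]. *)
Lemma level_grid_small e : 0 < e -> exists2 eta : R, 0 < eta <= 1 &
  forall q T, (0 < q)%N -> (T <= q)%N -> T%:R <= eta * q%:R ->
    q%:R^-1 * \sum_(0 <= d < T) level a (gridK q d) <= e.
Proof.
move=> e0; have m1 := M1_gt0 ell_gt0 ell_le.
have c0 : 0 < M1 + 2 by lra.
pose S n := \sum_(1 <= k < n.+1) level a k / k%:R ^+ 3.
have term0 k : 0 <= level a k / k%:R ^+ 3 by rewrite divr_ge0 ?level_ge0 ?exprn_ge0.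
pose E := [set S n | n in [set: nat]].
have E0 : E !=set0 by exists (S 0%N), 0%N.
have ubE : has_ubound E by exists W => _ [n _ <-]; exact: series_le.
have e2 : 0 < e / (2 * (M1 + 2)) by rewrite divr_gt0// mulr_gt0.
have [_ [k0 _ <-] hk0] := sup_adherent e2 (conj E0 ubE).
have tail n : \sum_(k0.+1 <= k < n.+1) level a k / k%:R ^+ 3 <= e / (2 * (M1 + 2)).
  have [nk|kn] := ltnP n k0.+1; first by rewrite big_geq// ltW.
  have : S n <= sup E by apply: ub_le_sup => //; exists n.
  rewrite {1}/S (@big_cat_nat _ _ _ k0.+1)//=; last by rewrite ltnS ltnW.
  by rewrite -/(S k0); lra.
have L0 := level_ge0 a k0.
pose eta := Num.min 1 (e / (2 * (level a k0 + 1))).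
have eta0 : 0 < eta by rewrite /eta lt_min ltr01 divr_gt0// mulr_gt0//; lra.
exists eta; first by rewrite eta0/= /eta ge_min lexx.
move=> q T q0 Tq Teta; apply: le_trans (level_grid_sum a01' q0 Tq) _.
have q1 : 0 < q%:R :> R by rewrite ltr0n.
have Te : T%:R / q%:R <= eta by rewrite ler_pdivrMr.
have diff0 k : (1 <= k)%N -> 0 <= level a k - level a k.-1.
  by case: k => // k _; rewrite subr_ge0 level_mono//; case/andP: a01.
have /andP[a0 _] := a01.
pose x k := level a k - level a k.-1.
apply: (@le_trans _ _ (\sum_(1 <= k < k0.+1) x k * eta +
    \sum_(k0.+1 <= k < q.+1) x k * (k%:R ^+ 2)^-1)).
  have [qk|kq] := leqP q k0.
    rewrite [X in _ <= _ + X]big_geq ?ltnS// addr0.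
    rewrite [leRHS](@big_cat_nat _ _ _ q.+1)//=.
    rewrite ler_wpDr//; last first.
      rewrite big_nat [leRHS]big_nat; apply: ler_sum => k /andP[k1 _].
      by apply: ler_wpM2l; [exact: diff0|rewrite ge_min Te].
    rewrite big_nat_cond sumr_ge0// => k /andP[/andP[k1 _] _].
    by rewrite mulr_ge0 ?(ltW eta0)// diff0// (leq_trans _ k1).
  rewrite (@big_cat_nat _ _ _ k0.+1)//=; last by rewrite ltnS ltnW.
  rewrite lerD//.
    rewrite big_nat [leRHS]big_nat; apply: ler_sum => k /andP[k1 _].
    by apply: ler_wpM2l; [exact: diff0|rewrite ge_min Te].
  rewrite big_nat [leRHS]big_nat; apply: ler_sum => k /andP[k1 _].
  apply: ler_wpM2l; last by rewrite ge_min lexx orbT.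
  by apply: diff0; exact: leq_trans k1.
have h1 : \sum_(1 <= k < k0.+1) x k * eta <= e / 2.
  rewrite -mulr_suml /x big_add1/= (@telescope_sumr_eq _ 0 k0 (level a))//= subr0.
  apply: (@le_trans _ _ (level a k0 * (e / (2 * (level a k0 + 1))))).
    by apply: ler_wpM2l => //; rewrite /eta ge_min lexx orbT.
  rewrite mulrA ler_pdivrMr; nra.
have h2 : \sum_(k0.+1 <= k < q.+1) x k * (k%:R ^+ 2)^-1 <= e / 2.
  apply: le_trans (level_step_series q (ltn0Sn k0)) _.
  apply: le_trans (ler_wpM2l (ltW c0) (tail q)) _.
  by rewrite [leLHS](_ : _ = e / 2)//; field; rewrite gt_eqF.
lra.
Qed.

End EnergyBounds.

(** * Second moments of mass and energy *)

Section SecondMoment.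
Context disp (Omega : measurableType disp) (R : realType) (P : probability Omega R).
Local Notation pr := (pr P).
Variables (F : nat -> set (set Omega)) (D : nat -> R -> Omega -> R) (C : R).
Hypothesis dm : distance_model P F D C.
Variables (ell : nat -> R) (M1 : R).
Hypothesis ell_gt0 : forall n, (1 <= n)%N -> 0 < ell n.
Hypothesis ell_le : forall n, (1 <= n)%N -> ell n <= M1 / n%:R.
Implicit Types (N n k q i j : nat).

Local Notation alive := (alive D ell).
Local Notation alive_prob := (alive_prob ell).

Lemma ler_sum_rows q (f : nat -> R) c : (forall i, (i < q)%N -> f i <= c) ->
  \sum_(0 <= i < q) f i <= q%:R * c.
Proof.
move=> h; rewrite mulr_natl -[in leRHS](subn0 q) -sumr_const_nat.
by rewrite big_nat [leRHS]big_nat; apply: ler_sum => i /andP[_]; exact: h.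
Qed.

Definition pair_prob N n q i j :=
  pr (alive N n (i%:R / q%:R) `&` alive N n (j%:R / q%:R)).

Lemma pair_probC N n q i j : pair_prob N n q i j = pair_prob N n q j i.
Proof. by rewrite /pair_prob setIC. Qed.

Lemma gapC i j : gap i j = gap j i.
Proof. by rewrite /gap addnC. Qed.

Lemma gap_prednK i j : (gap i j).-1.+1 = gap i j.
Proof. by rewrite prednK// /gap leq_maxl. Qed.

Lemma grid_times q i j : (i < j)%N -> (j < q)%N ->
  [/\ 0 <= (i%:R / q%:R : R) < j%:R / q%:R, j%:R / q%:R - i%:R / q%:R <= 1 :> R &
      j%:R / q%:R - i%:R / q%:R = (gap i j)%:R / q%:R :> R].
Proof.
move=> ij jq; have q1 : 0 < q%:R :> R by rewrite ltr0n (leq_ltn_trans _ jq).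
have e : j%:R / q%:R - i%:R / q%:R = (gap i j)%:R / q%:R :> R.
  rewrite -mulrBl -natrB ?(ltnW ij)// (_ : gap i j = j - i)%N// /gap.
  by move: ij; clear; lia.
split=> //; first by rewrite divr_ge0//= ltr_pM2r ?invr_gt0// ltr_nat.
rewrite e ler_pdivrMr// mul1r ler_nat; apply: gap_le => //.
exact: ltn_trans jq.
Qed.

Definition near_const : R := expR (4 * M1 ^+ 2 + 2 * C * M1 ^+ 2).

Lemma pair_prob_near N n q i j : (1 <= N)%N ->
  (forall k, (N <= k)%N -> ell k <= 1 / 2) -> (i < q)%N -> (j < q)%N -> i != j ->
  pair_prob N n q i j <= alive_prob N n ^+ 2 *
    (near_const * expR (partial_length ell (gridK R q (gap i j).-1))).
Proof.
move=> N1 l12; wlog ij : i j / (i < j)%N.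
  move=> H iq jq; rewrite neq_ltn => /orP[ij|ji].
    by apply: H => //; rewrite ltn_eqF.
  by rewrite pair_probC gapC; apply: H => //; rewrite ltn_eqF.
move=> iq jq _; have [st ts e] := grid_times ij jq.
have q0 : (0 < q)%N by exact: leq_ltn_trans jq.
have gq : ((gap i j).-1 < q)%N by rewrite gap_prednK gap_le.
have [/andP[K1 _] K2] := gridK_bounds R q0 gq.
move: K1 K2; set K := gridK R q _ => K1 K2.
have C0 := exit_const_ge0 dm.
apply: le_trans (alive_pair dm ell_gt0 K n N1 st ts l12) _.
apply: ler_wpM2l; first exact: sqr_ge0.
rewrite /near_const -expRD ler_expR.
have /andP[_ slt] := st.
apply: le_trans (pair_exponent_near dm ell_gt0 ell_le n K1 N1 slt) _.
have CM0 : 0 <= C * M1 ^+ 2 by apply: mulr_ge0 => //; exact: sqr_ge0.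
have := ler_wpM2l CM0 K2; rewrite e gap_prednK.
move: (_^-1) (C * M1 ^+ 2) (M1 ^+ 2) (partial_length ell K) CM0 => x y z t _.
by lra.
Qed.

Lemma pair_prob_far N n q i j (eta : R) : (2 <= N)%N ->
  (forall k, (N <= k)%N -> ell k <= 1 / 2) -> (i < q)%N -> (j < q)%N -> i != j ->
  0 < eta -> eta * q%:R <= (gap i j)%:R ->
  pair_prob N n q i j <= alive_prob N n ^+ 2 *
    expR (C * M1 ^+ 2 / (N.-1%:R * Num.sqrt eta)).
Proof.
move=> N2 l12; wlog ij : i j / (i < j)%N.
  move=> H iq jq; rewrite neq_ltn => /orP[ij|ji] e0 eg.
    by apply: H => //; rewrite ltn_eqF.
  by rewrite pair_probC; apply: H; rewrite // 1?gapC// ltn_eqF.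
move=> iq jq _ e0 eg; have [st ts e] := grid_times ij jq.
have q0 : 0 < q%:R :> R by rewrite ltr0n (leq_ltn_trans _ jq).
have C0 := exit_const_ge0 dm.
have N1 : (1 <= N)%N by exact: ltnW.
apply: le_trans (alive_pair dm ell_gt0 N.-1 n N1 st ts l12) _.
apply: ler_wpM2l; first exact: sqr_ge0.
have /andP[_ slt] := st; rewrite ler_expR.
have KN : (1 <= N.-1 < N)%N by move: N2; clear; lia.
apply: le_trans (pair_exponent_far dm ell_gt0 ell_le n KN slt) _.
have CM0 : 0 <= C * M1 ^+ 2 by apply: mulr_ge0 => //; exact: sqr_ge0.
apply: ler_wpM2l => //.
have N10 : 0 < N.-1%:R :> R by rewrite ltr0n; case/andP: KN.
have eq : eta <= j%:R / q%:R - i%:R / q%:R by rewrite e ler_pdivlMr.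
rewrite lef_pV2 ?posrE ?mulr_gt0 ?sqrtr_gt0//; last exact: lt_le_trans eq.
by apply: ler_wpM2l; [exact: ltW|exact: ler_wsqrtr].
Qed.

Variables (a W : R).
Hypothesis a01 : 0 <= a < 1.
Hypothesis series_le : forall n, \sum_(1 <= k < n.+1) level ell a k / k%:R ^+ 3 <= W.

Lemma level0_le k : level ell 0 k <= level ell a k.
Proof.
case: k => // k; rewrite /level mulr0 powRr0 ler_wpM2l ?expR_ge0//.
have /andP[a0 _] := a01.
by rewrite -[leLHS](powRr0 (k.+1%:R : R)) ler_powR ?ler1n ?mulr_ge0.
Qed.

Lemma pair_prob_diag N n q i : (1 <= N)%N -> (forall k, (N <= k)%N -> ell k <= 1 / 2) ->
  pair_prob N n q i i = alive_prob N n.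
Proof. by move=> N1 l12; rewrite /pair_prob setIid (alive_pr dm)// divr_ge0. Qed.

(** On the diagonal the pair probability is [alive_prob] instead of being of the order of its
    square. This gives the first term, which vanishes as [q] grows because [a < 1]. *)
Lemma energy_mean N n q : (1 <= N)%N -> (forall k, (N <= k)%N -> ell k <= 1 / 2) ->
  (0 < q)%N ->
  (q%:R * alive_prob N n) ^- 2 *
    \sum_(0 <= i < q) \sum_(0 <= j < q) pair_prob N n q i j * kernel a ((gap i j)%:R / q%:R)
  <= kernel a (q%:R^-1) / (q%:R * alive_prob N n) + 2 * near_const * ((M1 + 2) * W).
Proof.
move=> N1 l12 q0; have u0 := alive_prob_gt0 n l12; set u := alive_prob N n in u0 *.
have q1 : 0 < q%:R :> R by rewrite ltr0n.
pose G k : R := level ell a (gridK R q k.-1).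
have G0 k : 0 <= G k by exact: level_ge0.
have row i : (i < q)%N -> \sum_(0 <= j < q) pair_prob N n q i j * kernel a ((gap i j)%:R / q%:R)
    <= u * kernel a (q%:R^-1) + u ^+ 2 * near_const * (2 * \sum_(0 <= d < q) G d.+1).
  move=> iq; rewrite (bigD1_seq i)/= ?mem_index_iota ?iota_uniq//.
  rewrite pair_prob_diag// /gap subnn maxn0 mul1r lerD2l.
  apply: (@le_trans _ _ (\sum_(0 <= j < q | j != i) u ^+ 2 * near_const * G (gap i j))).
    rewrite big_nat_cond [leRHS]big_nat_cond; apply: ler_sum => j /andP[/andP[_ jq] ji].
    have ij : i != j by rewrite eq_sym.
    have k0 : 0 <= kernel a ((gap i j)%:R / q%:R : R) by exact: powR_ge0.
    apply: le_trans (ler_wpM2r k0 (pair_prob_near n N1 l12 iq jq ij)) _.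
    rewrite -/u /G; set K := gridK R q (gap i j).-1.
    have -> : level ell a K = expR (partial_length ell K) * kernel a ((gap i j)%:R / q%:R).
      rewrite /kernel -[in RHS](gap_prednK i j) -/(gridK R q (gap i j).-1) -/K.
      have gq : ((gap i j).-1 < q)%N by rewrite gap_prednK gap_le.
      have [/andP[K1 _] _] := gridK_bounds R q0 gq.
      by move: K1; rewrite -/K; case: K.
    by rewrite !mulrA.
  rewrite -mulr_sumr; apply: ler_wpM2l; last exact: sum_gap_le.
  by rewrite mulr_ge0 ?sqr_ge0 ?expR_ge0.
apply: (@le_trans _ _ ((q%:R * u) ^- 2 * (q%:R * (u * kernel a (q%:R^-1) +
    u ^+ 2 * near_const * (2 * \sum_(0 <= d < q) G d.+1))))).
  apply: ler_wpM2l; first by rewrite invr_ge0 sqr_ge0.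
  exact: ler_sum_rows.
rewrite [leLHS](_ : _ = kernel a (q%:R^-1) / (q%:R * u) +
    2 * near_const * (q%:R^-1 * \sum_(0 <= d < q) G d.+1)); last first.
  by field; rewrite !gt_eqF.
rewrite lerD2l; apply: ler_wpM2l; first by rewrite mulr_ge0// expR_ge0.
exact: (level_grid_total ell_gt0 ell_le a01 series_le q0).
Qed.

(** Three contributions, each with an error of [delta / 3]: the diagonal, which is [1 / (q u)];
    pairs with gap at most [T], whose total weight is small; and the remaining pairs, whose
    correlation bound tends to 1 as [N] grows. The threshold [N0] is chosen before [n], and [q0]
    after it. *)
Lemma second_moment (delta : R) : 0 < delta -> exists N0, forall N n,
  (N0 <= N)%N -> (forall k, (N <= k)%N -> ell k <= 1 / 2) ->
  exists q0, forall q, (q0 <= q)%N ->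
    (q%:R * alive_prob N n) ^- 2 *
      \sum_(0 <= i < q) \sum_(0 <= j < q) pair_prob N n q i j <= 1 + delta.
Proof.
move=> d0; have C0 := exit_const_ge0 dm; have /andP[a0 a1] := a01.
have CM0 : 0 <= C * M1 ^+ 2 by apply: mulr_ge0 => //; exact: sqr_ge0.
have A0 : 0 < near_const by exact: expR_gt0.
have e0 : 0 < delta / (6 * near_const) by rewrite divr_gt0// mulr_gt0.
have z01 : 0 <= (0 : R) < 1 by rewrite lexx ltr01.
have series0 n : \sum_(1 <= k < n.+1) level ell 0 k / k%:R ^+ 3 <= W.
  apply: le_trans (series_le n); apply: ler_sum => k _.
  by rewrite ler_wpM2r ?level0_le// invr_ge0 exprn_ge0.
have [eta /andP[eta0 eta1] heta] := level_grid_small ell_gt0 ell_le z01 series0 e0.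
pose X N : R := expR (C * M1 ^+ 2 / (N.-1%:R * Num.sqrt eta)).
have ln0 : 0 < ln (1 + delta / 3) by apply: ln_gt0; lra.
have se0 : 0 < Num.sqrt eta by rewrite sqrtr_gt0.
(* This makes [C M1^2 / ((N - 1) sqrt eta)] at most [ln (1 + delta / 3)]; the shift absorbs the
   truncation and the predecessor. *)
exists (Num.truncn (C * M1 ^+ 2 / (Num.sqrt eta * ln (1 + delta / 3)))).+3 => N n N0 l12.
have N2 : (2 <= N)%N by apply: leq_trans N0.
have N1 : (1 <= N)%N by exact: ltnW.
have u0 := alive_prob_gt0 n l12; set u := alive_prob N n in u0 *.
have XN : X N <= 1 + delta / 3.
  rewrite -[leRHS]lnK ?posrE; last lra.
  rewrite ler_expR.
  have h : C * M1 ^+ 2 / (Num.sqrt eta * ln (1 + delta / 3)) <= N.-1%:R.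
    apply: le_trans (ltW (truncnS_gt _)) _; rewrite ler_nat.
    by move: N0; case: (N) => // m; rewrite ltnS => /ltnW.
  have p0 : 0 < N.-1%:R :> R by rewrite ltr0n; case: (N) N2 => // -[].
  move: h; rewrite ler_pdivrMr ?mulr_gt0// => h.
  rewrite ler_pdivrMr ?mulr_gt0//; apply: (le_trans h).
  by rewrite le_eqVlt; apply/orP; left; apply/eqP; ring.
exists (maxn 1 (Num.truncn (3 / (delta * u))).+1) => q; rewrite geq_max => /andP[q0 hq].
have q1 : 0 < q%:R :> R by rewrite ltr0n.
have qu : (q%:R * u)^-1 <= delta / 3.
  have : 3 / (delta * u) <= q%:R by apply: le_trans (ltW (truncnS_gt _)) _; rewrite ler_nat.
  rewrite ler_pdivrMr ?mulr_gt0// => h.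
  by rewrite -[leRHS]invf_div lef_pV2 ?posrE ?divr_gt0 ?mulr_gt0// ler_pdivrMr//; nra.
pose T := Num.truncn (eta * q%:R).
have etaq : 0 <= eta * q%:R by rewrite mulr_ge0 ?ltW.
have /andP[T1 T2] := truncn_itv etaq.
have Tq : (T <= q)%N.
  by rewrite -(ler_nat R); apply: le_trans T1 _; rewrite ler_piMl// ltW.
pose G k : R := if (k <= T)%N then level ell 0 (gridK R q k.-1) else 0.
have G0 k : 0 <= G k by rewrite /G; case: ifP => // _; exact: level_ge0.
have row i : (i < q)%N -> \sum_(0 <= j < q) pair_prob N n q i j
    <= u + u ^+ 2 * (near_const * (2 * \sum_(0 <= d < q) G d.+1) + q%:R * X N).
  move=> iq; rewrite (bigD1_seq i)/= ?mem_index_iota ?iota_uniq//.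
  rewrite pair_prob_diag// lerD2l.
  apply: (@le_trans _ _ (\sum_(0 <= j < q | j != i) u ^+ 2 * (near_const * G (gap i j) + X N))).
    rewrite big_nat_cond [leRHS]big_nat_cond; apply: ler_sum => j /andP[/andP[_ jq] ji].
    have ij : i != j by rewrite eq_sym.
    rewrite /G; case: ifPn => gT.
      apply: le_trans (pair_prob_near n N1 l12 iq jq ij) _.
      apply: ler_wpM2l; first exact: sqr_ge0.
      apply: (@le_trans _ _ (near_const * level ell 0 (gridK R q (gap i j).-1))).
        have gq : ((gap i j).-1 < q)%N by rewrite gap_prednK gap_le.
        have [/andP[K1 _] _] := gridK_bounds R q0 gq.
        by move: K1; case: (gridK R q _) => // K _; rewrite /level mulr0 powRr0 mulr1.
      by rewrite lerDl expR_ge0.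
    rewrite mulr0 add0r; apply: (pair_prob_far n N2 l12 iq jq ij eta0).
    apply: (le_trans (ltW T2)); rewrite ler_nat.
    by rewrite ltnNge.
  rewrite -mulr_sumr big_split/= -mulr_sumr; apply: ler_wpM2l; first exact: sqr_ge0.
  apply: lerD; first by apply: ler_wpM2l; [exact: ltW|exact: sum_gap_le].
  rewrite big_mkcond/=; apply: (@le_trans _ _ (\sum_(0 <= j < q) X N)).
    by apply: ler_sum => j _; case: ifP => // _; exact: expR_ge0.
  by rewrite sumr_const_nat subn0 mulr_natl.
have sumG : \sum_(0 <= d < q) G d.+1 = \sum_(0 <= d < T) level ell 0 (gridK R q d).
  rewrite (@big_cat_nat _ _ _ T)//= [X in _ + X]big_nat_cond [X in _ + X]big1 ?addr0.
    by apply: eq_big_nat => k /andP[_ kT]; rewrite /G kT.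
  by move=> k /andP[/andP[Tk _] _]; rewrite /G ltnNge Tk.
have hG := heta q T q0 Tq T1; rewrite -sumG in hG.
apply: (@le_trans _ _ ((q%:R * u) ^- 2 * (q%:R * (u +
    u ^+ 2 * (near_const * (2 * \sum_(0 <= d < q) G d.+1) + q%:R * X N))))).
  apply: ler_wpM2l; first by rewrite invr_ge0 sqr_ge0.
  exact: ler_sum_rows.
rewrite [leLHS](_ : _ = (q%:R * u)^-1 +
    2 * near_const * (q%:R^-1 * \sum_(0 <= d < q) G d.+1) + X N); last first.
  by field; rewrite !gt_eqF.
have : 2 * near_const * (q%:R^-1 * \sum_(0 <= d < q) G d.+1) <= delta / 3.
  have p : 0 <= 2 * near_const by rewrite mulr_ge0// ltW.
  apply: le_trans (ler_wpM2l p hG) _.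
  by rewrite [leLHS](_ : _ = delta / 3)//; field; rewrite gt_eqF.
lra.
Qed.

End SecondMoment.

(** * Events of large mass and bounded energy *)

Section GoodEvents.
Context disp (Omega : measurableType disp) (R : realType) (P : probability Omega R).
Local Notation pr := (pr P).
Variables (F : nat -> set (set Omega)) (D : nat -> R -> Omega -> R) (C : R).
Hypothesis dm : distance_model P F D C.
Variables (ell : nat -> R) (M1 : R).
Hypothesis ell_gt0 : forall n, (1 <= n)%N -> 0 < ell n.
Hypothesis ell_le : forall n, (1 <= n)%N -> ell n <= M1 / n%:R.
Implicit Types (N n k q i j : nat).

Local Notation alive := (alive D ell).
Local Notation alive_prob := (alive_prob ell).
Local Notation alive_set := (alive_set D ell).
Local Notation pair_prob := (pair_prob P D ell).
Local Notation good := (good D ell).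

Lemma measurable_alive_set N n q (Q : {set 'I_q} -> Prop) : (1 <= N)%N ->
  measurable [set w | Q (alive_set N n q w)].
Proof.
move=> N1.
rewrite (_ : [set w | _] = \bigcup_(S in Q) [set w | alive_set N n q w = S]); last first.
  by apply/seteqP; split=> w /=; [move=> h; exists (alive_set N n q w)|case=> S QS /= ->].
apply: (sigma_bigcup (@sigma_algebra_measurable _ _)) => S _.
rewrite (_ : [set w | _] = \bigcap_(i in [set: 'I_q])
    (if i \in S then alive N n (i%:R / q%:R) else ~` alive N n (i%:R / q%:R))); last first.
  apply/seteqP; split=> w /=.
    by move=> <- i _; rewrite inE; case: asboolP.
  move=> h; apply/setP => i; rewrite inE; have := h i I.
  by case: ifP => _ hi; [apply/asboolP|apply/asboolPn].
apply: (sigma_bigcap (@sigma_algebra_measurable _ _)) => i _.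
have m := measurable_alive dm ell n (i%:R / q%:R) N1.
by case: ifP => _ //; exact: measurableC.
Qed.

Lemma mem_alive_set N n q w (i : 'I_q) :
  (i \in alive_set N n q w)%:R = \1_(alive N n (i%:R / q%:R)) w :> R.
Proof. by rewrite indicE inE. Qed.

Lemma card_alive_set N n q w :
  #|alive_set N n q w|%:R = \sum_(i < q) (\1_(alive N n (i%:R / q%:R)) w : R).
Proof.
rewrite -sum1_card natr_sum big_mkcond/=; apply: eq_bigr => i _.
by rewrite -mem_alive_set; case: (i \in _).
Qed.

Lemma energy_alive_set N n q w (kappa : nat -> nat -> R) :
  \sum_(i in alive_set N n q w) \sum_(j in alive_set N n q w) kappa i j =
  \sum_(p : 'I_q * 'I_q) kappa p.1 p.2 *
     \1_(alive N n (p.1%:R / q%:R) `&` alive N n (p.2%:R / q%:R)) w.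
Proof.
rewrite -(pair_bigA _ (fun i j : 'I_q => kappa i j *
  \1_(alive N n (i%:R / q%:R) `&` alive N n (j%:R / q%:R)) w))/= big_mkcond/=.
apply: eq_bigr => i _; case: ifP => iS.
  rewrite big_mkcond/=; apply: eq_bigr => j _.
  rewrite indicI /= -!mem_alive_set iS mul1r; case: ifP => _; by rewrite ?mulr1 ?mulr0.
by rewrite big1// => j _; rewrite indicI /= -!mem_alive_set iS mul0r mulr0.
Qed.

Lemma sum_pair_prob N n q (kappa : nat -> nat -> R) :
  \sum_(p : 'I_q * 'I_q) kappa p.1 p.2 *
     pr (alive N n (p.1%:R / q%:R) `&` alive N n (p.2%:R / q%:R)) =
  \sum_(0 <= i < q) \sum_(0 <= j < q) pair_prob N n q i j * kappa i j.
Proof.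
rewrite -(pair_bigA _ (fun i j : 'I_q => kappa i j *
  pr (alive N n (i%:R / q%:R) `&` alive N n (j%:R / q%:R))))/= big_mkord.
apply: eq_bigr => i _; rewrite big_mkord; apply: eq_bigr => j _.
by rewrite mulrC.
Qed.

Lemma measurable_alive_pair N n q (p : 'I_q * 'I_q) : (1 <= N)%N ->
  measurable (alive N n (p.1%:R / q%:R) `&` alive N n (p.2%:R / q%:R)).
Proof. by move=> N1; apply: measurableI; exact: (measurable_alive dm). Qed.

Lemma energy_markov N n q (mu M : R) (kappa : nat -> nat -> R) : (1 <= N)%N -> 0 < M ->
  (forall i j, 0 <= kappa i j) ->
  pr [set w | M < mu ^+ 2 * \sum_(i in alive_set N n q w) \sum_(j in alive_set N n q w) kappa i j]
  <= mu ^+ 2 * \sum_(0 <= i < q) \sum_(0 <= j < q) pair_prob N n q i j * kappa i j / M.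
Proof.
move=> N1 M0 k0.
pose T (S : {set 'I_q}) := M < mu ^+ 2 * \sum_(i in S) \sum_(j in S) kappa i j.
have mT : measurable [set w | T (alive_set N n q w)] by exact: (@measurable_alive_set N n q T).
have := pr_le_sum P (t := index_enum ('I_q * 'I_q)%type) (c := fun p => mu ^+ 2 * (kappa p.1 p.2 / M)) mT
  (fun p => measurable_alive_pair n p N1).
move=> h; apply: le_trans (h _) _.
  move=> w; under eq_bigr do rewrite -mulrA; rewrite -mulr_sumr.
  rewrite -(energy_alive_set N n q w (fun i j => kappa i j / M)) indicE.
  under eq_bigr do rewrite -mulr_suml; rewrite -mulr_suml.
  have s0 : 0 <= \sum_(i in alive_set N n q w) \sum_(j in alive_set N n q w) kappa i j.
    by do 2 apply: sumr_ge0 => ? _.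
  case: (boolP (w \in _)) => [/set_mem /= hT|_]; rewrite mulrA.
    by rewrite ler_pdivlMr// mul1r ltW.
  by apply: divr_ge0; [apply: mulr_ge0 => //; exact: sqr_ge0|exact: ltW].
under eq_bigr do rewrite -mulrA; rewrite -mulr_sumr.
rewrite (sum_pair_prob N n q (fun i j => kappa i j / M)).
by under eq_bigr do under eq_bigr do rewrite mulrA.
Qed.

(* The indicator of [Z < 1 / 2] is at most [4 * (1 - Z) ^ 2]. *)
Lemma few_alive N n q (mu : R) : (1 <= N)%N ->
  pr [set w | mu * #|alive_set N n q w|%:R < 1 / 2] <=
  4 + 4 * (mu ^+ 2 * \sum_(0 <= i < q) \sum_(0 <= j < q) pair_prob N n q i j)
    - 8 * (mu * \sum_(i < q) pr (alive N n (i%:R / q%:R))).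
Proof.
move=> N1.
(* The constant, the single times and the pairs of times are packed into one index type, matching
   the expansion of [4 * (1 - mu * z)^2]. *)
pose I := ('I_1 + ('I_q + 'I_q * 'I_q))%type.
pose c (x : I) : R := match x with inl _ => 4 | inr (inl _) => - (8 * mu) | inr (inr _) => 4 * mu ^+ 2 end.
pose E (x : I) : set Omega := match x with inl _ => setT | inr (inl i) => alive N n (i%:R / q%:R)
  | inr (inr p) => alive N n (p.1%:R / q%:R) `&` alive N n (p.2%:R / q%:R) end.
have mE x : measurable (E x).
  by case: x => [_|[i|p]] //=; [exact: (measurable_alive dm)|exact: measurable_alive_pair].
have mT : measurable [set w | mu * #|alive_set N n q w|%:R < 1 / 2].
  exact: (@measurable_alive_set N n q (fun S => mu * #|S|%:R < 1 / 2)).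
have := pr_le_sum P (t := index_enum I) (c := c) mT mE => h.
apply: le_trans (h _) _ => [w|].
  rewrite !big_sumType/= big_ord1 /c /E /= indicT mulr1 -!mulr_sumr -card_alive_set.
  set z : R := #|_|%:R.
  have -> : \sum_(p : 'I_q * 'I_q)
      (\1_(alive N n (p.1%:R / q%:R) `&` alive N n (p.2%:R / q%:R)) w : R) = z ^+ 2.
    under eq_bigr => p _ do rewrite -(mul1r (\1_ _ w)).
    rewrite -(energy_alive_set N n q w (fun _ _ => 1)) !sumr_const -/z.
    by rewrite expr2 -[in RHS]/z mulr_natr.
  rewrite indicE.
  case: (boolP (w \in _)) => [/set_mem /= hT|_]; last first.
    rewrite [leRHS](_ : _ = 4 * (1 - mu * z) ^+ 2); last by ring.
    by rewrite mulr_ge0// sqr_ge0.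
  by move: hT; rewrite -/z; nra.
rewrite !big_sumType/= big_ord1 /c /E /= pr_setT mulr1 -!mulr_sumr.
have -> : \sum_(p : 'I_q * 'I_q) pr (alive N n (p.1%:R / q%:R) `&` alive N n (p.2%:R / q%:R)) =
    \sum_(0 <= i < q) \sum_(0 <= j < q) pair_prob N n q i j.
  under eq_bigr => p _ do rewrite -(mul1r (pr _)).
  rewrite (sum_pair_prob N n q (fun _ _ => 1)).
  by under eq_bigr do under eq_bigr do rewrite mulr1.
by rewrite le_eqVlt; apply/orP; left; apply/eqP; ring.
Qed.

Variables (a W : R).
Hypothesis a01 : 0 <= a < 1.
Hypothesis series_le : forall n, \sum_(1 <= k < n.+1) level ell a k / k%:R ^+ 3 <= W.

Lemma kernel_le (q : nat) : (0 < q)%N -> kernel a (q%:R^-1) <= q%:R `^ a :> R.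
Proof.
have /andP[a0 _] := a01; move=> q0; rewrite /kernel powRrM.
apply: ge0_ler_powR; rewrite ?nnegrE ?powR_ge0 ?ler0n//.
rewrite powR_mulrn//; have x0 : 0 <= (Num.sqrt (q%:R^-1))^-1 :> R by rewrite invr_ge0 sqrtr_ge0.
have /andP[h _] := truncn_itv x0.
apply: (@le_trans _ _ (((Num.sqrt (q%:R^-1))^-1) ^+ 2)); first by rewrite lerXn2r ?nnegrE ?ler0n.
by rewrite exprVn sqr_sqrtr ?invrK// invr_ge0.
Qed.

(** The kernel at the smallest distance is at most the power [a] of [q], and [a < 1]. *)
Lemma diagonal_small (u : R) : 0 < u ->
  exists q0 : nat, forall q, (q0 <= q)%N -> kernel a (q%:R^-1) / (q%:R * u) <= 1.
Proof.
move=> u0; have /andP[a0 a1] := a01.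
exists (Num.truncn (u^-1 `^ (1 - a)^-1)).+1 => q hq.
have q0 : (0 < q)%N by exact: leq_trans hq.
have q1 : 0 < q%:R :> R by rewrite ltr0n.
have hq' : u^-1 `^ (1 - a)^-1 <= q%:R by apply: le_trans (ltW (truncnS_gt _)) _; rewrite ler_nat.
have b0 : 0 < 1 - a by lra.
have h : u^-1 <= q%:R `^ (1 - a).
  have := ge0_ler_powR (ltW b0) _ _ hq'; rewrite !nnegrE powR_ge0 ler0n => /(_ isT isT).
  by rewrite -powRrM mulVf ?gt_eqF// powRr1// invr_ge0 ltW.
rewrite ler_pdivrMr ?mulr_gt0// mul1r; apply: le_trans (kernel_le q0) _.
rewrite [X in _ <= X * u](_ : _ = q%:R `^ a * q%:R `^ (1 - a)); last first.
  rewrite -powRD; last by rewrite (gt_eqF q1) implybT.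
  by rewrite (_ : a + (1 - a) = 1) ?powRr1 ?ler0n//; ring.
rewrite -mulrA ler_peMr ?powR_ge0//.
by rewrite -ler_pdivrMr// div1r.
Qed.

Definition energy_bound : R := 1 + 2 * near_const C M1 * ((M1 + 2) * W).

Lemma series_bound_ge0 : 0 <= W.
Proof. by have := series_le 0; rewrite big_geq. Qed.

Lemma energy_bound_gt0 : 0 < energy_bound.
Proof.
have m1 := M1_gt0 ell_gt0 ell_le; have w0 := series_bound_ge0.
have n0 : 0 < near_const C M1 by exact: expR_gt0.
by rewrite /energy_bound ltr_pwDl// !mulr_ge0// ?ltW//; lra.
Qed.

(** With [mu = 1 / (q u)] the total mass has mean 1, and [few_alive] gives
    [4 + 4 (1 + delta) - 8 = 4 delta]. Markov's inequality for the energy gives the other term. *)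
Lemma good_prob (delta M : R) : 0 < delta -> 0 < M -> exists N0, forall N n,
  (N0 <= N)%N -> (1 <= N)%N -> (forall k, (N <= k)%N -> ell k <= 1 / 2) ->
  exists q mu, [/\ (n <= q)%N, 0 <= mu, measurable [set w | good a N n q mu M w] &
    1 - 4 * delta - energy_bound / M <= pr [set w | good a N n q mu M w]].
Proof.
move=> d0 M0; have [N0 hN0] := second_moment dm ell_gt0 ell_le a01 series_le d0.
exists N0 => N n NN N1 l12; have [q1 hq1] := hN0 N n NN l12.
have u0 := alive_prob_gt0 n l12; have [q2 hq2] := diagonal_small u0.
set u := alive_prob N n in u0 hq1 hq2.
pose q := (maxn n (maxn q1 q2)).+1.
have q0 : (0 < q)%N by [].
have nq : (n <= q)%N by rewrite /q leqW// leq_maxl.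
have qq1 : (q1 <= q)%N by rewrite /q leqW// leq_max leq_maxl orbT.
have qq2 : (q2 <= q)%N by rewrite /q leqW// leq_max leq_maxr orbT.
have q0R : 0 < q%:R :> R by [].
pose mu := (q%:R * u)^-1.
have mu0 : 0 <= mu by rewrite invr_ge0 mulr_ge0// ltW.
have mu2 : mu ^+ 2 = (q%:R * u) ^- 2 by rewrite /mu exprVn.
have mG : measurable [set w | good a N n q mu M w].
  exact: (@measurable_alive_set N n q (fun S => 1 / 2 <= mu * #|S|%:R /\
    mu ^+ 2 * \sum_(i in S) \sum_(j in S) kernel a ((gap i j)%:R / q%:R) <= M)).
exists q, mu; split=> //.
pose A := [set w | mu * #|alive_set N n q w|%:R < 1 / 2].
pose B := [set w | M < mu ^+ 2 * \sum_(i in alive_set N n q w) \sum_(j in alive_set N n q w)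
  kernel a ((gap i j)%:R / q%:R)].
have mA : measurable A.
  exact: (@measurable_alive_set N n q (fun S => mu * #|S|%:R < 1 / 2)).
have mB : measurable B.
  exact: (@measurable_alive_set N n q (fun S => M <
    mu ^+ 2 * \sum_(i in S) \sum_(j in S) kernel a ((gap i j)%:R / q%:R))).
have GC : ~` [set w | good a N n q mu M w] = A `|` B.
  apply/seteqP; split=> w /=.
    move=> /not_andP[/negP|/negP]; rewrite -ltNge => h; [by left|by right].
  by case=> [hA|hB] [h1 h2]; [move: hA|move: hB]; rewrite /A /B /= ltNge ?h1 ?h2.
have pA : pr A <= 4 * delta.
  apply: le_trans (few_alive n q mu N1) _; rewrite mu2.
  have -> : mu * \sum_(i < q) pr (alive N n (i%:R / q%:R)) = 1.
    rewrite (eq_bigr (fun=> u)); last by move=> i _; rewrite (alive_pr dm)// divr_ge0.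
    by rewrite sumr_const card_ord -mulr_natl mulVf// gt_eqF// mulr_gt0.
  by have := hq1 q qq1; move: (_ * _) => y; lra.
have pB : pr B <= energy_bound / M.
  apply: le_trans (energy_markov (kappa := fun i j => kernel a ((gap i j)%:R / q%:R)) n q mu N1 M0 _) _.
    by move=> i j; exact: powR_ge0.
  under eq_bigr do rewrite -mulr_suml; rewrite -mulr_suml mulrA.
  apply: ler_wpM2r; first by rewrite invr_ge0 ltW.
  rewrite mu2; apply: le_trans (energy_mean dm ell_gt0 ell_le a01 series_le n N1 l12 q0) _.
  by rewrite /energy_bound lerD2r; exact: hq2.
have := prU_le P mA mB; rewrite -GC pr_setC//; lra.
Qed.

(** Since [N0] serves all stages, infinitely many stages are good with at least the probability
    guaranteed for each. The choices [delta = eps / 8] and [M = 2 * energy_bound / eps] cost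
    [eps / 2] each. *)
Lemma lower_dimension (eps : R) : 0 < eps -> exists N0, forall N,
  (N0 <= N)%N -> (1 <= N)%N -> (forall k, (N <= k)%N -> ell k <= 1 / 2) ->
  exists E, [/\ measurable E, 1 - eps <= pr E & forall w, E w ->
    survivors D ell N w !=set0 /\
    forall s, 0 < s < a -> hausdorff_measure s (survivors D ell N w) <> 0%E].
Proof.
move=> e0; have W0 := energy_bound_gt0; have /andP[a0 a1] := a01.
pose M := 2 * energy_bound / eps.
have M0 : 0 < M by rewrite divr_gt0// mulr_gt0.
have d0 : 0 < eps / 8 by rewrite divr_gt0.
have [N0 hN0] := good_prob d0 M0.
exists N0 => N NN N1 l12.
have /choice[q /choice[mu hqm]] : forall n, exists q, exists mu,
    [/\ (n <= q)%N, 0 <= mu, measurable [set w | good a N n q mu M w] &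
    1 - 4 * (eps / 8) - energy_bound / M <= pr [set w | good a N n q mu M w]].
  by move=> n; exact: hN0.
pose G n := [set w | good a N n (q n) (mu n) M w].
have mG n : measurable (G n) by have [] := hqm n.
pose H m := \bigcup_(n in [set n | (m <= n)%N]) G n.
have mH m : measurable (H m) by apply: bigcup_measurable => n _.
exists (\bigcap_m H m); split.
- exact: bigcap_measurableType.
- apply: pr_bigcap_ge => //.
    by move=> n w [k /= nk Gk]; exists k => //=; exact: ltnW.
  move=> n; apply: (@le_trans _ _ (pr (G n))).
    have [_ _ _] := hqm n; rewrite -/(G n); apply: le_trans.
    have -> : energy_bound / M = eps / 2 by rewrite /M; field; rewrite !gt_eqF.
    lra.
  by apply: pr_mono => // w Gw; exists n => /=.
move=> w Ew; apply: (good_dim dm N1 _ M0); first by rewrite a0 ltW.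
move=> m; have [n /= mn Gn] := Ew m I; exists n, (q n), (mu n).
by have [nq mu0 _ _] := hqm n.
Qed.

End GoodEvents.

(** * Length sequences *)

Section HarmonicSums.
Variable R : realType.
Implicit Types (n : nat) (c e x : R).

Definition harmonic_sum n : R := \sum_(1 <= k < n.+1) k%:R^-1.

Lemma harmonic_sumS n : harmonic_sum n.+1 = harmonic_sum n + n.+1%:R^-1.
Proof. by rewrite /harmonic_sum big_nat_recr. Qed.

Lemma expR_harmonic_ge n : n.+1%:R <= expR (harmonic_sum n).
Proof.
elim: n => [|n IH]; first by rewrite /harmonic_sum big_geq// expR0.
rewrite harmonic_sumS expRD.
apply: (@le_trans _ _ (n.+1%:R * (1 + n.+1%:R^-1))).
  by rewrite mulrDr mulr1 mulfV// natr1.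
by apply: ler_pM => //; exact: expR_ge1Dx.
Qed.

Lemma inv_succ_le_lnB n : (0 < n)%N -> (n.+1%:R : R)^-1 <= ln n.+1%:R - ln n%:R.
Proof.
move=> n0; have n1 : 0 < n%:R :> R by rewrite ltr0n.
rewrite -ln_div ?posrE// -[leLHS]opprK lerNl -lnV ?posrE ?divr_gt0// invf_div.
rewrite -[leRHS]expRK ler_ln ?posrE ?divr_gt0 ?expR_gt0//.
apply: le_trans (expR_ge1Dx _).
rewrite (_ : n%:R / n.+1%:R = 1 - n.+1%:R^-1 :> R)//.
by rewrite -[in LHS](addrK (1 : R) n%:R) natr1 mulrBl mulfV// mul1r.
Qed.

Lemma expR_harmonic_le n : (0 < n)%N -> expR (harmonic_sum n) <= expR 1 * n%:R.
Proof.
case: n => // n _; elim: n => [|n IH].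
  by rewrite /harmonic_sum big_nat1 invr1 mulr1.
rewrite harmonic_sumS expRD.
have h : expR (n.+2%:R^-1) <= n.+2%:R / n.+1%:R :> R.
  rewrite -[leRHS]lnK ?posrE ?divr_gt0// ler_expR ln_div ?posrE//.
  exact: inv_succ_le_lnB.
apply: le_trans (ler_pM (expR_ge0 _) (expR_ge0 _) IH h) _.
by rewrite le_eqVlt; apply/orP; left; apply/eqP; field; rewrite nat1r pnatr_eq0.
Qed.

Lemma sum_inv_powR e n : 0 < e -> (0 < n)%N ->
  \sum_(1 <= k < n.+1) (k%:R `^ (1 + e))^-1 <= 1 + e^-1 :> R.
Proof.
move=> e0 n0.
(* The subtracted power makes the bound inductive: its increments dominate the terms, as in the
   comparison with an integral. *)
suff : \sum_(1 <= k < n.+1) (k%:R `^ (1 + e))^-1 <= 1 + e^-1 * (1 - n%:R `^ (- e)) :> R.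
  move/le_trans; apply; rewrite lerD2l; apply: ler_piMr; first by rewrite invr_ge0 ltW.
  by rewrite lerBlDr lerDl powR_ge0.
case: n n0 => // n _; elim: n => [|n IH].
  by rewrite big_nat1 !powR1 invr1 subrr mulr0 addr0.
rewrite big_nat_recr//=; apply: le_trans (lerD IH (lexx _)) _.
rewrite -addrA lerD2l -[leRHS]subr0 -lerBrDl.
have p (m : nat) (r : R) : m.+1%:R `^ r = expR (r * ln m.+1%:R) by rewrite /powR pnatr_eq0.
rewrite subr0 -mulrBr opprD opprK addrACA subrr add0r (addrC (- _)).
rewrite !p -expRN mulrDl mul1r opprD expRD expRN lnK ?posrE// mulNr.
set x := ln n.+2%:R; set y := ln n.+1%:R; rewrite mulNr.
have -> : expR (- (e * y)) = expR (- (e * x)) * expR (e * (x - y)).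
  by rewrite -expRD; congr expR; ring.
have h := inv_succ_le_lnB (ltn0Sn n); rewrite -/x -/y in h.
rewrite ler_pdivlMl//.
have h2 : e * n.+2%:R^-1 <= expR (e * (x - y)) - 1.
  rewrite lerBrDl; apply: le_trans (expR_ge1Dx _); rewrite lerD2l.
  by rewrite ler_wpM2l// ltW.
have E0 : 0 <= expR (- (e * x)) by exact: expR_ge0.
have := ler_wpM2l E0 h2; rewrite mulrBr mulr1 => h3.
by rewrite mulrA mulrC.
Qed.

Lemma nneseries_ltyP (f : nat -> R) : (forall n, 0 <= f n) ->
  (\sum_(1 <= n <oo) (f n)%:E < +oo)%E <->
  exists W, forall n, \sum_(1 <= k < n.+1) f k <= W.
Proof.
move=> f0; split=> [h|[W hW]].
  have h0 : (0 <= \sum_(1 <= n <oo) (f n)%:E)%E.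
    by apply: nneseries_ge0 => n _ _; rewrite lee_fin.
  have hf : (\sum_(1 <= n <oo) (f n)%:E)%E \is a fin_num by rewrite ge0_fin_numE.
  exists (fine (\sum_(1 <= n <oo) (f n)%:E)%E) => n; rewrite -lee_fin fineK// -sumEFin.
  by apply: nneseries_lim_ge => k _ _; rewrite lee_fin.
apply: (@le_lt_trans _ _ W%:E); last by rewrite ltry.
apply: lime_le; first by apply: is_cvg_nneseries => n _ _; rewrite lee_fin.
apply: nearW => -[|n]; last by rewrite sumEFin lee_fin.
rewrite big_geq// lee_fin; apply: le_trans (hW 0); by rewrite big_geq.
Qed.

Lemma limn_einf_lty (u : nat -> R) : (limn_einf (fun n => (u n)%:E) < +oo)%E ->
  exists A, forall m : nat, exists2 n, (m <= n)%N & u n <= A.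
Proof.
move=> h; apply: contrapT => H.
have far A : exists m, forall n, (m <= n)%N -> A < u n.
  apply: contrapT => H2; apply: H; exists A => m; apply: contrapT => H3.
  apply: H2; exists m => n mn; rewrite ltNge; apply/negP => un; apply: H3.
  by exists n.
suff : (limn_einf (fun n => (u n)%:E) = +oo)%E by move=> e; rewrite e ltxx in h.
apply: eq_infty => A; rewrite limn_einf_lim.
apply: lime_ge; first exact: is_cvg_einfs.
have [m hm] := far A; exists m => // n /= mn.
by apply: le_ereal_inf_tmp => _ [k /= nk <-]; rewrite lee_fin ltW// hm// (leq_trans mn).
Qed.

End HarmonicSums.

Section LengthSums.
Variables (R : realType) (ell : nat -> R) (M0 M1 : R).
Hypothesis ell_gt0 : forall n, (1 <= n)%N -> 0 < ell n.
Hypothesis M0_gt0 : 0 < M0.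
Hypothesis ell_ge : forall n, (1 <= n)%N -> M0 / n%:R <= ell n.
Hypothesis ell_le : forall n, (1 <= n)%N -> ell n <= M1 / n%:R.
Implicit Types (N n m k : nat) (b c : R).

Local Notation expsum := (expsum ell).

Lemma expsumE n : expsum n = expR (partial_length ell n).
Proof. by []. Qed.

Lemma expsum_gt0 n : 0 < expsum n.
Proof. exact: expR_gt0. Qed.

Lemma powR_le_expsum c n : 0 <= c -> (forall k, (1 <= k)%N -> c / k%:R <= ell k) ->
  n%:R `^ c <= expsum n.
Proof.
move=> c0 h; apply: (@le_trans _ _ (expR (harmonic_sum R n) `^ c)).
  apply: ge0_ler_powR; rewrite ?nnegrE ?expR_ge0//.
  by apply: le_trans (expR_harmonic_ge R n); rewrite ler_nat.
rewrite -expRM ler_expR mulrC mulr_sumr big_nat [leRHS]big_nat.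
by apply: ler_sum => k /andP[k1 _]; exact: h.
Qed.

Lemma expsum_le_powR c n : 0 <= c -> (forall k, (1 <= k)%N -> ell k <= c / k%:R) ->
  (0 < n)%N -> expsum n <= expR c * n%:R `^ c.
Proof.
move=> c0 h n0; apply: (@le_trans _ _ (expR (harmonic_sum R n) `^ c)).
  rewrite -expRM ler_expR [leRHS]mulrC mulr_sumr big_nat [leRHS]big_nat.
  by apply: ler_sum => k /andP[k1 _]; exact: h.
apply: (@le_trans _ _ ((expR 1 * n%:R) `^ c)).
  apply: ge0_ler_powR; rewrite ?nnegrE ?expR_ge0 ?mulr_ge0 ?expR_ge0//.
  exact: expR_harmonic_le.
by rewrite powRM ?expR_ge0// -expRM mul1r.
Qed.

(** Only a factor depending on [N] is lost: [expsum N] contains [ell N] as well, hence an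
    inequality. *)
Lemma tail_length N n : (1 <= N)%N ->
  expR (- \sum_(N <= k < n.+1) ell k) <= expsum N / expsum n.
Proof.
move=> N1; rewrite !expsumE -expRB ler_expR lerNl opprB.
rewrite lerBlDl /partial_length.
pose l k := if (1 <= k)%N then ell k else 0.
have l0 k : 0 <= l k by rewrite /l; case: ifP => // k1; rewrite ltW// ell_gt0.
have e m p : (1 <= m)%N -> \sum_(m <= k < p) ell k = \sum_(m <= k < p) l k.
  by move=> m1; apply: eq_big_nat => k /andP[mk _]; rewrite /l (leq_trans m1 mk).
rewrite !e//; have [nN|Nn] := ltnP n N.
  rewrite [X in _ + X]big_geq// addr0 [leRHS](@big_cat_nat _ _ _ n.+1)//= ?lerDl ?sumr_ge0//.
  by rewrite ltnS ltnW.
rewrite [leLHS](@big_cat_nat _ _ _ N)//=; last by rewrite ltnW// ltnS.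
by rewrite lerD2r [leRHS]big_nat_recr//= lerDl.
Qed.

Definition summable b := exists W, forall n,
  \sum_(1 <= k < n.+1) expsum k / k%:R `^ (1 + b) <= W.

Lemma term_ge0 b k : 0 <= expsum k / k%:R `^ (1 + b).
Proof. by rewrite divr_ge0 ?powR_ge0// ltW// expsum_gt0. Qed.

Lemma summableP b :
  (\sum_(1 <= n <oo) (expsum n / n%:R `^ (1 + b))%:E < +oo)%E <-> summable b.
Proof. exact: (nneseries_ltyP (term_ge0 b)). Qed.

Lemma dominated_summable b c A m : 0 <= A -> c < b ->
  (forall n, (m <= n)%N -> (1 <= n)%N -> expsum n <= A * n%:R `^ c) -> summable b.
Proof.
move=> A0 cb h; pose f k := expsum k / k%:R `^ (1 + b).
have e0 : 0 < b - c by rewrite subr_gt0.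
exists (\sum_(1 <= k < m.+1) f k + A * (1 + (b - c)^-1)) => -[|n].
  rewrite big_geq// addr_ge0 ?sumr_ge0//; first by move=> k _; exact: term_ge0.
  by rewrite mulr_ge0// addr_ge0// invr_ge0 ltW.
apply: (@le_trans _ _ (\sum_(1 <= k < n.+2) ((if (k <= m)%N then f k else 0) +
    A * (k%:R `^ (1 + (b - c)))^-1))).
  rewrite big_nat [leRHS]big_nat; apply: ler_sum => k /andP[k1 _].
  have k0 : 0 < k%:R :> R by rewrite ltr0n.
  case: ifPn => km.
    by rewrite lerDl mulr_ge0// invr_ge0 powR_ge0.
  rewrite add0r; have mk : (m <= k)%N by rewrite ltnW// ltnNge.
  rewrite ler_pdivrMr ?powR_gt0//; apply: le_trans (h k mk k1) _.
  rewrite -mulrA ler_wpM2l// -powRN -powRD ?(gt_eqF k0) ?implybT//.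
  by rewrite le_eqVlt; apply/orP; left; apply/eqP; congr (_ `^ _); ring.
rewrite big_split/= -mulr_sumr; apply: lerD.
  by apply: sum_prefix => k; exact: term_ge0.
by rewrite ler_wpM2l// sum_inv_powR.
Qed.

(** The numerators are at least [k^c], so for [b <= c] the series would dominate the harmonic one.
    Taken at [c = M0] this bounds from below the set whose infimum is [beta0]. *)
Lemma summable_gt b c : 0 <= c -> (forall k, (1 <= k)%N -> c / k%:R <= ell k) ->
  summable b -> c < b.
Proof.
move=> c0 h [W hW]; rewrite ltNge; apply/negP => bc.
have hh n : harmonic_sum R n <= W.
  apply: le_trans (hW n); rewrite /harmonic_sum big_nat [leRHS]big_nat.
  apply: ler_sum => k /andP[k1 _]; have k0 : 0 < k%:R :> R by rewrite ltr0n.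
  rewrite ler_pdivlMr ?powR_gt0//; apply: le_trans (powR_le_expsum k c0 h).
  rewrite -powR_inv1 ?ler0n// -powRD ?(gt_eqF k0) ?implybT//.
  by apply: ler_powR; [rewrite ler1n|lra].
have := expR_harmonic_ge R (Num.truncn (expR W)).
rewrite leNgt => /negP; apply.
apply: le_lt_trans (truncnS_gt (expR W)); by rewrite ler_expR.
Qed.

Lemma beta0E : beta0 ell = inf [set b | summable b].
Proof. by congr (inf _); apply/seteqP; split=> b /summableP. Qed.

Lemma summable_M1 : summable (M1 + 1).
Proof.
have M1p := M1_gt0 ell_gt0 ell_le.
apply: (@dominated_summable _ M1 (expR M1) 1); rewrite ?expR_ge0//; first lra.
by move=> n n1 _; apply: expsum_le_powR => //; exact: ltW.
Qed.

Lemma summable_gt0 b : summable b -> 0 < b.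
Proof. by move=> sb; apply: lt_trans (summable_gt (ltW M0_gt0) ell_ge sb). Qed.

Lemma summable_lbound : has_lbound [set b | summable b].
Proof. by exists 0 => b /= /summable_gt0 /ltW. Qed.

Lemma beta0_le b : summable b -> beta0 ell <= b.
Proof. by move=> sb; rewrite beta0E; apply: (ge_inf summable_lbound). Qed.

Lemma beta0_adherent e : 0 < e -> exists2 b, summable b & beta0 ell <= b < beta0 ell + e.
Proof.
move=> e0; have hi : has_inf [set b | summable b].
  by split; [exists (M1 + 1); exact: summable_M1|exact: summable_lbound].
have [b sb be] := inf_adherent e0 hi; exists b => //.
by rewrite beta0_le//= beta0E.
Qed.

(** Otherwise [expsum n] would be at most [A * n^c] from some index on, and the series would
    converge at the midpoint between [c] and [beta0]. *)
Lemma beta0_frequently c A m : c < beta0 ell -> 0 <= A ->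
  exists n, [/\ (m <= n)%N, (1 <= n)%N & A * n%:R `^ c < expsum n].
Proof.
move=> cb A0; apply: contrapT => H.
have : summable ((c + beta0 ell) / 2).
  apply: (@dominated_summable _ c A m) => //; first lra.
  by move=> n mn n1; rewrite leNgt; apply/negP => h; apply: H; exists n.
by move/beta0_le; lra.
Qed.

Lemma ell_half : exists N0, (1 <= N0)%N /\ forall k, (N0 <= k)%N -> ell k <= 1 / 2.
Proof.
exists (Num.truncn (2 * M1)).+1; split=> // k hk.
have k1 : (1 <= k)%N by exact: leq_trans hk.
apply: le_trans (ell_le k1) _; rewrite ler_pdivrMr ?ltr0n//.
have : 2 * M1 <= k%:R by apply: le_trans (ltW (truncnS_gt _)) _; rewrite ler_nat.
lra.
Qed.

(** Factor by factor [expR (- l) <= expR (2 l^2) * (1 - l)] for [l <= 1 / 2], and the squares have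
    sum at most [2 M1^2]. This passes from the products to the exponentials of partial sums. *)
Lemma expR_le_uprod n : (forall k, (1 <= k)%N -> ell k <= 1 / 2) ->
  (expsum n)^-1 <= expR (4 * M1 ^+ 2) * uprod ell n.
Proof.
move=> l12.
have step k : (1 <= k)%N -> expR (- ell k) <= expR (2 * ell k ^+ 2) * (1 - ell k).
  move=> k1; have l0 := ell_gt0 k1; have l2 := l12 k k1.
  have := expR_ge1Dx (ell k + 2 * ell k ^+ 2); rewrite expRD => h.
  have x0 : 0 <= 1 - ell k by lra.
  rewrite expRN -[leLHS]mul1r ler_pdivrMr ?expR_gt0//.
  apply: (@le_trans _ _ ((1 - ell k) * (1 + (ell k + 2 * ell k ^+ 2)))).
    have -> : (1 - ell k) * (1 + (ell k + 2 * ell k ^+ 2)) =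
      1 + ell k ^+ 2 * (1 - 2 * ell k) by ring.
    by rewrite lerDl mulr_ge0 ?sqr_ge0//; lra.
  apply: le_trans (ler_wpM2l x0 h) _.
  by rewrite le_eqVlt; apply/orP; left; apply/eqP; ring.
rewrite expsumE -expRN /partial_length -sumrN expR_sum.
apply: (@le_trans _ _ (\prod_(1 <= k < n.+1) (expR (2 * ell k ^+ 2) * (1 - ell k)))).
  rewrite big_nat [leRHS]big_nat; apply: ler_prod => k /andP[k1 _].
  by rewrite expR_ge0 step.
rewrite big_split/= -expR_sum; apply: ler_wpM2r.
  rewrite big_nat; apply: prodr_ge0 => k /andP[k1 _].
  by have := l12 k k1; lra.
rewrite ler_expR -mulr_sumr.
apply: (@le_trans _ _ (2 * (M1 ^+ 2 * \sum_(1 <= k < n.+1) (k%:R ^+ 2)^-1))).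
  apply: ler_wpM2l => //; rewrite mulr_sumr big_nat [leRHS]big_nat.
  by apply: ler_sum => k /andP[k1 _]; exact: (ell_sq_le ell_gt0 ell_le).
have := ler_wpM2l (sqr_ge0 M1) (sum_inv_sq R n); lra.
Qed.

End LengthSums.

Lemma beta0_harmonic (R : realType) (ell : nat -> R) c : 0 < c ->
  (forall n, (1 <= n)%N -> ell n = c / n%:R) -> beta0 ell = c.
Proof.
move=> c0 h.
have lge n : (1 <= n)%N -> c / n%:R <= ell n by move=> /h ->.
have lle n : (1 <= n)%N -> ell n <= c / n%:R by move=> /h ->.
have sgt b : c < b -> summable ell b.
  move=> cb; apply: (@dominated_summable _ _ _ c (expR c) 1); rewrite ?expR_ge0//.
  by move=> n n1 _; apply: expsum_le_powR => //; exact: ltW.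
apply/eqP; rewrite eq_le; apply/andP; split.
  by apply/ler_addgt0Pr => e e0; apply: (beta0_le c0 lge); apply: sgt; rewrite ltrDl.
rewrite beta0E; apply: lb_le_inf; first by exists (c + 1); apply: sgt; rewrite ltrDl.
by move=> b /= sb; rewrite ltW// (summable_gt (ltW c0) lge sb).
Qed.

(** * The exceptional times *)

Section ExceptionalEvent.
Context disp (Omega : measurableType disp) (R : realType) (P : probability Omega R).
Local Notation pr := (pr P).

(** [Q] need not be measurable: the points where it fails lie in the complement of every [E k].
    Lower bounds for the dimension become almost sure in this way. *)
Lemma ae_of_pr (Q : Omega -> Prop) :
  (forall eps, 0 < eps -> exists E, [/\ measurable E, 1 - eps <= pr E & forall w, E w -> Q w]) ->
  {ae P, forall w, Q w}.
Proof.
move=> h.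
have /choice[E hE] : forall k : nat, exists E,
    [/\ measurable E, 1 - k.+1%:R^-1 <= pr E & forall w, E w -> Q w].
  by move=> k; apply: h; rewrite invr_gt0.
have mE k : measurable (~` E k) by apply: measurableC; have [] := hE k.
have mI : measurable (\bigcap_k ~` E k) by exact: bigcapT_measurable.
exists (\bigcap_k ~` E k); split=> //.
  rewrite prE//; congr (_%:E); apply/eqP; rewrite eq_le pr_ge0 andbT.
  apply/ler_addgt0Pl => e e0; rewrite addr0.
  pose k := Num.truncn e^-1; have [mk pk _] := hE k.
  apply: (@le_trans _ _ (pr (~` E k))); first by apply: pr_mono => // w; exact.
  rewrite pr_setC//; apply: (@le_trans _ _ (k.+1%:R^-1)).
    by move: pk; move: (_^-1) (pr _) => y z; lra.
  by rewrite -[leRHS]invrK lef_pV2 ?posrE ?invr_gt0// ltW// truncnS_gt.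
by move=> w /= nQ k _ Ek; apply: nQ; have [_ _] := hE k; exact.
Qed.

Variables (F : nat -> set (set Omega)) (D : nat -> R -> Omega -> R) (C : R).
Hypothesis dm : distance_model P F D C.
Variables (ell : nat -> R) (M0 M1 : R).
Hypothesis ell_gt0 : forall n, (1 <= n)%N -> 0 < ell n.
Hypothesis M0_gt0 : 0 < M0.
Hypothesis ell_ge : forall n, (1 <= n)%N -> M0 / n%:R <= ell n.
Hypothesis ell_le : forall n, (1 <= n)%N -> ell n <= M1 / n%:R.
Variable N0 : nat.
Hypothesis N0_ge1 : (1 <= N0)%N.
Hypothesis ell_half_le : forall k, (N0 <= k)%N -> ell k <= 1 / 2.
Implicit Types (N n m k : nat) (a b s : R).

Local Notation survivors := (survivors D ell).
Local Notation survival := (survival D ell).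

(** Starting at [N0] keeps all lengths at most 1/2. Since the union runs over all later starting
    indices, it still yields the whole set of exceptional times. *)
Definition free_times w := \bigcup_n survivors (n + N0) w.

Lemma survivors_neq0 N : (1 <= N)%N ->
  [set w | survivors N w !=set0] = \bigcap_m survival N m.
Proof.
move=> N1; apply/seteqP; split=> w /=.
  move=> [t [t01 h]] m _; exists t; first by rewrite add0r.
  by move=> k; rewrite mem_index_iota => /andP[Nk _]; exact: h.
move=> h; have [||t t01 ht] := @hit_bigcap _ _ D (radius ell) N 0 1 w.
- by move=> n Nn; apply: (dm_cont dm); exact: leq_trans Nn.
- move=> m; have [t t01 ht] := h m I; exists t => // k; rewrite mem_index_iota => /andP[Nk km].
  by apply: ht; rewrite mem_index_iota Nk ltnS ltnW.
by exists t; split; [move: t01; rewrite add0r|exact: ht].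
Qed.

Lemma measurable_survival N m : (1 <= N)%N -> measurable (survival N m).
Proof.
move=> N1; apply: (measurable_uncovered dm) => // k; rewrite mem_index_iota.
by move=> /andP[Nk _]; exact: leq_trans Nk.
Qed.

Lemma addN_ge1 n : (1 <= n + N0)%N.
Proof. by rewrite (leq_trans N0_ge1)// leq_addl. Qed.

Lemma free_times_neq0 :
  [set w | free_times w !=set0] = \bigcup_n \bigcap_m survival (n + N0) m.
Proof.
apply/seteqP; split=> w /=.
  move=> [t [n _ tn]]; exists n => //; rewrite -survivors_neq0 ?addN_ge1//.
  by exists t.
move=> [n _]; rewrite -survivors_neq0 ?addN_ge1// => -[t tn].
by exists t; exists n.
Qed.

Lemma measurable_free_times_neq0 : measurable [set w | free_times w !=set0].
Proof.
rewrite free_times_neq0; apply: bigcupT_measurable => n.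
by apply: bigcapT_measurable => m; apply: measurable_survival; exact: addN_ge1.
Qed.

Lemma ell_le1 n k : (n + N0 <= k)%N -> ell k <= 1.
Proof.
move=> h; apply: (@le_trans _ _ (1 / 2)); last lra.
by apply: ell_half_le; apply: leq_trans h; exact: leq_addl.
Qed.

Lemma no_free_time (A : R) :
  (forall m, exists2 n, (m <= n)%N & n%:R ^+ 2 / expsum ell n <= A) ->
  P [set w | free_times w !=set0] = 0%E.
Proof.
move=> freq; apply/negligibleP; first exact: measurable_free_times_neq0.
rewrite free_times_neq0; apply: negligible_bigcup => n; set N := (n + N0)%N.
have N1 : (1 <= N)%N := addN_ge1 n.
have mS m : measurable (survival N m) by exact: measurable_survival.
have mI : measurable (\bigcap_m survival N m) by exact: bigcapT_measurable.
apply/negligibleP => //; apply: (etrans (prE P mI)); congr (_%:E); apply/eqP; rewrite eq_le pr_ge0 andbT.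
apply/ler_addgt0Pl => e e0; rewrite addr0.
have [|m hm] := @survival_vanishes _ _ _ P F D C dm ell ell_gt0 M0 (A * expsum ell N) N
  M0_gt0 N1 ell_ge (@ell_le1 n) _ e e0; last first.
  by apply: le_trans hm; apply: pr_mono => // w; exact.
move=> m; have [k mk hk] := freq m; exists k => //.
apply: (@le_trans _ _ (k%:R ^+ 2 * (expsum ell N / expsum ell k))).
  by apply: ler_wpM2l; [exact: sqr_ge0|exact: tail_length].
rewrite mulrCA mulrC; apply: ler_wpM2r => //; exact/ltW/expsum_gt0.
Qed.

(** With [a = 1 - b / 2], the power [k^(2a - 3)] is [k^(-1 - b)]; this is the origin of the
    dimension formula. *)
Lemma level_series b k : (1 <= k)%N ->
  level ell (1 - b / 2) k / k%:R ^+ 3 = expsum ell k / k%:R `^ (1 + b).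
Proof.
case: k => // k _; rewrite /level -/(expsum ell k.+1) -mulrA; congr (_ * _).
have k0 : k.+1%:R != 0 :> R by [].
rewrite -powR_mulrn// -!powRN -powRD ?k0 ?implybT//.
by congr (_ `^ _); field.
Qed.

Lemma hausdorff_measure0_sub s (A B : set R) : 0 < s -> A `<=` B ->
  hausdorff_measure s B = 0%E -> hausdorff_measure s A = 0%E.
Proof.
move=> s0 AB hB; apply: ball_cover_measure0 => // delta e d0 e0.
have [c [r [h1 h2 h3]]] := measure0_ball_cover s0 hB d0 e0.
by exists c, r; split=> //; exact: subset_trans h2.
Qed.

(** The energy method is used with exponent [1 - b / 2]. At [b = 2] this is 0: the dimension bound
    is void, but the existence of an uncovered time remains. *)
Lemma free_times_lower b : summable ell b -> b <= 2 -> forall eps, 0 < eps ->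
  exists E, [/\ measurable E, 1 - eps <= pr E & forall w, E w ->
    free_times w !=set0 /\ ((1 - b / 2)%:E <= hausdorff_dim (free_times w))%E].
Proof.
move=> sb b2 eps eps0; have [W hW] := sb.
have b0 : 0 < b := summable_gt0 M0_gt0 ell_ge sb.
have a01 : 0 <= 1 - b / 2 < 1 by lra.
have series_le n : \sum_(1 <= k < n.+1) level ell (1 - b / 2) k / k%:R ^+ 3 <= W.
  apply: le_trans (hW n); rewrite big_nat [leRHS]big_nat.
  by apply: ler_sum => k /andP[k1 _]; rewrite level_series.
have [N' hN'] := lower_dimension dm ell_gt0 ell_le a01 series_le eps0.
have [||E [mE pE hE]] := hN' (N' + N0)%N _ (addN_ge1 N'); first exact: leq_addr.
  by move=> k hk; apply: ell_half_le; apply: leq_trans hk; exact: leq_addl.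
exists E; split=> // w Ew; have [[t st] hs] := hE w Ew; split; first by exists t; exists N'.
apply: hausdorff_dim_ge => s sa h; apply: (hs s sa).
have /andP[s0 _] := sa; apply: hausdorff_measure0_sub h => //.
by move=> u su; exists N'.
Qed.

Lemma free_times_almost_surely : summable ell 2 -> P [set w | free_times w !=set0] = 1%E.
Proof.
move=> s2; have mE := measurable_free_times_neq0.
rewrite prE//; congr (_%:E); apply/eqP; rewrite eq_le pr_le1//=.
apply/ler_addgt0Pl => e e0.
have [E [mE' pE hE]] := free_times_lower s2 (lexx _) e0.
have : pr E <= pr [set w | free_times w !=set0].
  by apply: pr_mono => // w /hE[].
lra.
Qed.

(** Covering by mesh intervals costs [k^(2 - 2 s) / expsum k] up to a constant, and below [beta0]
    the denominator exceeds any multiple of the numerator for infinitely many [k]. *)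
Lemma free_times_measure0 s : 0 < s -> 2 - 2 * s < beta0 ell ->
  {ae P, forall w, hausdorff_measure s (free_times w) = 0%E}.
Proof.
move=> s0 sb.
have h n : {ae P, forall w, hausdorff_measure s (survivors (n + N0) w) = 0%E}.
  apply: (survivors_measure0 dm ell_gt0 s0 (addN_ge1 n) (@ell_le1 n)) => m eps eps0.
  set N := (n + N0)%N; set X := expsum ell N.
  have X0 : 0 < X := expsum_gt0 ell N.
  have A0 : 0 <= X / eps by rewrite divr_ge0// ltW.
  have [k [mk k1 hk]] := beta0_frequently M0_gt0 ell_ge m sb A0.
  exists k => //; have k0 : 0 < k%:R :> R by rewrite ltr0n.
  have e : (k ^ 2)%:R * mesh R k `^ s = k%:R `^ (2 - 2 * s).
    rewrite /mesh natrX -powR_inv1 ?exprn_ge0// -powRrM -powR_mulrn ?ler0n//.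
    by rewrite -powRrM -powRD ?(gt_eqF k0) ?implybT//; congr (_ `^ _); ring.
  rewrite e; have Xk : 0 < expsum ell k := expsum_gt0 ell k.
  apply: (@le_trans _ _ (k%:R `^ (2 - 2 * s) * (X / expsum ell k))).
    by apply: ler_wpM2l; [exact: powR_ge0|apply: (tail_length ell_gt0 k (addN_ge1 n))].
  rewrite mulrA ler_pdivrMr//; move: hk.
  move: (k%:R `^ _) => y; rewrite mulrAC ltr_pdivrMr// => hk.
  by rewrite mulrC (mulrC eps); exact: ltW.
have := ae_foralln h; apply: filterS => w hw.
exact: bigcup_measure0.
Qed.

Lemma free_times_dim :
  {ae P, forall w, hausdorff_dim (free_times w) = (Num.max (1 - beta0 ell / 2) 0)%:E}.
Proof.
set g := Num.max _ _.
have upper : {ae P, forall w, forall j : nat,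
    (hausdorff_dim (free_times w) <= (g + j.+1%:R^-1)%:E)%E}.
  apply: ae_foralln => j; have j0 : 0 < j.+1%:R^-1 :> R by rewrite invr_gt0.
  have g0 : 0 <= g by rewrite le_max lexx orbT.
  have g1 : 1 - beta0 ell / 2 <= g by rewrite le_max lexx.
  have s0 : 0 < g + j.+1%:R^-1 by rewrite ltr_wpDl.
  have := @free_times_measure0 (g + j.+1%:R^-1) s0.
  have hlt : 2 - 2 * (g + j.+1%:R^-1) < beta0 ell by move: j0 g1; move: (_^-1) => y; lra.
  move=> /(_ hlt); apply: filterS => w; exact: hausdorff_dim_le.
have lower : {ae P, forall w, forall j : nat,
    ((1 - beta0 ell / 2 - j.+1%:R^-1)%:E <= hausdorff_dim (free_times w))%E}.
  apply: ae_foralln => j; have j0 : 0 < j.+1%:R^-1 :> R by rewrite invr_gt0.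
  have [b sb /andP[b1 b2]] := beta0_adherent ell_gt0 M0_gt0 ell_ge ell_le j0.
  (* If [b > 2], the claimed lower bound is negative. *)
  have [bl|bg] := leP b 2; last first.
    apply/aeW => w; apply: le_trans (hausdorff_dim_ge0 _); rewrite lee_fin.
    by move: j0 b2; move: (_^-1) => y; lra.
  apply: ae_of_pr => eps eps0.
  have [E [mE pE hE]] := free_times_lower sb bl eps0.
  exists E; split=> // w /hE[_]; apply: le_trans; rewrite lee_fin.
  by move: j0 b2; move: (_^-1) => y; lra.
move: upper lower; apply: filterS2 => w up lo.
have arch (e : R) : 0 < e -> exists j : nat, j.+1%:R^-1 <= e.
  move=> e0; exists (Num.truncn e^-1).
  by rewrite -[leRHS]invrK lef_pV2 ?posrE ?invr_gt0// ltW// truncnS_gt.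
apply/eqP; rewrite eq_le; apply/andP; split.
  apply/lee_addgt0Pr => e e0; have [j hj] := arch e e0.
  by apply: le_trans (up j) _; rewrite -EFinD lee_fin lerD2l.
rewrite /g; have [h|h] := leP (1 - beta0 ell / 2) 0; first exact: hausdorff_dim_ge0.
apply/lee_addgt0Pr => e e0; have [j hj] := arch e e0.
rewrite -leeBlDr//; apply: le_trans (lo j); rewrite -EFinB lee_fin.
by move: hj; move: (_^-1) => y; lra.
Qed.

End ExceptionalEvent.

Lemma exceptional_timesE (R : realType) d (T : measurableType d) (ell : nat -> R)
    (U : nat -> R -> T -> circle R) (x : circle R) (N0 : nat) (w : T) :
  exceptional_times ell U x w =
  free_times (fun n t w => circle_dist (U n (Num.max t 0) w) x) ell N0 w.
Proof.
apply/seteqP; split=> t /=.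
  move=> [t01 h]; have [n hn] : exists n, forall k, (n <= k)%N ->
      ~ circle_arc (U k t w) (ell k) x.
    apply: contrapT => H; apply: h => n _; apply: contrapT => H2; apply: H.
    by exists n => k nk hk; apply: H2; exists k.
  exists n => //; split=> // k nk; have /andP[t0 _] := t01.
  rewrite (max_idPl t0) leNgt; apply/negP; apply: hn.
  by apply: leq_trans nk; exact: leq_addr.
move=> [n _ [t01 h]]; split=> // /(_ (n + N0)%N I) [k /= nk].
have /andP[t0 _] := t01.
by rewrite /circle_arc/= ltNge; apply/negP; have := h k nk; rewrite (max_idPl t0) => ->.
Qed.

Theorem theorem1p2 (R : realType) (d : measure_display)
    (Omega : measurableType d) (P : probability Omega R)
    (ell : nat -> R) (M0 M1 : R) (U : nat -> R -> Omega -> circle R)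
    (x : circle R)
    (ell_gt0 : forall n, (1 <= n)%N -> 0 < ell n)
    (ell_decr : forall m n, (1 <= m)%N -> (m <= n)%N -> ell n <= ell m)
    (ell_cvg0 : ell n @[n --> \oo] --> 0)
    (M0_gt0 : 0 < M0) (M0_le_M1 : M0 <= M1)
    (ell_bounds : forall n, (1 <= n)%N -> M0 / n%:R <= ell n <= M1 / n%:R)
    (model : brownian_circle_model P U) :
  let exceptional := [set w | exists t, 0 <= t <= 1 /\ uncovered_set ell U t w x] in
  let HDexceptional w := hausdorff_dim (exceptional_times ell U x w) in
  [/\
    ((ell 1%N <= 1 / 2 ->
       (limn_einf (fun n => (n%:R ^+ 2 * uprod ell n)%:E) < +oo)%E ->
       P exceptional = 0%E)
     /\
     (forall c : R, (forall n, (1 <= n)%N -> ell n = c / n%:R) -> 2 <= c ->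
       P exceptional = 0%E)),
    (((\sum_(1 <= n <oo) (expsum ell n / n%:R ^+ 3)%:E < +oo)%E ->
       P exceptional = 1%E)
     /\
     (forall c : R, (forall n, (1 <= n)%N -> ell n = c / n%:R) -> 0 < c < 2 ->
       P exceptional = 1%E))
   &
    ({ae P, forall w,
       HDexceptional w = (Num.max (1 - beta0 ell / 2) 0)%:E}
     /\
     (forall c : R, (forall n, (1 <= n)%N -> ell n = c / n%:R) -> 0 < c <= 2 ->
       {ae P, forall w, HDexceptional w = (1 - c / 2)%:E}))].
Proof.
move=> exceptional HDexceptional.
have ell_ge n : (1 <= n)%N -> M0 / n%:R <= ell n by move=> /ell_bounds /andP[].
have ell_le n : (1 <= n)%N -> ell n <= M1 / n%:R by move=> /ell_bounds /andP[].
have [N0 [N01 half]] := ell_half ell_le.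
have dm := brownian_distance_model x model.
have timesE w := exceptional_timesE ell U x N0 w.
have -> : exceptional = [set w | free_times (fun n t w =>
    circle_dist (U n (Num.max t 0) w) x) ell N0 w !=set0].
  by apply/seteqP; split=> w; rewrite /= -timesE.
have dimE := free_times_dim dm ell_gt0 M0_gt0 ell_ge ell_le N01 half.
have vanish := no_free_time dm ell_gt0 M0_gt0 ell_ge N01 half.
have sure := free_times_almost_surely dm ell_gt0 M0_gt0 ell_ge ell_le N01 half.
have HDE : {ae P, forall w, HDexceptional w = (Num.max (1 - beta0 ell / 2) 0)%:E}.
  by move: dimE; apply: filterS => w; rewrite -timesE.
split; split.
- move=> ell1 /limn_einf_lty[A hA].
  have l12 k : (1 <= k)%N -> ell k <= 1 / 2 by move=> k1; apply: le_trans ell1; exact: ell_decr.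
  apply: (vanish (expR (4 * M1 ^+ 2) * A)) => m; have [n mn hn] := hA m; exists n => //.
  apply: (@le_trans _ _ (n%:R ^+ 2 * (expR (4 * M1 ^+ 2) * uprod ell n))).
    by apply: ler_wpM2l; [exact: sqr_ge0|exact: (expR_le_uprod ell_gt0 ell_le)].
  by rewrite mulrCA; apply: ler_wpM2l => //; exact: expR_ge0.
(* The criterion is applied to [expsum] directly, since [1 - ell 1] is negative here:
   [ell k >= 2 / k] gives [expsum n >= n^2]. *)
- move=> c hc c2; apply: (vanish 1) => m; exists m => //.
  have c0 : 0 <= (2 : R) by [].
  have h k : (1 <= k)%N -> 2 / k%:R <= ell k by move=> k1; rewrite hc// ler_wpM2r// invr_ge0.
  have := powR_le_expsum m c0 h; rewrite powR_mulrn// => hm.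
  by rewrite ler_pdivrMr ?mul1r//; exact: expsum_gt0.
- move=> hs; apply: sure; apply/summableP; apply: le_lt_trans hs.
  rewrite le_eqVlt; apply/orP; left; apply/eqP; apply: eq_eseriesr => n _.
  by rewrite -powR_mulrn// nat1r.
- move=> c hc /andP[c0 c2]; apply: sure.
  apply: (@dominated_summable _ _ _ c (expR c) 1); rewrite ?expR_ge0// => n n1 _.
  by apply: expsum_le_powR => //; [exact: ltW|move=> k /hc ->].
- exact: HDE.
- move=> c hc /andP[c0 c2]; move: HDE; rewrite (beta0_harmonic c0 hc) (max_idPl _)//.
  by rewrite subr_ge0 ler_pdivrMr// mul1r.
Qed.
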